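(* Let $d\ge 1$ be an integer, and let $c:(0,\infty)\to(0,\infty)$ be a $C^1$ function such that $c'>0$ on $(0,\infty)$ and $c/c'$ is concave on $(0,\infty)$. Set $$u(t,x)=\int_0^x c(y)^{e^{2t}}\,dy,\qquad t\ge 0,\ x>0,$$ and for every $t\ge 0$ let $v(t,\cdot)$ be the inverse function of $x\mapsto u(t,x)$, $x>0$. Then for any nonnegative, measurable function $f$ on $\mathbb{R}^d$ such that $u(0,f)\in L^1(\gamma_d)$, we have $$v\bigl(t,\|u(t,Q_tf)\|_1\bigr)\le v\bigl(0,\|u(0,f)\|_1\bigr)\qquad\text{for all } t\ge 0.$$
   Context: $\gamma_d$ is the standard Gaussian measure on $\mathbb{R}^d$; $L^p(\gamma_d)$ ($p>0$) is the set of measurable $f:\mathbb{R}^d\to\mathbb{R}$ with $\int|f|^p\,d\gamma_d<\infty$, and $\|f\|_p=\left(\int|f|^p\,d\gamma_d\right)^{1/p}$. The Ornstein-Uhlenbeck semigroup is, for $f\in L^1(\gamma_d)$ and $t\ge 0$, $$(Q_tf)(x)=\int_{\mathbb{R}^d}f\bigl(e^{-t}x+\sqrt{1-e^{-2t}}\,y\bigr)\,\gamma_d(dy),$$ which is finite for $\gamma_d$-a.e. $x$. (The condition $u(0,f)\in L^1(\gamma_d)$ implies $f\in L^1(\gamma_d)$, so $Q_tf$ is well defined.) Conventions: $u(t,0)=0$, $v(t,0)=0$, and $v(t,\infty)=\infty$, so that the inequality includes the assertion $u(t,Q_tf)\in L^1(\gamma_d)$. *)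

(* Defs.v *)
From HB Require Import structures.
From mathcomp Require Import all_boot all_order all_algebra.
From mathcomp Require Import all_classical all_reals all_analysis.

Set Implicit Arguments.
Unset Strict Implicit.
Unset Printing Implicit Defensive.
Import Order.TTheory GRing.Theory Num.Theory.
Import numFieldNormedType.Exports.
Local Open Scope classical_set_scope.
Local Open Scope ring_scope.
Local Open Scope convex_scope.

Section gaussian.
Variable R : realType.

(* measurableTypeR R is R with the syntactic form of the Borel sigma-algebra
   that lebesgue_measure and normal_prob are stated over. *)
Definition tuple_cons n (p : measurableTypeR R * n.-tuple R) : n.+1.-tuple R :=
  [tuple of (p.1 : R) :: p.2].

Lemma measurable_tuple_cons n : measurable_fun setT (@tuple_cons n).
Proof.
have m1 : measurable_fun setT (fun p : measurableTypeR R * n.-tuple R => p.1 : R).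
  exact: measurable_fst.
exact: (measurable_cons m1 measurable_snd).
Qed.

HB.instance Definition _ n :=
  isMeasurableFun.Build _ _ _ _ (@tuple_cons n) (@measurable_tuple_cons n).

(* R^d is d.-tuple R with its product sigma-algebra, which is the Borel one;
   the standard Gaussian measure on it is the d-fold product of N(0, 1). *)
Fixpoint std_gaussian (d : nat) : probability (d.-tuple R) R :=
  if d is n.+1 then
    distribution (normal_prob (0 : R) 1 \x std_gaussian n)%E (@tuple_cons n)
  else dirac [tuple].

Lemma std_gaussian_box d (A : 'I_d -> set R) : (forall i, measurable (A i)) ->
  std_gaussian d [set x | forall i, A i (tnth x i)] =
  (\prod_(i < d) normal_prob (0 : R) 1 (A i))%E.
Proof.
elim: d A => [|n IH] A mA.
  rewrite big_ord0 /= diracE mem_set//.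
  by case.
rewrite big_ord_recl -IH//=.
rewrite /distribution /pushforward -product_measure1E//=.
- congr (product_measure1 _ _ _); apply/seteqP; split=> -[a x] /=.
    move=> h; split; first by have := h ord0; rewrite tnth0.
    by move=> i; have := h (lift ord0 i); rewrite tnthS.
  move=> [h0 h] i; case: (unliftP ord0 i) => [j|] ->; last by rewrite tnth0.
  by rewrite tnthS.
- exact: mA.
- rewrite (_ : [set x | _] = \bigcap_(i in [set: 'I_n])
      ((@tnth _ R ^~ i) @^-1` A (lift ord0 i))).
    apply: fin_bigcap_measurable => // i _; rewrite -[X in measurable X]setTI.
    exact: measurable_tnth.
  by apply/seteqP; split => x /= h i; [move=> _|]; exact: h.
Qed.

End gaussian.

Section ornstein_uhlenbeck.
Context {R : realType} {d : nat}.
Implicit Types (f : d.-tuple R -> R) (x : d.-tuple R) (t : R).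

(* The value is an extended real: for nonnegative f it is +oo on the null set
   of points x where the integral diverges. *)
Definition OU t f x : \bar R :=
  (\int[std_gaussian R d]_y (f [tuple expR (- t) * tnth x i +
     Num.sqrt (1 - expR (- (2 * t))) * tnth y i | i < d])%:E)%E.

End ornstein_uhlenbeck.

Section uv.
Context {R : realType}.
Implicit Types (c : R -> R) (t : R).

(* The upper bound x ranges over [0, +oo], so u c t 0 = 0, and u c t +oo is the
   integral over the whole half-line; c is only used on ]0, +oo[. *)
Definition u c t (x : \bar R) : \bar R :=
  (\int[lebesgue_measure]_(y in [set y : R | 0 < y%:E <= x])
     (c y `^ expR (2 * t))%:E)%E.

(* u c t is a bijection from ]0, +oo[ onto itself when c is positive and
   nondecreasing, so the default value given to 'pinv_ is irrelevant. *)
Definition v c t (s : \bar R) : \bar R :=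
  if s == 0%E then 0%E else if s == +oo%E then +oo%E else
  ('pinv_(fun=> 0) [set x | 0 < x < +oo] (u c t) s)%E.

End uv.

(* The mirror image of convex_function. *)
Definition concave_function (R : numFieldType) (E : lmodType R)
    (E' := convex_lmodType E) (D : set E') (f : E' -> R^o) :=
  forall (t : {i01 R}),
    {in D &, forall (x y : E'), f x <| t |> f y <= f (x <| t |> y)}.

(* Main.v *)
(* Write U = u(0, .), U1 = u(t, .), V = v(0, .), q = e^{2t} and rho = e^{-t}.
   Let P_r be the heat flow and consider, for 0 <= s <= 1,
     A(s) = E U1 (E' V (P_{1-s} (U f)) (sqrt s (rho X + sqrt (1 - rho^2) Y)))
   with X, Y independent standard Gaussian vectors and E' the expectation over
   Y.  Then A(0) = U1 (V (E U f)) and A(1) = E U1 (Q_t f), so it suffices that A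
   does not increase.  Adding a Gaussian increment of variance e splits each of
   the vectors in two, and to second order in the increment the claim becomes
     rho^2 Var(E' g) / k1(E g) <= E' (Var g / k(E g)),
   where k = c / c' and k1 = k / q are the reciprocal curvatures of U and U1:
   the factor rho^2 is the spectral gap of the Ornstein-Uhlenbeck semigroup and
   exactly compensates q, and what remains is the joint convexity of d^2 / k(a)
   in (d, a), which holds because k is concave.

   The spectral gap needs no Hermite expansion.  With phi(rho) the normalised
   squared norm of the Ornstein-Uhlenbeck average of a centred function,
   symmetry and the Cauchy-Schwarz inequality give phi(rho)^2 <= phi(rho^2), and
   splitting a Gaussian vector in two halves gives phi(rho) <= 2 rho^2; together
   they force phi(rho) <= rho^2.

   To have Lipschitz functions in the second order expansions, the interpolation
   stops at s = 1 - r.  Since the variances then add up to 1 - r only, this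
   proves the inequality at a slightly different time, and r tends to 0.
   Unbounded f are reached by truncation and monotone convergence. *)

Require Import Defs.
From HB Require Import structures.
From mathcomp Require Import all_boot all_order all_algebra.
From mathcomp Require Import all_classical all_reals all_analysis.
From mathcomp Require Import measurable_realfun ring lra.

Set Implicit Arguments.
Unset Strict Implicit.
Unset Printing Implicit Defensive.
Import Order.TTheory GRing.Theory Num.Theory.
Import numFieldNormedType.Exports.
Local Open Scope classical_set_scope.
Local Open Scope ring_scope.

(** * Primitives of increasing functions *)

(** No derivative of A is ever taken. Time is cut into N equal steps of length e, and one step is
    bounded with an error [eta * (B * e) + M * (B * e) ^+ 2], where B is fixed by the dimension, the
    range of the data and the smoothing time r, while M may also depend on eta. Choosing eta first
    and N afterwards makes the total error as small as desired. This forces every Taylor bound to be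
    uniform in the probability space and in the function, and forces the functions to stay in a
    segment of ]0, +oo[, since c' is not controlled near 0. Lifting f to a small positive constant
    is cheap, because u(0, .) is continuous at 0.

    The shift in time is traded for a shift in exponent: to reach q at its own time, the
    interpolation is run for q' = (1 - r) q, whose correlation 1 / sqrt q' is brought to 1 / sqrt q
    by the missing variance r. At the end point the leftover smoothing goes the right way, since V
    (P_r (U f)) >= P_r f by convexity of U.

    Stability, the semigroup law and self-adjointness all come from one property: (X, rho X + sg Y)
    is exchangeable when rho^2 + sg^2 = 1, which is read off the joint density in dimension one. *)

Section profile.
Context {R : realType}.

(** Satisfied by c and by its positive powers, so that [u c 0] and [u c t] fall under one theory. *)
Record profile (C dC : R -> R) : Prop := Profile {
  profile_gt0 : forall y : R, 0 < y -> 0 < C y;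
  profile_derive : forall y : R, 0 < y -> is_derive y 1 C (dC y);
  profile_dcont : forall y : R, 0 < y -> {for y, continuous dC};
  profile_dgt0 : forall y : R, 0 < y -> 0 < dC y }.

Definition prim (C : R -> R) (x : R) : R :=
  \int[lebesgue_measure]_(y in `]0, x]) C y.

Lemma within_itv_continuous (f : R -> R) (a b : R) :
  (forall x : R, a <= x <= b -> {for x, continuous f}) ->
  {within `[a, b], continuous f}.
Proof.
move=> cf; apply/continuous_in_subspaceT => x /set_mem/=; rewrite in_itv/=.
exact: cf.
Qed.

Lemma derive_continuous (f : R -> R) (x l : R) :
  is_derive x 1 f l -> {for x, continuous f}.
Proof.
by move=> fl; apply/differentiable_continuous/derivable1_diffP.
Qed.

(** Heine's theorem from the near-covering form of compactness, the radius being the parameter that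
    tends to 0 from the right. Continuity is two-sided at each point, so only x has to lie in the
    segment. *)
Lemma uniform_continuity_segment (f : R -> R) (a b : R) :
  (forall x : R, a <= x <= b -> {for x, continuous f}) ->
  forall eta : R, 0 < eta -> exists2 r : R, 0 < r &
    forall x y : R, a <= x <= b -> `|y - x| < r -> `|f y - f x| <= eta.
Proof.
move=> cf eta eta0.
have := (@segment_compact _ a b : compact _).
move/compact_near_coveringP.
move=> /(_ R (0^'+) (fun r x => forall y, `|y - x| < r -> `|f y - f x| <= eta)).
case.
  move=> x; rewrite /= in_itv/= => xab.
  have := cf x xab; move/cvgrPdist_lt => /(_ (eta / 2)); rewrite divr_gt0//.
  move=> /(_ isT) [e /= e0 He].
  exists ([set x' | `|x - x'| < e / 2], [set r | r < e / 2]) => /=.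
    split; first by exists (e / 2) => //=; rewrite divr_gt0.
    exists (e / 2); first by rewrite /= divr_gt0.
    by move=> r /= + r0; rewrite sub0r normrN gtr0_norm.
  move=> [x' r] /= [xx' re] y yx'.
  have h1 := He x' (lt_trans xx' (ltac:(lra) : e / 2 < e)).
  have xy : `|x - y| < e.
    rewrite (_ : x - y = (x - x') - (y - x')); last by ring.
    by rewrite (le_lt_trans (ler_normB _ _))//; lra.
  have h2 := He y xy.
  rewrite (_ : f y - f x' = (f x - f x') - (f x - f y)); last by ring.
  by rewrite (le_trans (ler_normB _ _))//; lra.
move=> r0 /= r0_gt0 H.
exists (r0 / 2); first by rewrite divr_gt0.
move=> x y xab yx.
apply: (H (r0 / 2)) => //=.
- by rewrite sub0r normrN gtr0_norm ?divr_gt0//; lra.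
- by rewrite divr_gt0.
Qed.

Lemma bounded_segment (f : R -> R) (a b : R) :
  (forall x : R, a <= x <= b -> {for x, continuous f}) ->
  exists2 M : R, 0 < M & forall x : R, a <= x <= b -> `|f x| <= M.
Proof.
move=> cf.
have [ab|ba] := leP a b; last first.
  by exists 1 => // x /andP[ax xb]; have := le_trans ax xb; rewrite leNgt ba.
have cf' : {within `[a, b], continuous f} by exact: within_itv_continuous.
have [c _ Hc] := EVT_max ab cf'.
have [d _ Hd] := EVT_min ab cf'.
exists (`|f c| + `|f d| + 1).
  by have := normr_ge0 (f c); have := normr_ge0 (f d); lra.
move=> x xab.
have := Hc x ltac:(by rewrite in_itv); have := Hd x ltac:(by rewrite in_itv).
have := ler_norm (f c); have := ler_norm (- f d); rewrite normrN.
have := normr_ge0 (f c); have := normr_ge0 (f d).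
by move=> *; rewrite ler_norml; lra.
Qed.

(** The points may come in either order. The bound on [z - a] lets a second application, between a
    and z, be measured by [b - a] again. *)
Lemma MVT_between (f df : R -> R) (lo hi a b : R) : 0 < lo ->
  (forall y : R, 0 < y -> is_derive y 1 f (df y)) ->
  lo <= a <= hi -> lo <= b <= hi ->
  exists z : R, [/\ lo <= z <= hi, `|z - a| <= `|b - a| &
    f b - f a = df z * (b - a)].
Proof.
move=> lo0 fdf /andP[la ah] /andP[lb bh].
have cf x y : lo <= x -> {within `[x, y], continuous f}.
  move=> lx; apply: within_itv_continuous => z /andP[xz _].
  by apply: derive_continuous; apply: fdf; lra.
have [ab|ba] := leP a b.
- have [z| |z] := @MVT_segment _ f df a b ab.
  + by rewrite in_itv/= => /andP[? _]; apply: fdf; lra.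
  + exact: cf.
  + rewrite in_itv/= => /andP[az zb] e; exists z; split => //; first by apply/andP; split; lra.
    by rewrite !ger0_norm; lra.
- have [z| |z] := @MVT_segment _ f df b a (ltW ba).
  + by rewrite in_itv/= => /andP[? _]; apply: fdf; lra.
  + exact: cf.
  + rewrite in_itv/= => /andP[az zb] e; exists z; split => //; first by apply/andP; split; lra.
      by rewrite !ler0_norm; lra.
    by rewrite -opprB e; ring.
Qed.

Section one_profile.
Variables (C dC : R -> R) (pC : profile C dC).
Notation U := (prim C).

Lemma profile_cont y : 0 < y -> {for y, continuous C}.
Proof. by move=> y0; exact/derive_continuous/(profile_derive pC). Qed.

Lemma profile_lt x y : 0 < x -> x < y -> C x < C y.
Proof.
move=> x0 xy.
have [z| |z] := @MVT _ C dC x y xy.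
- by rewrite in_itv/= => /andP[xz _]; apply: (profile_derive pC); lra.
- apply: within_itv_continuous => z xz; apply: profile_cont.
  by move: xz => /andP[]; lra.
- rewrite in_itv/= => /andP[xz _] e.
  by rewrite -subr_gt0 e mulr_gt0 ?subr_gt0// (profile_dgt0 pC)//; lra.
Qed.

Lemma profile_le x y : 0 < x -> x <= y -> C x <= C y.
Proof.
by move=> x0; rewrite le_eqVlt => /orP[/eqP->//|/(profile_lt x0)/ltW].
Qed.

Lemma measurable_profile (x : R) :
  measurable_fun (`]0, x] : set (measurableTypeR R)) C.
Proof.
apply: (measurable_funS (E := (`]0, +oo[ : set (measurableTypeR R)))).
- exact: measurable_itv.
- by move=> y/=; rewrite !in_itv/= andbT => /andP[].
apply: open_continuous_measurable_fun; first exact: interval_open.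
by move=> y /set_mem/=; rewrite in_itv/= andbT => /profile_cont.
Qed.

(** C increases, so on the interval it is bounded by [C x], whatever happens near 0. *)
Lemma integrable_profile (x : R) :
  lebesgue_measure.-integrable `]0, x] (EFin \o C).
Proof.
apply: measurable_bounded_integrable => //.
- rewrite /= lebesgue_measure_itv/=; case: ifP => // _.
  by rewrite ltry.
- exact: measurable_profile.
exists (C x); split; first exact: num_real.
move=> M CM y /=; rewrite in_itv/= => /andP[y0 yx].
rewrite gtr0_norm ?(profile_gt0 pC)//.
by rewrite (le_trans (profile_le y0 yx))// ltW.
Qed.

Lemma prim_le0 x : x <= 0 -> U x = 0.
Proof.
move=> x0; rewrite /prim set_itv_ge ?Rintegral_set0//.
by rewrite bnd_simp -leNgt.
Qed.

Lemma prim0 : U 0 = 0.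
Proof. exact: prim_le0. Qed.

Lemma primB a b : 0 <= a -> a <= b ->
  U b - U a = \int[lebesgue_measure]_(y in `]a, b]) C y.
Proof.
move=> a0 ab; rewrite /prim Rintegral_itvB//; exact: integrable_profile.
Qed.

Lemma Rintegral_cst_itv (a b m : R) : a <= b ->
  \int[lebesgue_measure]_(y in `]a, b]) (cst m y) = m * (b - a).
Proof.
move=> ab; rewrite Rintegral_cst//.
rewrite /= lebesgue_measure_itv/= lte_fin.
by case: ltgtP ab => // -> _; rewrite subrr.
Qed.

(** Monotonicity of C encloses its integral. Strict growth, convexity, the derivative and the range
    of [prim C] are all drawn from these two bounds; the lower one is confined to positive a because
    [C 0] is arbitrary. *)
Lemma prim_sandwich a b : 0 <= a -> a <= b ->
  (0 < a -> C a * (b - a) <= U b - U a) /\ U b - U a <= C b * (b - a).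
Proof.
move=> a0 ab.
have icst (m : R) : lebesgue_measure.-integrable `]a, b] (EFin \o cst m).
  apply: measurable_bounded_integrable => //.
    rewrite /= lebesgue_measure_itv/=; case: ifP => // _.
    by rewrite ltry.
  exists `|m|; split; first exact: num_real.
  by move=> M mM y _; rewrite /= ltW.
have iC : lebesgue_measure.-integrable `]a, b] (EFin \o C).
  apply: (integrableS _ _ _ (integrable_profile b)); try exact: measurable_itv.
  by move=> y/=; rewrite !in_itv/= => /andP[ay ->]; rewrite andbT; lra.
rewrite primB// -!Rintegral_cst_itv//; split=> [a1|].
- apply: le_Rintegral => //.
  by move=> y/=; rewrite in_itv/= => /andP[ay yb]; apply: profile_le => //; lra.
- apply: le_Rintegral => //.
  by move=> y/=; rewrite in_itv/= => /andP[ay yb]; apply: profile_le => //; lra.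
Qed.

Lemma prim_nd : {homo U : x y / x <= y}.
Proof.
move=> x y xy; have [x0|x0] := leP x 0.
  rewrite prim_le0//; apply: Rintegral_ge0 => z /=; rewrite in_itv/=.
  by move=> /andP[z0 _]; rewrite ltW// (profile_gt0 pC).
have [/(_ x0) + _] := prim_sandwich (ltW x0) xy.
move=> h; rewrite -subr_ge0; apply: le_trans h.
by rewrite mulr_ge0 ?subr_ge0// ltW// (profile_gt0 pC).
Qed.

Lemma prim_ge0 x : 0 <= U x.
Proof.
have [x0|x0] := leP x 0; first by rewrite prim_le0.
by rewrite -prim0; apply: prim_nd; exact: ltW.
Qed.

Lemma prim_lt x y : 0 <= x -> x < y -> U x < U y.
Proof.
move=> x0 xy; pose z := (x + y) / 2.
have xz : x < z by rewrite /z; lra.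
have zy : z < y by rewrite /z; lra.
have z0 : 0 < z by lra.
rewrite (le_lt_trans (prim_nd (ltW xz)))// -subr_gt0.
have [/(_ z0) + _] := prim_sandwich (ltW z0) (ltW zy).
by move=> h; apply: lt_le_trans h; rewrite mulr_gt0 ?subr_gt0// (profile_gt0 pC).
Qed.

(** Convexity, in the form that yields Jensen's inequality after integration. *)
Lemma prim_tangent a b : 0 < a -> 0 <= b -> U a + C a * (b - a) <= U b.
Proof.
move=> a0 b0; have [ab|ba] := leP a b.
  by have [/(_ a0)] := prim_sandwich (ltW a0) ab; lra.
by have [_] := prim_sandwich b0 (ltW ba); lra.
Qed.

(** By [prim_sandwich] the difference quotient lies between the values of C at the two end points,
    and C is continuous at a. *)
Lemma is_derive_prim (a : R) : 0 < a -> is_derive a 1 U (C a).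
Proof.
move=> a0.
suff H : h^-1 *: ((U \o shift a) (h *: 1) - U a) @[h --> 0^'] --> C a.
  by apply: DeriveDef; [apply/cvg_ex; exists (C a)|apply/cvg_lim].
apply/cvgrPdist_le => e e0.
have := profile_cont a0; move/cvgrPdist_le => /(_ e e0) [r /= r0 Hr'].
have Hr y : `|a - y| < r -> `|C a - C y| <= e := Hr' y.
near=> h.
have h0 : h != 0 by near: h; exact: nbhs_dnbhs_neq.
have hr : `|h| < r.
  near: h; apply: dnbhs0_lt; exact: r0.
have ha : `|h| < a by near: h; apply: dnbhs0_lt.
rewrite /= /GRing.scale/= mulr1.
have /orP[hp|hn] : (0 < h) || (h < 0) by rewrite orbC -neq_lt.
- have := prim_sandwich (ltW a0) (ltac:(lra) : a <= h + a).
  rewrite addrK => -[/(_ a0) l1 l2].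
  have := Hr (h + a); rewrite opprD addrCA subrr addr0 normrN => /(_ hr).
  rewrite ler_norml => /andP[l3 l4].
  have q1 : C a <= h^-1 * (U (h + a) - U a).
    by rewrite mulrC ler_pdivlMr//.
  have q2 : h^-1 * (U (h + a) - U a) <= C (h + a).
    by rewrite mulrC ler_pdivrMr//.
  by rewrite ler_norml; apply/andP; split; lra.
- have ha' : 0 < h + a by move: ha; rewrite ltr0_norm//; lra.
  have := prim_sandwich (ltW ha') (ltac:(lra) : h + a <= a).
  rewrite (_ : a - (h + a) = - h); last by ring.
  move=> [/(_ ha') l1 l2].
  have := Hr (h + a); rewrite opprD addrCA subrr addr0 normrN => /(_ hr).
  rewrite ler_norml => /andP[l3 l4].
  have q1 : h^-1 * (U (h + a) - U a) <= C a.
    by rewrite mulrC ler_ndivrMr//; lra.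
  have q2 : C (h + a) <= h^-1 * (U (h + a) - U a).
    by rewrite mulrC ler_ndivlMr//; lra.
  by rewrite ler_norml; apply/andP; split; lra.
Unshelve. all: by end_near.
Qed.

(** Right continuity with a = 0 included, where [is_derive_prim] says nothing. *)
Lemma prim_cont a : 0 <= a -> forall e : R, 0 < e ->
  exists2 b : R, a < b & U b <= U a + e.
Proof.
move=> a0 e e0; have Ca : 0 < C (a + 1) by apply: (profile_gt0 pC); lra.
(* Between a and [a + 1] the slope is at most [C (a + 1)]. *)
exists (a + Num.min 1 (e / C (a + 1))).
  by rewrite ltrDl lt_min ltr01 divr_gt0.
set m := Num.min _ _.
have m1 : m <= 1 by rewrite ge_min lexx.
have m2 : m <= e / C (a + 1) by rewrite ge_min lexx orbT.
have m0 : 0 < m by rewrite lt_min ltr01 divr_gt0.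
have [_] := prim_sandwich a0 (ltac:(lra) : a <= a + m).
rewrite [a + m - a]addrC addKr.
have : C (a + m) * m <= C (a + 1) * (e / C (a + 1)).
  apply: ler_pM => //; [|exact: ltW|by apply: profile_le; lra].
  by apply/ltW/(profile_gt0 pC); lra.
rewrite mulrCA divff ?mulr1 ?gt_eqF//; lra.
Qed.

(** Past a positive point the primitive grows at least linearly, since C increases. The left end of
    the segment is taken positive, by [prim_cont] at 0, so that the intermediate value theorem
    applies where continuity is known. *)
Lemma prim_surj s : 0 <= s -> exists2 x : R, 0 <= x & U x = s.
Proof.
rewrite le_eqVlt => /orP[/eqP<-|s0]; first by exists 0; rewrite ?prim0.
have [a a0 Ua] : exists2 a, 0 < a & U a <= s.
  by have [b b0] := prim_cont (lexx 0) s0; rewrite prim0 add0r; exists b.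
pose b := Num.max a 1 + s / C (Num.max a 1).
have m0 : 0 < Num.max a 1 by rewrite lt_max a0.
have Cm0 := profile_gt0 pC m0.
have sC : 0 < s / C (Num.max a 1) by rewrite divr_gt0.
have am : a <= Num.max a 1 by rewrite le_max lexx.
have Ub : s <= U b.
  have [/(_ m0) + _] := @prim_sandwich (Num.max a 1) b (ltW m0) ltac:(rewrite /b; lra).
  rewrite /b [in X in X <= _]addrAC subrr add0r mulrCA divff ?mulr1 ?gt_eqF//.
  by have := prim_ge0 (Num.max a 1); lra.
have ab : a <= b by rewrite /b; lra.
have [||z] := @IVT _ U a b s ab.
- apply: within_itv_continuous => x /andP[ax _].
  by apply: derive_continuous; apply: is_derive_prim; lra.
- by rewrite ge_min Ua le_max Ub orbT.
- by rewrite in_itv/= => /andP[az _] <-; exists z => //; lra.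
Qed.

Lemma prim_inj x y : 0 <= x -> 0 <= y -> U x = U y -> x = y.
Proof.
move=> x0 y0 e; case: (ltgtP x y) => // h.
  by have := prim_lt x0 h; rewrite e ltxx.
by have := prim_lt y0 h; rewrite e ltxx.
Qed.

(* Extended by 0 to the negative half-line, so as to be nondecreasing on R. *)
Definition primV (s : R) : R :=
  if pselect (0 <= s) is left s0 then sval (cid2 (prim_surj s0)) else 0.

Lemma primK s : 0 <= s -> U (primV s) = s.
Proof.
by move=> s0; rewrite /primV; case: pselect => // ?; case: cid2.
Qed.

Lemma primV_ge0 s : 0 <= primV s.
Proof. by rewrite /primV; case: pselect => // ?; case: cid2. Qed.

Lemma primVK x : 0 <= x -> primV (U x) = x.
Proof.
by move=> x0; apply: prim_inj => //; rewrite ?primV_ge0// primK ?prim_ge0.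
Qed.

Lemma primV_nd : {homo primV : x y / x <= y}.
Proof.
move=> x y xy; have [x0|x0] := ltP x 0.
  rewrite {1}/primV; case: pselect => [h|_]; last exact: primV_ge0.
  by have := lt_le_trans x0 h; rewrite ltxx.
rewrite leNgt; apply/negP => h.
have := prim_lt (primV_ge0 _) h; rewrite !primK//; last exact: le_trans xy.
by rewrite ltNge xy.
Qed.

Lemma primV_seg a b s : 0 <= a -> 0 <= b -> U a <= s <= U b ->
  a <= primV s <= b.
Proof.
move=> a0 b0 /andP[as_ sb].
by rewrite -{1}(primVK a0) -(primVK b0) !primV_nd.
Qed.

Lemma profile_dbounded (lo hi : R) : 0 < lo ->
  exists2 D : R, 0 < D & forall x : R, lo <= x <= hi -> dC x <= D.
Proof.
move=> lo0; have [x /andP[lx _]|M M0 HM] := @bounded_segment dC lo hi.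
  by apply: (profile_dcont pC); exact: lt_le_trans lo0 lx.
by exists M => // x xs; rewrite (le_trans (ler_norm _))// HM.
Qed.

Lemma prim_taylor1 (lo hi : R) : 0 < lo ->
  exists2 M : R, 0 < M & forall a b : R,
  lo <= a <= hi -> lo <= b <= hi ->
  `|U b - U a - C a * (b - a)| <= M * (b - a) ^+ 2.
Proof.
move=> lo0; have [D D0 HD] := profile_dbounded hi lo0; exists D => // a b ha hb.
have [z [hz za ->]] := MVT_between lo0 is_derive_prim ha hb.
have [w [hw wa e]] := MVT_between lo0 (profile_derive pC) ha hz.
rewrite -mulrBl e normrM normrM -real_normK ?num_real// expr2 mulrA.
rewrite ler_wpM2r// ler_pM// gtr0_norm ?HD//.
by apply: (profile_dgt0 pC); lra.
Qed.

(** dC is merely continuous, so there is no cubic remainder. Within the radius r of uniform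
    continuity the error is eta times the square; beyond it, the crude quadratic bound becomes a
    fourth power because [(b - a) ^+ 2 / r ^+ 2 >= 1]. *)
Lemma prim_taylor2 (lo hi eta : R) : 0 < lo -> 0 < eta ->
  exists2 M : R, 0 < M & forall a b : R,
  lo <= a <= hi -> lo <= b <= hi ->
  `|U b - U a - C a * (b - a) - dC a / 2 * (b - a) ^+ 2| <=
  eta * (b - a) ^+ 2 + M * (b - a) ^+ 4.
Proof.
move=> lo0 eta0; have [D D0 HD] := profile_dbounded hi lo0.
have [M1 M10 HM1] := prim_taylor1 hi lo0.
have [x /andP[lx _]|r r0 Hr] := @uniform_continuity_segment dC lo hi _ eta eta0.
  by apply: (profile_dcont pC); exact: lt_le_trans lo0 lx.
exists ((M1 + D) / r ^+ 2); first by rewrite divr_gt0 ?addr_gt0// exprn_gt0.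
move=> a b ha hb; have [bar|bar] := ltP `|b - a| r.
  (* The mean value theorem for F, then for C, leaves [(dC w - dC a) * (z - a) * (b - a)]. *)
  pose F y := U y - C a * y - dC a / 2 * (y - a) ^+ 2.
  pose dF y := C y - C a - dC a * (y - a).
  have FdF (y : R) : 0 < y -> is_derive y 1 F (dF y).
    move=> y0; have := is_derive_prim y0 => ?.
    by apply: is_derive_eq; rewrite /dF /GRing.scale/=; field.
  have [z [hz za e]] := MVT_between lo0 FdF ha hb.
  have [w [hw wa e']] := MVT_between lo0 (profile_derive pC) ha hz.
  rewrite (_ : _ - _ = F b - F a); last by rewrite /F; ring.
  rewrite e (_ : dF z = (dC w - dC a) * (z - a)); last first.
    by rewrite /dF e'; ring.
  rewrite (le_trans (y := eta * (b - a) ^+ 2))//; last first.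
    rewrite lerDl mulr_ge0//; last by rewrite exprn_even_ge0.
    by rewrite divr_ge0// ?exprn_ge0 ?addr_ge0// ltW.
  rewrite 2!normrM -[X in _ <= _ * X]real_normK ?num_real// expr2 mulrA.
  rewrite ler_wpM2r// ler_pM//; apply: Hr => //.
  exact: le_lt_trans (le_trans wa za) bar.
have h1 := HM1 a b ha hb.
have h2 : `|dC a / 2 * (b - a) ^+ 2| <= D * (b - a) ^+ 2.
  rewrite normrM [X in _ * X]ger0_norm ?sqr_ge0// ler_wpM2r ?sqr_ge0//.
  have := HD a ha; have : 0 < dC a by apply: (profile_dgt0 pC); lra.
  by move=> ? ?; rewrite gtr0_norm; lra.
apply: (le_trans (ler_normB _ _)); apply: (le_trans (lerD h1 h2)).
rewrite -mulrDl; apply: ler_wpDl.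
  by apply: mulr_ge0; rewrite ?sqr_ge0// ltW.
have -> : (M1 + D) / r ^+ 2 * (b - a) ^+ 4 =
    (M1 + D) * (b - a) ^+ 2 * ((b - a) ^+ 2 / r ^+ 2).
  by field; rewrite gt_eqF.
apply: ler_peMr.
  by apply: mulr_ge0; rewrite ?sqr_ge0// addr_ge0// ltW.
rewrite ler_pdivlMr ?exprn_gt0// mul1r -(real_normK (num_real (b - a))).
by rewrite lerXn2r// ?nnegrE// ltW.
Qed.

(** Above lo, U stretches distances by at least [C lo], so the error of [prim_taylor1] is at most
    [M1 / C lo ^+ 2] times the square of [s - U a]; the third factor [C lo] comes from the division
    by [C a]. *)
Lemma primV_taylor (lo hi : R) : 0 < lo ->
  exists2 M : R, 0 < M & forall a s : R,
  lo <= a <= hi -> U lo <= s <= U hi ->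
  a + (s - U a) / C a - M * (s - U a) ^+ 2 <= primV s.
Proof.
move=> lo0; have [M1 M10 HM1] := prim_taylor1 hi lo0.
have Cl0 := profile_gt0 pC lo0.
exists (M1 / C lo ^+ 3); first by rewrite divr_gt0// exprn_gt0.
move=> a s ha hs.
have lohi : lo <= hi by lra.
have hb := primV_seg (ltW lo0) (le_trans (ltW lo0) lohi) hs.
have s0 : 0 <= s by move: hs => /andP[h _]; rewrite (le_trans _ h)// prim_ge0.
have Ub := primK s0; move: (primV s) hb Ub => b hb Ub.
have h1 := HM1 a b ha hb; rewrite Ub in h1.
have Ca : C lo <= C a by apply: profile_le => //; lra.
have Ca0 : 0 < C a by lra.
have h2 : C lo * `|b - a| <= `|s - U a|.
  rewrite -Ub; have [ab|ba] := leP a b.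
    rewrite !ger0_norm ?subr_ge0 ?prim_nd//.
    have [//|/(_ _) + _] := @prim_sandwich a b _ ab; first by lra.
    move=> /(_ ltac:(lra)) h; apply: le_trans h.
    by rewrite ler_wpM2r ?subr_ge0.
  rewrite !ltr0_norm ?subr_lt0 ?prim_lt//; try lra.
  have [|/(_ _) + _] := @prim_sandwich b a _ (ltW ba); first by lra.
  move=> /(_ ltac:(lra)) h; rewrite !opprB; apply: le_trans h.
  rewrite ler_wpM2r ?subr_ge0 ?(ltW ba)//.
  by apply: profile_le => //; lra.
have h3 : C lo ^+ 2 * (b - a) ^+ 2 <= (s - U a) ^+ 2.
  rewrite -exprMn -(real_normK (num_real (_ * _))).
  rewrite -(real_normK (num_real (s - U a))) lerXn2r ?nnegrE//.
  by rewrite normrM (gtr0_norm Cl0).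
have h4 : (s - U a) / C a <= b - a + M1 * (b - a) ^+ 2 / C lo.
  rewrite ler_pdivrMr// mulrDl.
  have : M1 * (b - a) ^+ 2 <= M1 * (b - a) ^+ 2 / C lo * C a.
    rewrite (_ : _ / _ * _ = M1 * (b - a) ^+ 2 * (C a / C lo)); last by ring.
    apply: ler_peMr; first by apply: mulr_ge0; rewrite ?sqr_ge0// ltW.
    by rewrite ler_pdivlMr// mul1r.
  by move: h1; rewrite ler_norml => /andP[_]; lra.
have h5 : M1 * (b - a) ^+ 2 / C lo <= M1 / C lo ^+ 3 * (s - U a) ^+ 2.
  rewrite (_ : M1 * _ / _ = M1 / C lo ^+ 3 * (C lo ^+ 2 * (b - a) ^+ 2)).
    by rewrite ler_wpM2l// divr_ge0 ?exprn_ge0 ?ltW.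
  by field; rewrite gt_eqF.
lra.
Qed.

End one_profile.

Lemma profile_powR (C dC : R -> R) (q : R) : 0 < q -> profile C dC ->
  profile (fun y => C y `^ q) (fun y => q * C y `^ (q - 1) * dC y).
Proof.
move=> q0 pC; have C0 := profile_gt0 pC; split=> y y0.
- by rewrite powR_gt0 ?C0.
- have := is_derive1_powR q (C0 y y0); have := profile_derive pC y0 => ? ?.
  exact: is_derive1_comp.
- apply: cvgM; last exact: (profile_dcont pC).
  apply: cvgM; first exact: cvg_cst.
  apply: (@continuous_comp _ _ _ C (fun x => x `^ (q - 1))).
    exact: profile_cont pC _ y0.
  exact/derive_continuous/is_derive1_powR/C0.
- by rewrite !mulr_gt0 ?powR_gt0 ?C0 ?(profile_dgt0 pC).
Qed.

End profile.

(** * Expectations of bounded measurable functions *)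

Section bounded_measurable.
Context {R : realType}.

(** Such functions are integrable for every probability measure and closed under algebraic
    operations, monotone maps and partial integration, so the side conditions of linearity and
    Fubini reduce to closure lemmas. *)
Definition bm d (T : measurableType d) (f : T -> R) : Prop :=
  measurable_fun setT f /\ exists M : R, forall x, `|f x| <= M.

Section closure.
Context d (T : measurableType d).
Implicit Types f g : T -> R.

Lemma bm_cst (a : R) : bm (fun _ : T => a).
Proof. by split; [exact: measurable_cst|exists `|a|]. Qed.

Lemma bmD f g : bm f -> bm g -> bm (fun x => f x + g x).
Proof.
move=> [mf [M fM]] [mg [N gN]]; split; first exact: measurable_funD.
by exists (M + N) => x; rewrite (le_trans (ler_normD _ _))// lerD.
Qed.

Lemma bmN f : bm f -> bm (fun x => - f x).
Proof.
move=> [mf [M fM]]; split; first exact: measurable_funN.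
by exists M => x; rewrite normrN.
Qed.

Lemma bmB f g : bm f -> bm g -> bm (fun x => f x - g x).
Proof. by move=> bf bg; apply: bmD => //; exact: bmN. Qed.

Lemma bmM f g : bm f -> bm g -> bm (fun x => f x * g x).
Proof.
move=> [mf [M fM]] [mg [N gN]]; split; first exact: measurable_funM.
by exists (M * N) => x; rewrite normrM ler_pM.
Qed.

Lemma bmX f n : bm f -> bm (fun x => f x ^+ n).
Proof.
move=> bf; elim: n => [|n ih]; first exact: bm_cst.
rewrite (_ : (fun x => _) = (fun x => f x * f x ^+ n)); first exact: bmM.
by apply/funext => x; rewrite exprS.
Qed.

(** Monotonicity alone gives measurability and keeps the range between [h (- M)] and [h M]; [prim]
    and [primV] are applied in this way. *)
Lemma bm_nd f (h : R -> R) : {homo h : x y / x <= y} -> bm f ->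
  bm (fun x => h (f x)).
Proof.
move=> nh [mf [M fM]]; split.
  apply: measurableT_comp => //; exact: nondecreasing_measurable.
exists (`|h M| + `|h (- M)|) => x.
have := fM x; rewrite ler_norml => /andP[/nh h1 /nh h2].
have := ler_norm (h M); have := ler_norm (- h (- M)); rewrite normrN.
have := normr_ge0 (h M); have := normr_ge0 (h (- M)).
by move=> *; rewrite ler_norml; lra.
Qed.

Lemma bm_bounded f (a b : R) : measurable_fun setT f ->
  (forall x, a <= f x <= b) -> bm f.
Proof.
move=> mf fab; split => //; exists (`|a| + `|b|) => x.
have /andP[h1 h2] := fab x.
have := ler_norm b; have := ler_norm (- a); rewrite normrN.
have := normr_ge0 a; have := normr_ge0 b.
by move=> *; rewrite ler_norml; lra.
Qed.

End closure.

Lemma bm_comp d d' (T : measurableType d) (T' : measurableType d')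
    (f : T -> R) (g : T' -> T) :
  bm f -> measurable_fun setT g -> bm (fun x => f (g x)).
Proof.
move=> [mf [M fM]] mg; split; first exact: measurableT_comp.
by exists M.
Qed.

Section integral.
Context d (T : measurableType d) (P : probability T R).
Implicit Types f g : T -> R.

Lemma bm_integrable f : bm f -> P.-integrable setT (EFin \o f).
Proof.
move=> [mf [M fM]]; apply: measurable_bounded_integrable => //.
  by rewrite (le_lt_trans (probability_le1 P _))// ltry.
exists M; split; first exact: num_real.
by move=> N MN x _; exact: le_trans (fM x) (ltW MN).
Qed.

Lemma bm_fin_num f : bm f -> (\int[P]_x (f x)%:E)%E \is a fin_num.
Proof. by move=> bf; apply: integrable_fin_num => //; exact: bm_integrable. Qed.

Lemma bm_EFin_int f : bm f -> (\int[P]_x f x)%:E = (\int[P]_x (f x)%:E)%E.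
Proof. by move=> bf; rewrite fineK// bm_fin_num. Qed.

Lemma EcstE (a : R) : \int[P]_x a = a.
Proof.
have /= -> := Rintegral_cst P measurableT a.
by rewrite (_ : P setT = 1%E) ?mulr1// probability_setT.
Qed.

Lemma ED f g : bm f -> bm g ->
  \int[P]_x (f x + g x) = \int[P]_x f x + \int[P]_x g x.
Proof. by move=> bf bg; rewrite RintegralD//; exact: bm_integrable. Qed.

Lemma EB f g : bm f -> bm g ->
  \int[P]_x (f x - g x) = \int[P]_x f x - \int[P]_x g x.
Proof. by move=> bf bg; rewrite RintegralB//; exact: bm_integrable. Qed.

Lemma EZ f (a : R) : bm f -> \int[P]_x (a * f x) = a * \int[P]_x f x.
Proof. by move=> bf; rewrite RintegralZl//; exact: bm_integrable. Qed.

Lemma Ele f g : bm f -> bm g -> (forall x, f x <= g x) ->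
  \int[P]_x f x <= \int[P]_x g x.
Proof. by move=> bf bg fg; apply: le_Rintegral => //; exact: bm_integrable. Qed.

Lemma Ege0 f : (forall x, 0 <= f x) -> 0 <= \int[P]_x f x.
Proof. by move=> f0; apply: Rintegral_ge0. Qed.

Lemma Enorm f : bm f -> `|\int[P]_x f x| <= \int[P]_x `|f x|.
Proof. by move=> bf; apply: le_normr_Rintegral => //; exact: bm_integrable. Qed.

Lemma Eseg f (a b : R) : bm f -> (forall x, a <= f x <= b) ->
  a <= \int[P]_x f x <= b.
Proof.
move=> bf fab; rewrite -{1}(EcstE a) -(EcstE b).
by apply/andP; split; apply: Ele => //; try exact: bm_cst;
  move=> x; have /andP[] := fab x.
Qed.

Lemma Esqr_le f : bm f -> (\int[P]_x f x) ^+ 2 <= \int[P]_x (f x ^+ 2).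
Proof.
move=> bf; set m := \int[P]_x f x.
have : 0 <= \int[P]_x ((f x - m) ^+ 2) by apply: Ege0 => x; exact: sqr_ge0.
have -> : \int[P]_x ((f x - m) ^+ 2) = \int[P]_x (f x ^+ 2) - m ^+ 2.
  transitivity (\int[P]_x (f x ^+ 2 - ((2 * m) * f x - m ^+ 2))).
    by apply: eq_Rintegral => x _; ring.
  have b1 : bm (fun x => 2 * m * f x) by apply: bmM => //; exact: bm_cst.
  have b2 : bm (fun _ : T => m ^+ 2) := bm_cst _ _.
  rewrite EB; [|exact: bmX|exact: bmB].
  by rewrite EB// EZ// EcstE -/m; ring.
by rewrite subr_ge0.
Qed.

Lemma Eexp4_le f : bm f -> (\int[P]_x f x) ^+ 4 <= \int[P]_x (f x ^+ 4).
Proof.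
move=> bf; rewrite (_ : 4 = 2 * 2)%N// exprM.
apply: (@le_trans _ _ ((\int[P]_x (f x ^+ 2)) ^+ 2)).
  by rewrite lerXn2r ?nnegrE ?sqr_ge0 ?Esqr_le// Ege0// => x; rewrite sqr_ge0.
rewrite (le_trans (Esqr_le (bmX 2 bf)))//.
by rewrite le_eqVlt; apply/orP; left; apply/eqP; apply: eq_Rintegral => x _;
  rewrite -exprM.
Qed.

End integral.

Section fubini.
Context d1 d2 (T1 : measurableType d1) (T2 : measurableType d2).
Variables (P1 : probability T1 R) (P2 : probability T2 R).
Implicit Types f : T1 -> T2 -> R.

Lemma bm_section f x : bm (fun p : T1 * T2 => f p.1 p.2) -> bm (f x).
Proof.
by move=> bf; apply: (bm_comp (g := fun y => (x, y)) bf); exact: measurable_pair1.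
Qed.

Lemma bm_sectionr f y : bm (fun p : T1 * T2 => f p.1 p.2) -> bm (f^~ y).
Proof.
by move=> bf; apply: (bm_comp (g := fun x => (x, y)) bf); exact: measurable_pair2.
Qed.

Lemma bm_int f : bm (fun p : T1 * T2 => f p.1 p.2) ->
  bm (fun x => \int[P2]_y f x y).
Proof.
move=> bf; split.
  apply: measurableT_comp; first exact: fine_measurable.
  (* Measurability of the partial integral involves no measure on T1; a Dirac mass is put there to
     form a product over which the integrand is integrable. *)
  pose D := @dirac _ T1 point R.
  apply: (@measurable_fubini_F _ _ _ _ _ D P2 (fun p => (f p.1 p.2)%:E)).
  exact: (bm_integrable (D \x P2)%E).
have [_ [M fM]] := bf; exists M => x.
have /andP[] := @Eseg _ _ P2 (f x) (- M) M (bm_section x bf)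
  (fun y => ltac:(by rewrite -ler_norml; exact: (fM (x, y)))).
by rewrite ler_norml => -> ->.
Qed.

Lemma Efubini f : bm (fun p : T1 * T2 => f p.1 p.2) ->
  \int[P1]_x \int[P2]_y f x y = \int[P2]_y \int[P1]_x f x y.
Proof.
move=> bf; rewrite {1 3}/Rintegral.
have F := @Fubini _ _ _ _ _ P1 P2 (fun p => (f p.1 p.2)%:E)
  (bm_integrable (P1 \x P2)%E bf).
congr fine; transitivity (\int[P1]_x \int[P2]_y (f x y)%:E)%E.
  by apply: eq_integral => x _; rewrite bm_EFin_int//; exact: bm_section.
rewrite F; apply: eq_integral => y _; rewrite bm_EFin_int//.
exact: bm_sectionr.
Qed.

End fubini.
End bounded_measurable.

Section composition.
Context {R : realType} d d1 d2 d3 d4 (T : measurableType d)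
  (T1 : measurableType d1) (T2 : measurableType d2) (T3 : measurableType d3)
  (T4 : measurableType d4).

Lemma measurable_fstf (g : T -> T1 * T2) :
  measurable_fun setT g -> measurable_fun setT (fun x => (g x).1).
Proof. by move=> mg; exact: measurableT_comp measurable_fst mg. Qed.

Lemma measurable_sndf (g : T -> T1 * T2) :
  measurable_fun setT g -> measurable_fun setT (fun x => (g x).2).
Proof. by move=> mg; exact: measurableT_comp measurable_snd mg. Qed.

Lemma bm_comp2 (F : T1 -> T2 -> R) (g1 : T -> T1) (g2 : T -> T2) :
  bm (fun p : T1 * T2 => F p.1 p.2) ->
  measurable_fun setT g1 -> measurable_fun setT g2 ->
  bm (fun x => F (g1 x) (g2 x)).
Proof.
move=> bF m1 m2; apply: (bm_comp (g := fun x => (g1 x, g2 x)) bF).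
exact: measurable_fun_pair.
Qed.

Lemma bm_comp4 (F : T1 -> T2 -> T3 -> T4 -> R)
    (g1 : T -> T1) (g2 : T -> T2) (g3 : T -> T3) (g4 : T -> T4) :
  bm (fun p : ((T1 * T2) * T3) * T4 => F p.1.1.1 p.1.1.2 p.1.2 p.2) ->
  measurable_fun setT g1 -> measurable_fun setT g2 ->
  measurable_fun setT g3 -> measurable_fun setT g4 ->
  bm (fun x => F (g1 x) (g2 x) (g3 x) (g4 x)).
Proof.
move=> bF m1 m2 m3 m4.
apply: (bm_comp (g := fun x => (((g1 x, g2 x), g3 x), g4 x)) bF).
by repeat apply: measurable_fun_pair.
Qed.

End composition.

(** * Gaussian integrals *)

Section gaussian_line.
Context {R : realType}.
Notation MR := (measurableTypeR R).
Notation leb := (@lebesgue_measure R).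
Notation N01 := (normal_prob (0 : R) 1).
Notation n01 := (normal_pdf (0 : R) 1).
Local Open Scope ereal_scope.

(** The Radon-Nikodym derivative and the explicit density have the same integral over every
    measurable set, hence agree almost everywhere. *)
Lemma ge0_integral_normal (f : MR -> \bar R) :
  measurable_fun [set: MR] f -> (forall x, 0 <= f x) ->
  \int[N01]_x f x = \int[leb]_x (f x * (n01 x)%:E).
Proof.
move=> mf f0.
have dom := @normal_prob_dominates R 0 1.
rewrite -(Radon_Nikodym_SigmaFinite.change_of_variables dom)//.
have mn : measurable_fun [set: MR] (EFin \o n01).
  by apply/measurable_EFinP; exact: measurable_normal_pdf.
apply: ge0_ae_eq_integral => //.
- apply: emeasurable_funM => //.
  apply: measurable_int; exact: Radon_Nikodym_SigmaFinite.f_integrable dom.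
- exact: emeasurable_funM.
- move=> x _; rewrite mule_ge0//.
  exact: Radon_Nikodym_SigmaFinite.f_ge0.
- by move=> x _; rewrite mule_ge0// lee_fin normal_pdf_ge0.
apply: ae_eqe_mul2l; apply: integral_ae_eq => //.
- exact: Radon_Nikodym_SigmaFinite.f_integrable.
- by move=> E _ mE; rewrite -Radon_Nikodym_SigmaFinite.f_integral.
Qed.

(** The image of Lebesgue measure under the affine map, multiplied by s, gives half-open intervals
    their length, hence is Lebesgue measure. *)
Lemma ge0_integral_affine (m s : R) (f : MR -> \bar R) : (0 < s)%R ->
  measurable_fun [set: MR] f -> (forall x, 0 <= f x) ->
  s%:E * \int[leb]_x f (m + s * x)%R = \int[leb]_x f x.
Proof.
move=> s0 mf f0; pose phi (x : MR) : MR := (m + s * x)%R.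
have mphi : measurable_fun [set: MR] phi.
  by apply: measurable_funD => //; exact: measurable_funM.
have uniq A : measurable A ->
    leb A = mscale (NngNum (ltW s0)) (pushforward leb phi) A.
  apply: lebesgue_measure_unique => _ [[a b]] _ <-.
  change (leb `]a, b] = s%:E * leb (phi @^-1` `]a, b]%classic)).
  have -> : phi @^-1` `]a, b]%classic = `]((a - m) / s)%R, ((b - m) / s)%R]%classic.
    apply/seteqP; split => x /=; rewrite !in_itv/= ltr_pdivrMr// ler_pdivlMr//;
      rewrite /phi => /andP[h1 h2]; apply/andP; split; lra.
  rewrite !lebesgue_measure_itv/= !lte_fin.
  rewrite (ltr_pM2r (x := s^-1)) ?invr_gt0// ltrD2r.
  case: ifP => _; last by rewrite mule0.
  by rewrite -EFinB -!EFinD -EFinM; congr EFin; field; rewrite gt_eqF.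
rewrite [RHS](eq_measure_integral (mscale (NngNum (ltW s0)) (pushforward leb phi))).
  rewrite ge0_integral_mscale// ge0_integral_pushforward//.
by move=> A mA _; exact: uniq.
Qed.

(** Joint density of X and [rho * X + sg * Y] for independent standard normal X and Y. *)
Definition ou_density (rho sg x y : R) : R :=
  (n01 x * (n01 ((y - rho * x) / sg) / sg))%R.

Lemma ou_density_ge0 (rho sg x y : R) : (0 < sg)%R ->
  (0 <= ou_density rho sg x y)%R.
Proof.
by move=> s0; rewrite /ou_density mulr_ge0 ?divr_ge0 ?normal_pdf_ge0// ltW.
Qed.

(** The difference of the two exponents is a multiple of [1 - (rho ^+ 2 + sg ^+ 2)]. *)
Lemma ou_density_sym (rho sg x y : R) : (0 < sg)%R ->
  (rho ^+ 2 + sg ^+ 2 = 1)%R -> ou_density rho sg x y = ou_density rho sg y x.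
Proof.
move=> s0 rs; rewrite /ou_density !normal_pdfE ?oner_eq0//.
rewrite /normal_fun !mulrA; congr (_ / _)%R.
have reassoc (a b c d : R) : (a * b * c * d = a * c * (b * d))%R by ring.
rewrite !reassoc -!expRD; congr (_ * expR _)%R.
apply/eqP; rewrite -subr_eq0; apply/eqP.
transitivity ((x ^+ 2 - y ^+ 2) / (2 * sg ^+ 2) * (1 - (rho ^+ 2 + sg ^+ 2)))%R.
  by field; rewrite gt_eqF.
by rewrite rs subrr mulr0.
Qed.

Lemma measurable_ou_density (rho sg : R) :
  measurable_fun [set: MR * MR] (fun p => ou_density rho sg p.1 p.2).
Proof.
apply: measurable_funM.
  by apply: measurableT_comp; [exact: measurable_normal_pdf|exact: measurable_fst].
apply: measurable_funM => //.
apply: measurableT_comp; first exact: measurable_normal_pdf.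
apply: measurable_funM => //.
apply: measurable_funB; first exact: measurable_snd.
by apply: measurable_funM => //; exact: measurable_fst.
Qed.

Lemma ge0_integral_ou (rho sg : R) (F : MR * MR -> \bar R) : (0 < sg)%R ->
  measurable_fun setT F -> (forall p, 0 <= F p) ->
  \int[N01]_x \int[N01]_y F (x, (rho * x + sg * y)%R) =
  \int[leb]_x \int[leb]_y (F (x, y) * (ou_density rho sg x y)%:E).
Proof.
move=> s0 mF F0.
have mG : measurable_fun [set: MR * MR]
    (fun p : MR * MR => F (p.1, (rho * p.1 + sg * p.2)%R)).
  apply: measurableT_comp => //; apply: measurable_fun_pair.
    exact: measurable_fst.
  by apply: measurable_funD; apply: measurable_funM.
rewrite ge0_integral_normal; first last.
- by move=> x; exact: integral_ge0.
- exact: (@measurable_fun_fubini_tonelli_F _ _ _ _ _ N01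
    (fun p : MR * MR => F (p.1, (rho * p.1 + sg * p.2)%R))).
apply: eq_integral => x _.
have mFx : measurable_fun [set: MR] (fun y => F (x, y)).
  exact: measurableT_comp mF (measurable_pair1 x).
rewrite ge0_integral_normal//; last first.
  exact: (measurableT_comp mG (measurable_pair1 x)).
pose f (y : MR) := F (x, y) * (n01 ((y - rho * x) / sg) / sg)%:E.
have mf : measurable_fun [set: MR] f.
  apply: emeasurable_funM => //; apply/measurable_EFinP.
  apply: measurable_funM => //.
  apply: measurableT_comp; first exact: measurable_normal_pdf.
  by apply: measurable_funM => //; exact: measurable_funB.
have f0 y : 0 <= f y.
  by rewrite mule_ge0// lee_fin divr_ge0 ?normal_pdf_ge0// ltW.
transitivity ((\int[leb]_y f y) * (n01 x)%:E); last first.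
  rewrite -ge0_integralZr//; last by rewrite lee_fin normal_pdf_ge0.
  apply: eq_integral => y _; rewrite /f -muleA -EFinM; congr (_ * _%:E).
  by rewrite /ou_density mulrC.
congr (_ * _); rewrite -(ge0_integral_affine (rho * x) s0 mf f0).
rewrite -ge0_integralZl//; last 2 first.
- by apply: measurableT_comp => //; apply: measurable_funD.
- by rewrite lee_fin ltW.
apply: eq_integral => y _; rewrite /f muleCA -EFinM; congr (_ * _%:E).
have -> : ((rho * x + sg * y - rho * x) / sg = y)%R by field; rewrite gt_eqF.
by rewrite mulrCA divff ?mulr1// gt_eqF.
Qed.

Lemma ge0_gauss_sym1 (rho sg : R) (F : MR * MR -> \bar R) : (0 < sg)%R ->
  (rho ^+ 2 + sg ^+ 2 = 1)%R ->
  measurable_fun setT F -> (forall p, 0 <= F p) ->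
  \int[N01]_x \int[N01]_y F (x, (rho * x + sg * y)%R) =
  \int[N01]_x \int[N01]_y F ((rho * x + sg * y)%R, x).
Proof.
move=> s0 rs mF F0; rewrite ge0_integral_ou//.
have mF' : measurable_fun [set: MR * MR] (fun p : MR * MR => F (p.2, p.1)).
  by apply: measurableT_comp => //; exact: measurable_swap.
rewrite [RHS](@ge0_integral_ou rho sg (fun p => F (p.2, p.1)) s0 mF' (fun=> F0 _))/=.
rewrite (@fubini_tonelli _ _ _ _ _ leb leb
  (fun p => F (p.2, p.1) * (ou_density rho sg p.1 p.2)%:E))/=.
- apply: eq_integral => x _; apply: eq_integral => y _.
  by rewrite ou_density_sym.
- apply: emeasurable_funM => //; apply/measurable_EFinP.
  exact: measurable_ou_density.
- by move=> p; rewrite mule_ge0// lee_fin ou_density_ge0.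
Qed.

Lemma normal_pdf1E (x : R) : n01 x = (normal_peak 1 * expR (- (x ^+ 2 / 2)))%R.
Proof.
rewrite normal_pdfE ?oner_eq0// /normal_fun subr0; congr (_ * expR _)%R.
by field.
Qed.

Lemma normal_pdf2E (x : R) :
  normal_pdf 0 2 x = (normal_peak 2 * expR (- (x ^+ 2 / 8)))%R.
Proof.
rewrite normal_pdfE ?pnatr_eq0// /normal_fun subr0; congr (_ * expR _)%R.
by field.
Qed.

Let peak1 : (0 < normal_peak (1 : R))%R.
Proof. by apply: normal_peak_gt0; rewrite oner_eq0. Qed.

Let peak2 : (0 < normal_peak (2 : R))%R.
Proof. by apply: normal_peak_gt0; rewrite pnatr_eq0. Qed.

(** With z = x - w and |w| <= 1: the 2 comes from |z| + 1 <= 2 exp(z^2 / 4), the exponential from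
    x^2 / 8 <= z^2 / 4 + 1 / 4, and the quotient of peaks passes to the density of standard
    deviation 2. Locking keeps it atomic in later arithmetic. *)
Definition shift_const : R :=
  locked (2 * expR 4^-1 * normal_peak 1 / normal_peak (2 : R))%R.

Lemma shift_const_ge0 : (0 <= shift_const)%R.
Proof.
rewrite /shift_const -lock.
apply: mulr_ge0; last by rewrite invr_ge0 ltW.
by rewrite !mulr_ge0 ?expR_ge0 ?(ltW peak1).
Qed.

(* [1 - exp (- t) <= t] with [t] the difference of the two exponents; the
   polynomial factor is absorbed by widening the Gaussian. *)
Lemma normal_pdf_shift (x w : R) : (`|w| <= 1)%R ->
  (n01 (x - w) <= n01 x + `|w| * (shift_const * normal_pdf 0 2 x))%R.
Proof.
move=> w1; have p1 := peak1; have p2 := peak2; set z := (x - w)%R.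
have w2 : (w ^+ 2 <= `|w|)%R.
  by rewrite -real_normK ?num_real// expr2 ler_piMl.
have w0 : (0 <= `|w|)%R by [].
have zw : (z * w <= `|z| * `|w|)%R by rewrite -normrM ler_norm.
have xE : x = (z + w)%R by rewrite /z; ring.
clearbody z.
have h1 : (expR (- (z ^+ 2 / 2)) <= expR (- (x ^+ 2 / 2)) +
    `|w| * (`|z| + 1) * expR (- (z ^+ 2 / 2)))%R.
  have -> : expR (- (x ^+ 2 / 2)) =
      (expR (- (z ^+ 2 / 2)) * expR (- (z * w + w ^+ 2 / 2)))%R.
    by rewrite -expRD xE; congr expR; field.
  rewrite [X in (_ <= _ + X)%R]mulrC -mulrDr ler_peMr ?expR_ge0//.
  have := expR_ge1Dx (- (z * w + w ^+ 2 / 2)); lra.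
have h2 : ((`|z| + 1) * expR (- (z ^+ 2 / 2)) <= 2 * expR (- (z ^+ 2 / 4)))%R.
  rewrite (_ : (- (z ^+ 2 / 2) = (- (z ^+ 2 / 4)) + - (z ^+ 2 / 4))%R); last first.
    by field.
  rewrite expRD mulrA ler_wpM2r ?expR_ge0// expRN ler_pdivrMr ?expR_gt0//.
  have := expR_ge1Dx (z ^+ 2 / 4); rewrite -(real_normK (num_real z)).
  have := sqr_ge0 (`|z| - 1)%R; lra.
have h3 : (expR (- (z ^+ 2 / 4)) <= expR 4^-1 * expR (- (x ^+ 2 / 8)))%R.
  rewrite -expRD ler_expR xE.
  have := sqr_ge0 (z - w)%R; have : (w ^+ 2 <= 1)%R by lra.
  lra.
have h4 : (`|w| * ((`|z| + 1) * expR (- (z ^+ 2 / 2))) <=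
    `|w| * (2 * (expR 4^-1 * expR (- (x ^+ 2 / 8)))))%R.
  by rewrite ler_wpM2l// (le_trans h2)// ler_wpM2l.
rewrite !normal_pdf1E normal_pdf2E /shift_const -lock.
rewrite (_ : (_ + _ = normal_peak 1 * (expR (- (x ^+ 2 / 2)) +
    `|w| * (2 * (expR 4^-1 * expR (- (x ^+ 2 / 8))))))%R); last first.
  by field; rewrite gt_eqF.
by rewrite ler_pM2l//; lra.
Qed.

(** Squaring x^2 / 8 <= exp(x^2 / 8) gives the 64; the remaining exp(- x^2 / 4) is below the wider
    Gaussian. *)
Lemma normal_pdf_exp4 (x : R) :
  (x ^+ 4 * n01 x <= 64 * normal_peak 1 / normal_peak 2 * normal_pdf 0 2 x)%R.
Proof.
have p1 := peak1; have p2 := peak2.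
rewrite normal_pdf1E normal_pdf2E.
rewrite (_ : (_ / _ * _ = normal_peak 1 * (64 * expR (- (x ^+ 2 / 8))))%R); last first.
  by field; rewrite gt_eqF.
rewrite mulrCA ler_pM2l//.
have h : (x ^+ 4 <= 64 * (expR (x ^+ 2 / 8) * expR (x ^+ 2 / 8)))%R.
  have := expR_ge1Dx (x ^+ 2 / 8) => h.
  have x2 : (0 <= x ^+ 2 / 8)%R by rewrite divr_ge0 ?sqr_ge0.
  have h' : ((x ^+ 2 / 8) * (x ^+ 2 / 8) <= expR (x ^+ 2 / 8) * expR (x ^+ 2 / 8))%R.
    by apply: ler_pM => //; lra.
  rewrite (_ : (x ^+ 4 = 64 * ((x ^+ 2 / 8) * (x ^+ 2 / 8)))%R); last by field.
  by rewrite ler_pM2l.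
apply: (@le_trans _ _ (64 * (expR (x ^+ 2 / 8) * expR (x ^+ 2 / 8)) *
    expR (- (x ^+ 2 / 2))))%R; first by rewrite ler_wpM2r ?expR_ge0.
rewrite -!mulrA ler_pM2l// -!expRD ler_expR.
by have := sqr_ge0 x; lra.
Qed.

End gaussian_line.

(** * Translations and moments on the line, and Gaussian integrals one coordinate at a time *)

Section gaussian_space.
Context {R : realType}.
Notation MR := (measurableTypeR R).
Notation N01 := (normal_prob (0 : R) 1).
Notation leb := (@lebesgue_measure R).

Lemma gauss_sym1 (rho sg : R) (F : MR -> MR -> R) : 0 < sg ->
  rho ^+ 2 + sg ^+ 2 = 1 -> bm (fun p : MR * MR => F p.1 p.2) ->
  \int[N01]_x \int[N01]_y F x (rho * x + sg * y) =
  \int[N01]_x \int[N01]_y F (rho * x + sg * y) x.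
Proof.
move=> s0 rs bF.
have mL : measurable_fun [set: MR * MR]
    (fun p : MR * MR => rho * p.1 + sg * p.2 : MR).
  by apply: measurable_funD; apply: measurable_funM.
have [mF [M FM]] := bF.
have bF1 : bm (fun p : MR * MR => F p.1 (rho * p.1 + sg * p.2)).
  apply: (bm_comp (g := fun p : MR * MR => (p.1, rho * p.1 + sg * p.2)) bF).
  exact: measurable_fun_pair.
have bF2 : bm (fun p : MR * MR => F (rho * p.1 + sg * p.2) p.1).
  apply: (bm_comp (g := fun p : MR * MR => (rho * p.1 + sg * p.2, p.1)) bF).
  exact: measurable_fun_pair.
have E (H : MR -> MR -> R) : bm (fun p : MR * MR => H p.1 p.2) ->
    \int[N01]_x \int[N01]_y H x y + M =
    \int[N01]_x \int[N01]_y (H x y + M).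
  move=> bH; rewrite -{1}(EcstE N01 M) -ED//; [|exact: bm_int|exact: bm_cst].
  apply: eq_Rintegral => x _; rewrite ED ?EcstE//; last exact: bm_cst.
  exact: (bm_section x bH).
(* Adding the bound M makes the integrand nonnegative, as [ge0_gauss_sym1] demands. *)
apply: (addIr M); rewrite (E _ bF1) (E _ bF2).
have E2 (H : MR -> MR -> R) : bm (fun p : MR * MR => H p.1 p.2) ->
    \int[N01]_x \int[N01]_y (H x y + M) =
    fine (\int[N01]_x \int[N01]_y (H x y + M)%:E).
  move=> bH; congr fine; apply: eq_integral => x _; rewrite bm_EFin_int//.
  by apply: bmD; [exact: (bm_section x bH)|exact: bm_cst].
rewrite (E2 _ bF1) (E2 _ bF2); congr fine.
apply: (@ge0_gauss_sym1 _ rho sg (fun p => (F p.1 p.2 + M)%:E)) => //.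
- by apply/measurable_EFinP; apply: measurable_funD => //.
- move=> p; rewrite lee_fin; have := FM p; rewrite ler_norml => /andP[]; lra.
Qed.

(** A change of variable moves the translation onto the density, where [normal_pdf_shift] applies;
    the widened density integrates to 1. *)
Let gauss_shift1_le (phi : MR -> R) (M w : R) : measurable_fun setT phi ->
  (forall x, 0 <= phi x <= M) -> `|w| <= 1 ->
  \int[N01]_x phi (w + x) <= \int[N01]_x phi x + M * shift_const * `|w|.
Proof.
move=> mphi phiM w1.
have M0 : 0 <= M by have /andP[h1 h2] := phiM 0; apply: le_trans h2.
have phi0 x : 0 <= phi x by have /andP[] := phiM x.
have sc := @shift_const_ge0 R.
have bphi : bm phi by exact: bm_bounded phiM.
have mw : measurable_fun [set: MR] (fun x => w + x : MR) by exact: measurable_funD.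
have bphiw : bm (fun x : MR => phi (w + x)) by exact: bm_comp bphi mw.
rewrite -lee_fin EFinD !bm_EFin_int//.
rewrite !ge0_integral_normal//; last 3 first.
- exact/measurable_EFinP.
- by apply/measurable_EFinP; have [] := bphiw.
- by move=> x; rewrite lee_fin.
have mn : measurable_fun [set: MR] (normal_pdf (0:R) 1 : MR -> R).
  exact: measurable_normal_pdf.
have mn2 : measurable_fun [set: MR] (normal_pdf (0:R) 2 : MR -> R).
  exact: measurable_normal_pdf.
have mnw : measurable_fun [set: MR] (fun x : MR => normal_pdf 0 1 (x - w)).
  by apply: measurableT_comp => //; exact: measurable_funB.
pose f (x : MR) := (phi x * normal_pdf 0 1 (x - w))%:E.
rewrite (_ : (\int[leb]_x _ = \int[leb]_x f x)%E); last first.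
  have := @ge0_integral_affine _ w 1 f ltr01.
  rewrite mul1e => <-; last 2 first.
  - by apply/measurable_EFinP; exact: measurable_funM.
  - by move=> x; rewrite lee_fin mulr_ge0// normal_pdf_ge0.
  apply: eq_integral => x _; rewrite /f mul1r -EFinM.
  by rewrite (_ : w + x - w = x)//; ring.
have -> : (M * shift_const * `|w|)%:E =
    (\int[leb]_x ((M * shift_const * `|w|)%:E * (normal_pdf 0 2 x)%:E))%E.
  rewrite ge0_integralZl//.
  - by rewrite integral_normal_pdf mule1.
  - exact/measurable_EFinP.
  - by move=> x _; rewrite lee_fin normal_pdf_ge0.
  - by rewrite lee_fin mulr_ge0// mulr_ge0.
rewrite -ge0_integralD//; last 4 first.
- by move=> x _; rewrite mule_ge0 ?lee_fin ?normal_pdf_ge0.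
- by apply: emeasurable_funM; exact/measurable_EFinP.
- by move=> x _; rewrite -EFinM lee_fin mulr_ge0 ?normal_pdf_ge0// mulr_ge0// mulr_ge0.
- by apply: emeasurable_funM => //; exact/measurable_EFinP.
apply: ge0_le_integral => //.
- by move=> x _; rewrite lee_fin mulr_ge0 ?normal_pdf_ge0.
- by apply/measurable_EFinP; exact: measurable_funM.
- by apply/emeasurable_funD; apply: emeasurable_funM => //; exact/measurable_EFinP.
- move=> x _; rewrite -!EFinM -EFinD lee_fin.
  have /andP[p0 pM] := phiM x.
  apply: (le_trans (ler_wpM2l p0 (normal_pdf_shift x w1))).
  rewrite mulrDr lerD2l.
  rewrite (_ : M * _ * _ * _ = M * (`|w| * (shift_const * normal_pdf 0 2 x))); last by ring.
  by rewrite ler_wpM2r// mulr_ge0// mulr_ge0 ?normal_pdf_ge0.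
Qed.

(** The reverse bound is [gauss_shift1_le] for the translated function and [- w]. The extra 1 in the
    constant covers |w| > 1, where the difference is at most M anyway. *)
Lemma gauss_shift1 (phi : MR -> R) (M w : R) : measurable_fun setT phi ->
  (forall x, 0 <= phi x <= M) ->
  `|\int[N01]_x phi (w + x) - \int[N01]_x phi x| <= M * (shift_const + 1) * `|w|.
Proof.
move=> mphi phiM.
have M0 : 0 <= M by have /andP[h1 h2] := phiM 0; apply: le_trans h2.
have mw : measurable_fun [set: MR] (fun x => w + x : MR) by exact: measurable_funD.
have mphiw : measurable_fun [set: MR] (fun x : MR => phi (w + x)).
  exact: measurableT_comp mphi mw.
have sc := @shift_const_ge0 R.
have [w1|w1] := leP `|w| 1.
  have h1 := gauss_shift1_le mphi phiM w1.
  have h2 := @gauss_shift1_le (fun x => phi (w + x)) M (- w) mphiw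
    (fun x => phiM (w + x)).
  rewrite normrN in h2; have {h2} := h2 w1.
  rewrite (_ : (fun x => phi (w + (- w + x))) = phi); last first.
    by apply/funext => x; rewrite addNKr.
  have : 0 <= M * `|w| by rewrite mulr_ge0.
  rewrite ler_norml; lra.
have /andP[h1 h2] := @Eseg _ _ _ N01 phi 0 M (bm_bounded mphi phiM) phiM.
have /andP[h3 h4] := @Eseg _ _ _ N01 (fun x => phi (w + x)) 0 M
  (bm_bounded mphiw (fun x => phiM (w + x))) (fun x => phiM (w + x)).
have h : M <= M * (shift_const + 1) * `|w|.
  rewrite -mulrA; apply: ler_peMr => //; apply: (le_trans (ltW w1)).
  by apply: ler_peMl => //; lra.
rewrite ler_norml; lra.
Qed.

Lemma N01_exp4_lty : (\int[N01]_x (x ^+ 4)%:E < +oo)%E.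
Proof.
have p1 : 0 < normal_peak (1 : R) by apply: normal_peak_gt0; rewrite oner_eq0.
have p2 : 0 < normal_peak (2 : R) by apply: normal_peak_gt0; rewrite pnatr_eq0.
have mn : measurable_fun [set: MR] (normal_pdf (0:R) 1 : MR -> R).
  exact: measurable_normal_pdf.
have mn2 : measurable_fun [set: MR] (normal_pdf (0:R) 2 : MR -> R).
  exact: measurable_normal_pdf.
have x40 (x : R) : 0 <= x ^+ 4 by rewrite exprn_even_ge0.
rewrite ge0_integral_normal//; last first.
  by apply/measurable_EFinP; exact: measurable_funX.
pose k : R := 64 * normal_peak 1 / normal_peak 2.
have k0 : 0 <= k.
  by rewrite /k; apply: mulr_ge0; rewrite ?invr_ge0 ?(ltW p2)// mulr_ge0// ltW.
apply: (@le_lt_trans _ _ (\int[leb]_x (k%:E * (normal_pdf 0 2 x)%:E))%E).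
  apply: ge0_le_integral => //.
  - by move=> x _; rewrite -EFinM lee_fin mulr_ge0 ?normal_pdf_ge0.
  - apply/emeasurable_funM; last exact/measurable_EFinP.
    by apply/measurable_EFinP; exact: measurable_funX.
  - by apply/emeasurable_funM => //; exact/measurable_EFinP.
  - by move=> x _; rewrite -!EFinM lee_fin normal_pdf_exp4.
rewrite ge0_integralZl//.
- by rewrite integral_normal_pdf mule1 ltry.
- exact/measurable_EFinP.
- by move=> x _; rewrite lee_fin normal_pdf_ge0.
Qed.

(** All linear changes of variables use this one operation: scaling by c is [lin c 0 x x],
    translation by w is [lin 1 1 w x]. *)
Definition lin n (a b : R) (x y : n.-tuple R) : n.-tuple R :=
  [tuple a * tnth x i + b * tnth y i | i < n].

Lemma tnth_lin n (a b : R) (x y : n.-tuple R) i :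
  tnth (lin a b x y) i = a * tnth x i + b * tnth y i.
Proof. by rewrite tnth_mktuple. Qed.

Lemma measurable_lin d (T : measurableType d) n (a b : R)
    (f g : T -> n.-tuple R) :
  measurable_fun setT f -> measurable_fun setT g ->
  measurable_fun setT (fun x => lin a b (f x) (g x)).
Proof.
move=> mf mg; apply/measurable_fun_tnthP => i.
rewrite (_ : _ \o _ = fun x => a * tnth (f x) i + b * tnth (g x) i).
  apply: measurable_funD; apply: measurable_funM => //.
  - exact: (measurable_fun_tnthP f).1.
  - exact: (measurable_fun_tnthP g).1.
by apply/funext => x /=; rewrite tnth_lin.
Qed.

Lemma lin_cons n (a b u v : R) (x y : n.-tuple R) :
  lin a b (tuple_cons (u, x)) (tuple_cons (v, y)) =
  tuple_cons (a * u + b * v, lin a b x y).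
Proof.
apply: eq_from_tnth => i; rewrite tnth_lin /tuple_cons /=.
case: (unliftP ord0 i) => [j|] ->; first by rewrite !tnthS tnth_lin.
by rewrite !tnth0.
Qed.

Notation gam := (std_gaussian R).

Lemma ge0_integral_gauss_cons n (f : n.+1.-tuple R -> \bar R) :
  measurable_fun setT f -> (forall x, 0 <= f x)%E ->
  (\int[gam n.+1]_x f x = \int[N01]_a \int[gam n]_x f (tuple_cons (a, x)))%E.
Proof.
move=> mf f0; rewrite /= ge0_integral_distribution//.
have mf' : measurable_fun [set: MR * n.-tuple R] (f \o @tuple_cons R n).
  exact: measurableT_comp.
rewrite (@fubini_tonelli1 _ _ _ _ _ N01 (gam n) (f \o @tuple_cons R n))//.
by move=> p; exact: f0.
Qed.

Lemma bm_cons n (f : n.+1.-tuple R -> R) : bm f ->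
  bm (fun p : MR * n.-tuple R => f (tuple_cons (p.1, p.2))).
Proof. by move=> bf; apply: bm_comp bf _; exact: measurable_tuple_cons. Qed.

Lemma E_cons n (f : n.+1.-tuple R -> R) : bm f ->
  \int[gam n.+1]_x f x = \int[N01]_a \int[gam n]_x f (tuple_cons (a, x)).
Proof.
move=> bf; have bf' := bm_cons bf.
have if' : (N01 \x gam n)%E.-integrable setT (EFin \o (f \o @tuple_cons R n)).
  exact: bm_integrable bf'.
rewrite {1}/Rintegral /= integral_distribution//; last first.
  by apply/measurable_EFinP; have [] := bf.
congr fine; rewrite -(@integral12_prod_meas1 _ _ _ _ _ N01 (gam n) _ if').
apply: eq_integral => a _; rewrite bm_EFin_int//.
exact: (bm_section (f := fun a x => f (tuple_cons (a, x))) a bf').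
Qed.

Lemma measurable_tuple_consf d (T : measurableType d) n
    (f : T -> R) (g : T -> n.-tuple R) :
  measurable_fun setT f -> measurable_fun setT g ->
  measurable_fun setT (fun x => tuple_cons (f x, g x)).
Proof. by move=> mf mg; exact: measurable_cons mf mg. Qed.

End gaussian_space.

Ltac meas := repeat (lazymatch goal with
  | |- measurable_fun _ (fun x => x) => exact: measurable_id
  | |- measurable_fun _ (fun x => fst _) => apply: measurable_fstf
  | |- measurable_fun _ (fun x => snd _) => apply: measurable_sndf
  | |- measurable_fun _ (fun x => (_, _)) => apply: measurable_fun_pair
  | |- measurable_fun _ fst => exact: measurable_fst
  | |- measurable_fun _ snd => exact: measurable_snd
  | |- measurable_fun _ (lin ?a ?b ?x) =>
      apply: (@measurable_lin _ _ _ _ a b (fun=> x) (fun y => y))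
  | |- measurable_fun _ (fun x => lin _ _ _ _) => apply: measurable_lin
  | |- measurable_fun _ (fun x => tuple_cons (_, _)) =>
      apply: measurable_tuple_consf
  | |- measurable_fun _ (fun x => _ + _) => apply: measurable_funD
  | |- measurable_fun _ (fun x => _ * _) => apply: measurable_funM
  | |- measurable_fun _ (fun x => ?a) => exact: measurable_cst
  end).

(** * Exchangeability, translations and fourth moments in dimension n *)

Section gaussian_symmetry.
Context {R : realType}.
Notation MR := (measurableTypeR R).
Notation N01 := (normal_prob (0 : R) 1).
Notation gam := (std_gaussian R).

Section exchange.
Context d1 d2 d3 d4 (T1 : measurableType d1) (T2 : measurableType d2)
  (T3 : measurableType d3) (T4 : measurableType d4).
Variables (P1 : probability T1 R) (P2 : probability T2 R)
  (P3 : probability T3 R) (P4 : probability T4 R).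

Lemma Efubini23 (H : T1 -> T2 -> T3 -> T4 -> R) :
  bm (fun p : ((T1 * T2) * T3) * T4 => H p.1.1.1 p.1.1.2 p.1.2 p.2) ->
  \int[P1]_a \int[P2]_x \int[P3]_b \int[P4]_y H a x b y =
  \int[P1]_a \int[P3]_b \int[P2]_x \int[P4]_y H a x b y.
Proof.
move=> bH; apply: eq_Rintegral => a _; apply: Efubini; apply: bm_int.
by apply: (bm_comp4 bH); meas.
Qed.

Lemma Efubini_pairs (H : T1 -> T2 -> T3 -> T4 -> R) :
  bm (fun p : ((T1 * T2) * T3) * T4 => H p.1.1.1 p.1.1.2 p.1.2 p.2) ->
  \int[P1]_a \int[P2]_x \int[P3]_b \int[P4]_y H a x b y =
  \int[P2]_x \int[P4]_y \int[P1]_a \int[P3]_b H a x b y.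
Proof.
move=> bH; rewrite Efubini; last first.
  by apply: bm_int; apply: bm_int; apply: (bm_comp4 bH); meas.
apply: eq_Rintegral => x _.
transitivity (\int[P1]_a \int[P4]_y \int[P3]_b H a x b y).
  apply: eq_Rintegral => a _; apply: Efubini.
  by apply: (bm_comp4 bH); meas.
by apply: Efubini; apply: bm_int; apply: (bm_comp4 bH); meas.
Qed.

End exchange.

(** Reversibility of the Ornstein-Uhlenbeck process. By induction on the dimension: the tails are
    exchanged with the heads frozen, then the heads with the tails frozen, Fubini bringing the
    relevant pair of integrals innermost. *)
Lemma gauss_sym n (rho sg : R) (F : n.-tuple R -> n.-tuple R -> R) : 0 < sg ->
  rho ^+ 2 + sg ^+ 2 = 1 ->
  bm (fun p : n.-tuple R * n.-tuple R => F p.1 p.2) ->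
  \int[gam n]_x \int[gam n]_y F x (lin rho sg x y) =
  \int[gam n]_x \int[gam n]_y F (lin rho sg x y) x.
Proof.
move=> s0 rs; elim: n F => [|n ih] F bF.
  apply: eq_Rintegral => x _; apply: eq_Rintegral => y _.
  by rewrite (tuple0 x) (tuple0 (lin _ _ _ _)).
have split (G : n.+1.-tuple R -> n.+1.-tuple R -> R) :
    bm (fun p : n.+1.-tuple R * n.+1.-tuple R => G p.1 p.2) ->
    \int[gam n.+1]_x \int[gam n.+1]_y G x y =
    \int[N01]_a \int[gam n]_x \int[N01]_b \int[gam n]_y
      G (tuple_cons (a, x)) (tuple_cons (b, y)).
  move=> bG; rewrite E_cons; last exact: bm_int.
  apply: eq_Rintegral => a _; apply: eq_Rintegral => x _.
  by rewrite E_cons//; exact: (bm_section (f := G) _ bG).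
rewrite (split (fun x y => F x (lin rho sg x y))); last first.
  by apply: (bm_comp2 bF); meas.
rewrite (split (fun x y => F (lin rho sg x y) x)); last first.
  by apply: (bm_comp2 bF); meas.
(* In H1 nothing is exchanged, in H2 the tails are, in H3 the heads as well. *)
pose H1 (a : MR) x (b : MR) y :=
  F (tuple_cons (a, x)) (tuple_cons (rho * a + sg * b, lin rho sg x y)).
pose H2 (a : MR) x (b : MR) y :=
  F (tuple_cons (a, lin rho sg x y)) (tuple_cons (rho * a + sg * b, x)).
pose H3 (a : MR) x (b : MR) y :=
  F (tuple_cons (rho * a + sg * b, lin rho sg x y)) (tuple_cons (a, x)).
have b1 : bm (fun p : ((MR * n.-tuple R) * MR) * n.-tuple R =>
    H1 p.1.1.1 p.1.1.2 p.1.2 p.2).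
  by apply: (bm_comp2 bF); meas.
have b2 : bm (fun p : ((MR * n.-tuple R) * MR) * n.-tuple R =>
    H2 p.1.1.1 p.1.1.2 p.1.2 p.2).
  by apply: (bm_comp2 bF); meas.
have b3 : bm (fun p : ((MR * n.-tuple R) * MR) * n.-tuple R =>
    H3 p.1.1.1 p.1.1.2 p.1.2 p.2).
  by apply: (bm_comp2 bF); meas.
transitivity (\int[N01]_a \int[gam n]_x \int[N01]_b \int[gam n]_y H1 a x b y).
  by do 4 (apply: eq_Rintegral => ? _); rewrite lin_cons.
rewrite [LHS](Efubini23 N01 (gam n) N01 (gam n) b1).
transitivity (\int[N01]_a \int[N01]_b \int[gam n]_x \int[gam n]_y H2 a x b y).
  apply: eq_Rintegral => a _; apply: eq_Rintegral => b _.
  apply: (ih (fun u v => F (tuple_cons (a, u)) (tuple_cons (rho * a + sg * b, v)))).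
  by apply: (bm_comp2 bF); meas.
rewrite -[LHS](Efubini23 N01 (gam n) N01 (gam n) b2).
rewrite [LHS](Efubini_pairs N01 (gam n) N01 (gam n) b2).
transitivity (\int[gam n]_x \int[gam n]_y \int[N01]_a \int[N01]_b H3 a x b y).
  apply: eq_Rintegral => x _; apply: eq_Rintegral => y _.
  apply: (@gauss_sym1 _ rho sg
    (fun u v => F (tuple_cons (u, lin rho sg x y)) (tuple_cons (v, x)))) => //.
  by apply: (bm_comp2 bF); meas.
rewrite -[LHS](Efubini_pairs N01 (gam n) N01 (gam n) b3).
by do 4 (apply: eq_Rintegral => ? _); rewrite lin_cons.
Qed.

(** One coordinate is translated at a time, whence the l1 norm of w; C is the intermediate integral
    in which only the tail is translated. *)
Lemma gauss_shift n (phi : n.-tuple R -> R) (M : R) (w : n.-tuple R) :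
  measurable_fun setT phi -> (forall x, 0 <= phi x <= M) ->
  `|\int[gam n]_x phi (lin 1 1 w x) - \int[gam n]_x phi x| <=
  M * (shift_const + 1) * \sum_(i < n) `|tnth w i|.
Proof.
elim: n phi w => [|n ih] phi w mphi phiM.
  rewrite big_ord0 mulr0 (_ : \int[_]_x _ = \int[gam 0]_x phi x) ?subrr ?normr0//.
  by apply: eq_Rintegral => x _; rewrite (tuple0 x) (tuple0 (lin _ _ _ _)).
have bphi : bm phi by exact: bm_bounded phiM.
have wE : w = tuple_cons (tnth w ord0, [tuple of behead w]).
  by rewrite {1}(tuple_eta w).
rewrite wE; move: (tnth w ord0) [tuple of behead w] => a v {w wE}.
have bl : bm (fun x => phi (lin 1 1 (tuple_cons (a, v)) x)).
  by apply: (bm_comp bphi); meas.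
rewrite !E_cons// big_ord_recl tnth0 mulrDr.
under [X in _ <= _ + _ * X]eq_bigr do rewrite tnthS.
have b2 : bm (fun p : MR * n.-tuple R => phi (tuple_cons (p.1, p.2))).
  by apply: (bm_comp bphi); meas.
have -> : \int[N01]_b \int[gam n]_x phi (lin 1 1 (tuple_cons (a, v)) (tuple_cons (b, x))) =
   \int[N01]_b \int[gam n]_x phi (tuple_cons (a + b, lin 1 1 v x)).
  by do 2 (apply: eq_Rintegral => ? _); rewrite lin_cons !mul1r.
set A := \int[N01]_b _; set B := \int[N01]_b _.
pose C := \int[N01]_b \int[gam n]_x phi (tuple_cons (b, lin 1 1 v x)).
have -> : A - B = (A - C) + (C - B) by ring.
rewrite (le_trans (ler_normD _ _))//; apply: lerD.
  apply: (@gauss_shift1 _ (fun b => \int[gam n]_x phi (tuple_cons (b, lin 1 1 v x)))).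
    suff [] : bm (fun b : MR => \int[gam n]_x phi (tuple_cons (b, lin 1 1 v x))) by [].
    by apply: bm_int; apply: (bm_comp bphi); meas.
  move=> b; apply: Eseg => //.
  by apply: (bm_comp bphi); meas.
have bC : bm (fun b : MR => \int[gam n]_x phi (tuple_cons (b, lin 1 1 v x))).
  by apply: bm_int; apply: (bm_comp bphi); meas.
have bB : bm (fun b : MR => \int[gam n]_x phi (tuple_cons (b, x))).
  by apply: bm_int; apply: (bm_comp bphi); meas.
rewrite /C /B -EB//.
rewrite (le_trans (Enorm _ (bmB bC bB)))//.
set K := M * _ * _; rewrite -(EcstE N01 K).
apply: Ele => [||b]; [|exact: bm_cst|].
  have [mD [L DL]] := bmB bC bB; split; last first.
    by exists L => b; rewrite normr_id.
  exact: measurableT_comp.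
apply: (ih (fun x => phi (tuple_cons (b, x)))) => //.
by apply: measurableT_comp => //; meas.
Qed.

Lemma integral_prob_cst d (T : measurableType d) (P : probability T R)
  (a : \bar R) : (\int[P]_x a = a)%E.
Proof.
rewrite integral_cst// [X in (_ * X)%E](_ : _ = 1%E) ?mule1//.
exact: probability_setT.
Qed.

(** The l1 norm matches [gauss_shift]. The induction rests on (b + S)^4 <= 8 (b^4 + S^4). *)
Lemma gauss_exp4_lty n :
  (\int[gam n]_x ((\sum_(i < n) `|tnth x i|) ^+ 4)%:E < +oo)%E.
Proof.
elim: n => [|n ih].
  under eq_integral do rewrite big_ord0 expr0n/=.
  by rewrite integral0.
have mS m : measurable_fun [set: m.-tuple R]
    (fun x => (\sum_(i < m) `|tnth x i|) ^+ 4).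
  apply: measurable_funX; apply: measurable_sum => i.
  by apply: measurableT_comp => //; exact: measurable_tnth.
have S0 m (x : m.-tuple R) : 0 <= (\sum_(i < m) `|tnth x i|) ^+ 4.
  by rewrite exprn_even_ge0.
have mSE m : measurable_fun [set: m.-tuple R]
    (fun x => ((\sum_(i < m) `|tnth x i|) ^+ 4)%:E).
  by apply/measurable_EFinP; exact: mS.
rewrite ge0_integral_gauss_cons//; last by move=> x; rewrite lee_fin.
have mSn := mSE n.
set m4 := (\int[_]_x _)%E in ih.
have m40 : (0 <= m4)%E by apply: integral_ge0 => x _; rewrite lee_fin.
have ma : measurable_fun [set: MR] (fun a : MR => (a ^+ 4)%:E).
  by apply/measurable_EFinP; exact: measurable_funX.
have a0 (a : MR) : (0 <= (a ^+ 4)%:E)%E by rewrite lee_fin exprn_even_ge0.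
apply: (@le_lt_trans _ _ (\int[N01]_a (8%:E * (a ^+ 4)%:E + 8%:E * m4))%E).
  apply: ge0_le_integral => //.
  - by move=> a _; apply: integral_ge0 => x _; rewrite lee_fin.
  - pose f (p : MR * n.-tuple R) :=
      ((\sum_(i < n.+1) `|tnth (tuple_cons (p.1, p.2)) i|) ^+ 4)%:E.
    apply: (@measurable_fun_fubini_tonelli_F _ _ _ _ _ (gam n) f).
      apply: (measurableT_comp (mSE n.+1)).
      exact: measurable_tuple_cons.
    by move=> p; rewrite /f lee_fin exprn_even_ge0.
  - by apply: emeasurable_funD => //; exact: emeasurable_funM.
  move=> a _.
  have -> : (8%:E * (a ^+ 4)%:E + 8%:E * m4 = \int[gam n]_x
      ((8 * a ^+ 4)%:E + 8%:E * ((\sum_(i < n) `|tnth x i|) ^+ 4)%:E))%E.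
    rewrite ge0_integralD//; last 3 first.
    - by move=> x _; rewrite lee_fin mulr_ge0// exprn_even_ge0.
    - by move=> x _; rewrite -EFinM lee_fin mulr_ge0.
    - exact: emeasurable_funM.
    rewrite integral_prob_cst.
    by rewrite ge0_integralZl// => x _; rewrite lee_fin.
  apply: ge0_le_integral => //.
  - apply: (measurableT_comp (mSE n.+1)).
    exact: measurableT_comp (@measurable_tuple_cons R n) (measurable_pair1 a).
  - by apply: emeasurable_funD => //; exact: emeasurable_funM.
  move=> x _; rewrite -EFinM -EFinD lee_fin big_ord_recl tnth0.
  rewrite (eq_bigr (fun i => `|tnth x i|)); last by move=> i _; rewrite tnthS.
  set S := \sum_(i < n) _.
  have -> : a ^+ 4 = `|a| ^+ 4.
    by rewrite -normrX ger0_norm// exprn_even_ge0.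
  move: `|a| => b.
  have h (u v : R) : (u + v) ^+ 2 <= 2 * (u ^+ 2 + v ^+ 2).
    by have := sqr_ge0 (u - v); lra.
  have -> : 8 * b ^+ 4 + 8 * S ^+ 4 = 4 * (2 * ((b ^+ 2) ^+ 2 + (S ^+ 2) ^+ 2)) by ring.
  apply: (@le_trans _ _ (4 * (b ^+ 2 + S ^+ 2) ^+ 2)); last by rewrite ler_pM2l.
  have -> : 4 * (b ^+ 2 + S ^+ 2) ^+ 2 = (2 * (b ^+ 2 + S ^+ 2)) ^+ 2 by ring.
  rewrite (_ : (b + S) ^+ 4 = ((b + S) ^+ 2) ^+ 2); last by rewrite -exprM.
  by rewrite lerXn2r ?nnegrE ?sqr_ge0// mulr_ge0// addr_ge0 ?sqr_ge0.
rewrite ge0_integralD//; last 3 first.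
- by move=> x _; rewrite mule_ge0.
- exact: emeasurable_funM.
- by move=> x _; rewrite mule_ge0.
rewrite ge0_integralZl// integral_prob_cst; apply: lte_add_pinfty.
  by apply: lte_mul_pinfty => //; exact: N01_exp4_lty.
exact: lte_mul_pinfty.
Qed.

End gaussian_symmetry.

(** * The spectral gap of the Ornstein-Uhlenbeck operators *)

Section cauchy_schwarz.
Context {R : realType}.

Lemma discriminant_le (A B C : R) :
  (forall t : R, 0 <= A - t * (2 * B) + t ^+ 2 * C) -> 0 <= C -> B ^+ 2 <= A * C.
Proof.
move=> H; rewrite le_eqVlt => /orP[/eqP C0|C0].
  have [->|B0] := eqVneq B 0; first by rewrite expr0n/= -C0 mulr0.
  (* When C = 0 the polynomial takes the value -1 at this point. *)
  have := H ((A + 1) / (2 * B)); rewrite -C0 mulr0 addr0 divfK; first by lra.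
  by rewrite mulf_neq0// pnatr_eq0.
have := H (B / C); rewrite (_ : _ + _ = A - B ^+ 2 / C); last first.
  by field; rewrite gt_eqF.
by rewrite subr_ge0 ler_pdivrMr.
Qed.

Lemma Ecauchy_schwarz d (T : measurableType d) (P : probability T R)
    (f g : T -> R) : bm f -> bm g ->
  (\int[P]_x (f x * g x)) ^+ 2 <= \int[P]_x (f x ^+ 2) * \int[P]_x (g x ^+ 2).
Proof.
move=> bf bg; apply: discriminant_le; last by apply: Ege0 => x; exact: sqr_ge0.
move=> t; have : 0 <= \int[P]_x ((f x - t * g x) ^+ 2).
  by apply: Ege0 => x; exact: sqr_ge0.
congr (_ <= _).
have bt a (h : T -> R) : bm h -> bm (fun x => a * h x).
  by move=> bh; apply: bmM => //; exact: bm_cst.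
have bfg : bm (fun x => f x * g x) by exact: bmM.
have bf2 := bmX 2 bf; have bg2 := bmX 2 bg.
transitivity (\int[P]_x ((f x ^+ 2 - t * 2 * (f x * g x)) + t ^+ 2 * g x ^+ 2)).
  by apply: eq_Rintegral => x _; ring.
rewrite ED; [|by apply: bmB => //; exact: bt|exact: bt].
by rewrite EB ?EZ//; [rewrite mulrA|exact: bt].
Qed.

(* Iterating phi r ^+ 2 <= phi (r ^+ 2) m times and taking the 2 ^ m-th root
   turns the constant 2 of the last hypothesis into 1. *)
Lemma doubling_bound (phi : R -> R) (rho : R) : 0 < rho <= 1 ->
  (forall r : R, 0 < r <= 1 -> 0 <= phi r) ->
  (forall r : R, 0 < r <= 1 -> phi r ^+ 2 <= phi (r ^+ 2)) ->
  (forall r : R, 0 < r <= 1 -> phi r <= 2 * r ^+ 2) -> phi rho <= rho ^+ 2.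
Proof.
move=> rho1 phi0 phi2 phib.
have pw (r : R) m : 0 < r <= 1 -> phi r ^+ (2 ^ m) <= 2 * (r ^+ 2) ^+ (2 ^ m).
  elim: m r => [|m ih] r r1; first by rewrite !expr1 phib.
  have r21 : 0 < r ^+ 2 <= 1.
    by case/andP: r1 => r0 r1; rewrite exprn_gt0//= exprn_ile1// ltW.
  rewrite expnS !exprM; apply: le_trans (ih _ r21).
  by rewrite lerXn2r ?nnegrE ?sqr_ge0 ?phi0// phi2.
rewrite leNgt; apply/negP => h.
have rho0 : 0 < rho ^+ 2 by case/andP: rho1 => r0 _; rewrite exprn_gt0.
pose q := phi rho / rho ^+ 2.
have q1 : 1 < q by rewrite ltr_pdivlMr// mul1r.
have qb m : q ^+ (2 ^ m) <= 2.
  rewrite /q expr_div_n ler_pdivrMr; last by rewrite exprn_gt0.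
  exact: pw.
have bern k : 1 + k%:R * (q - 1) <= q ^+ k.
  elim: k => [|k ih]; first by rewrite mul0r addr0 expr0.
  rewrite exprS (le_trans (y := q * (1 + k%:R * (q - 1))))//; last first.
    by rewrite ler_wpM2l//; lra.
  rewrite -natr1; have := sqr_ge0 (q - 1); have : 0 <= k%:R :> R by [].
  by move=> k0 s0; have := mulr_ge0 k0 s0; lra.
have q10 : 0 < q - 1 by lra.
have q2 : 0 <= (q - 1)^-1 by rewrite invr_ge0 ltW.
have := archi_boundP q2; set N := Num.bound _.
rewrite -[X in X < _]mul1r ltr_pdivrMr// => Nq.
have mm : N%:R * (q - 1) <= (2 ^ N)%:R * (q - 1).
  by rewrite ler_wpM2r ?(ltW q10)// ler_nat ltnW// ltn_expl.
by have := qb N; have := bern (2 ^ N)%N; lra.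
Qed.

End cauchy_schwarz.

(** * Stability of the Gaussian law and decay of Ornstein-Uhlenbeck averages *)

Section ou_operator.
Context {R : realType} (n : nat).
Notation T := (n.-tuple R).
Notation gam := (std_gaussian R n).

(** After scaling by c this is [gauss_sym] for a function of its first argument alone. The case b =
    0 is separate because [gauss_sym] requires a positive sg. *)
Lemma gauss_stable (a b c : R) (F : T -> R) : 0 <= a -> 0 <= b -> 0 <= c ->
  c ^+ 2 = a ^+ 2 + b ^+ 2 -> bm F ->
  \int[gam]_x \int[gam]_y F (lin a b x y) = \int[gam]_x F (lin c 0 x x).
Proof.
move=> a0; rewrite le_eqVlt => /orP[/eqP <-|b0] c0 cab bF.
  have <- : a = c.
    apply/eqP; rewrite -(eqrXn2 (n := 2))//; apply/eqP; rewrite cab; ring.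
  apply: eq_Rintegral => x _; rewrite -[RHS](EcstE gam).
  apply: eq_Rintegral => y _; congr F.
  by apply: eq_from_tnth => i; rewrite !tnth_lin !mul0r.
have cp : 0 < c.
  rewrite lt_neqAle c0 andbT eq_sym; apply/eqP => c0'.
  by have := exprn_gt0 2 b0; have := sqr_ge0 a; rewrite c0' expr0n/= in cab; lra.
have bp : 0 < b / c by rewrite divr_gt0.
have rs : (a / c) ^+ 2 + (b / c) ^+ 2 = 1.
  by rewrite !expr_div_n -mulrDl -cab divff// expf_neq0// gt_eqF.
have bF' : bm (fun p : T * T => F (lin c 0 p.1 p.1)).
  by apply: (bm_comp bF); meas.
transitivity (\int[gam]_x \int[gam]_y
    F (lin c 0 (lin (a / c) (b / c) x y) (lin (a / c) (b / c) x y))).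
  apply: eq_Rintegral => x _; apply: eq_Rintegral => y _; congr F.
  by apply: eq_from_tnth => i; rewrite !tnth_lin; field; rewrite gt_eqF.
rewrite -(@gauss_sym _ n (a / c) (b / c) (fun u _ => F (lin c 0 u u)) bp rs)//.
by apply: eq_Rintegral => x _; rewrite EcstE.
Qed.

Lemma lin10 (x y : T) : lin 1 0 x y = x.
Proof. by apply: eq_from_tnth => i; rewrite tnth_lin mul0r mul1r addr0. Qed.

Definition ou (rho : R) (G : T -> R) (x : T) : R :=
  \int[gam]_y G (lin rho (Num.sqrt (1 - rho ^+ 2)) x y).

Lemma bm_ou (rho : R) (G : T -> R) : bm G -> bm (ou rho G).
Proof. by move=> bG; apply: bm_int; apply: (bm_comp bG); meas. Qed.

Let sqr_sqrt1 (rho : R) : 0 <= rho <= 1 ->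
  Num.sqrt (1 - rho ^+ 2) ^+ 2 = 1 - rho ^+ 2.
Proof.
by move=> /andP[r0 r1]; rewrite sqr_sqrtr// subr_ge0 exprn_ile1.
Qed.

Lemma E_ou (rho : R) (G : T -> R) : 0 <= rho <= 1 -> bm G ->
  \int[gam]_x ou rho G x = \int[gam]_x G x.
Proof.
move=> r1 bG; have /andP[r0 _] := r1.
rewrite (@gauss_stable _ _ 1)// ?sqrtr_ge0//; last first.
  by rewrite sqr_sqrt1//; ring.
by apply: eq_Rintegral => x _; rewrite lin10.
Qed.

(** The two noises have variances tau^2 (1 - rho^2) and 1 - tau^2, with sum 1 - (rho tau)^2, so
    [gauss_stable] merges them. *)
Lemma ou_ou (rho tau : R) (G : T -> R) (x : T) : 0 <= rho <= 1 -> 0 <= tau <= 1 -> bm G ->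
  ou rho (ou tau G) x = ou (rho * tau) G x.
Proof.
move=> r1 t1 bG; have /andP[r0 _] := r1; have /andP[t0 _] := t1.
pose F u := G (lin (rho * tau) 1 x u).
have bF : bm F by apply: (bm_comp bG); meas.
have rt : 0 <= rho * tau <= 1.
  by move: r1 t1 => /andP[? ?] /andP[? ?]; rewrite mulr_ge0//= mulr_ile1.
transitivity (\int[gam]_y \int[gam]_z
    F (lin (tau * Num.sqrt (1 - rho ^+ 2)) (Num.sqrt (1 - tau ^+ 2)) y z)).
  apply: eq_Rintegral => y _; apply: eq_Rintegral => z _; congr G.
  by apply: eq_from_tnth => i; rewrite !tnth_lin; ring.
rewrite (@gauss_stable _ _ (Num.sqrt (1 - (rho * tau) ^+ 2))) ?sqrtr_ge0//.
- apply: eq_Rintegral => y _; congr G.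
  by apply: eq_from_tnth => i; rewrite !tnth_lin; ring.
- by rewrite mulr_ge0// sqrtr_ge0.
- by rewrite sqr_sqrt1// [X in _ = X + _]exprMn !sqr_sqrt1//; ring.
Qed.

Lemma E_ou_sqr_le (rho : R) (G : T -> R) : 0 <= rho <= 1 -> bm G ->
  \int[gam]_x (ou rho G x ^+ 2) <= \int[gam]_x (G x ^+ 2).
Proof.
move=> r1 bG; rewrite -(E_ou r1 (bmX 2 bG)).
apply: Ele => [||x]; [by apply: bmX; exact: bm_ou|exact: bm_ou (bmX 2 bG)|].
by apply: Esqr_le; apply: (bm_comp bG); meas.
Qed.

Lemma E_ou_exp4_le (rho : R) (G : T -> R) : 0 <= rho <= 1 -> bm G ->
  \int[gam]_x (ou rho G x ^+ 4) <= \int[gam]_x (G x ^+ 4).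
Proof.
move=> r1 bG; rewrite -(E_ou r1 (bmX 4 bG)).
apply: Ele => [||x]; [by apply: bmX; exact: bm_ou|exact: bm_ou (bmX 4 bG)|].
by apply: Eexp4_le; apply: (bm_comp bG); meas.
Qed.

(* For independent X and Y, the centred variables h(X) and h(Y), where
   h(X) = E[G((X + Y) / sqrt 2) | X], are orthogonal projections of
   G((X + Y) / sqrt 2), so that their squared norms add up to at most its own. *)
Lemma E_ou_half_le (G : T -> R) : bm G -> \int[gam]_x G x = 0 ->
  \int[gam]_x (ou (Num.sqrt 2^-1) G x ^+ 2) <= 2^-1 * \int[gam]_x (G x ^+ 2).
Proof.
move=> bG G0; set rho := Num.sqrt 2^-1; pose h := ou rho G.
have rho2 : rho ^+ 2 = 2^-1 by rewrite sqr_sqrtr.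
have r0 : 0 <= rho by exact: sqrtr_ge0.
have r1 : 0 <= rho <= 1.
  by rewrite r0/= -(ler_pXn2r (n := 2)) ?nnegrE// rho2 expr1n; lra.
have rE : Num.sqrt (1 - rho ^+ 2) = rho by rewrite rho2 /rho; congr Num.sqrt; field.
pose K x y := G (lin rho rho x y).
have bK : bm (fun p : T * T => K p.1 p.2) by apply: (bm_comp bG); meas.
have bh : bm h by exact: bm_ou.
have hE x : h x = \int[gam]_y K x y by rewrite /h /ou rE.
have hE' y : h y = \int[gam]_x K x y.
  rewrite hE; apply: eq_Rintegral => x _; rewrite /K; congr G.
  by apply: eq_from_tnth => i; rewrite !tnth_lin; ring.
have h0 : \int[gam]_x h x = 0 by rewrite E_ou.
pose H := \int[gam]_x (h x ^+ 2).
have b2 (a : R) (f : T -> R) : bm f -> bm (fun x => a * f x).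
  by move=> bf; apply: bmM => //; exact: bm_cst.
have KhE : \int[gam]_x \int[gam]_y (K x y * h y) = H.
  rewrite Efubini; last by apply: bmM => //; apply: (bm_comp bh); meas.
  apply: eq_Rintegral => y _.
  have /= E := EZ gam (h y) (bm_sectionr (f := K) y bK).
  rewrite expr2 [X in _ = _ * X]hE' -E.
  by apply: eq_Rintegral => x _; rewrite mulrC.
have K2E : \int[gam]_x \int[gam]_y (K x y ^+ 2) = \int[gam]_x (G x ^+ 2).
  have := @gauss_stable rho rho 1 (fun u => G u ^+ 2) r0 r0 ler01.
  rewrite rho2 => ->; [|by field|exact: bmX].
  by apply: eq_Rintegral => x _; rewrite lin10.
have key x : \int[gam]_y ((K x y - h x - h y) ^+ 2) =
    \int[gam]_y (K x y ^+ 2) - h x ^+ 2 + (H - 2 * \int[gam]_y (K x y * h y)).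
  have bKx : bm (K x) by exact: (bm_section (f := K)).
  transitivity (\int[gam]_y ((K x y ^+ 2 + h x ^+ 2) + (h y ^+ 2 +
      (2 * h x * h y - (2 * h x * K x y + 2 * (K x y * h y)))))).
    by apply: eq_Rintegral => y _; ring.
  have c1 : bm (fun y => 2 * h x * K x y) by exact: b2.
  have c2 : bm (fun y => 2 * (K x y * h y)) by apply: b2; exact: bmM.
  have c3 : bm (fun y => 2 * h x * h y) by exact: b2.
  have c4 : bm (fun y => K x y ^+ 2) by exact: bmX.
  have c5 : bm (fun y : T => h x ^+ 2) := bm_cst _ _.
  have c6 : bm (fun y => h y ^+ 2) by exact: bmX.
  rewrite ED; [|exact: bmD|by apply: bmD => //; apply: bmB => //; exact: bmD].
  rewrite ED// EcstE ED//; last by apply: bmB => //; exact: bmD.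
  rewrite EB//; last exact: bmD.
  rewrite ED// !EZ//; last exact: bmM.
  by rewrite h0 -hE -/H; ring.
have : 0 <= \int[gam]_x \int[gam]_y ((K x y - h x - h y) ^+ 2).
  by apply: Ege0 => x; apply: Ege0 => y; exact: sqr_ge0.
under eq_Rintegral do rewrite key.
have bKh : bm (fun p : T * T => K p.1 p.2 * h p.2).
  by apply: bmM => //; apply: (bm_comp bh); meas.
have d1 : bm (fun x => \int[gam]_y (K x y ^+ 2)) by apply: bm_int; exact: bmX.
have d2 : bm (fun x => h x ^+ 2) by exact: bmX.
have d3 : bm (fun x => 2 * \int[gam]_y (K x y * h y)) by apply: b2; exact: bm_int.
rewrite ED; [|exact: bmB|by apply: bmB => //; exact: bm_cst].
rewrite EB// EB//; last exact: bm_cst.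
rewrite EcstE EZ; last exact: bm_int.
by rewrite KhE K2E -/H; lra.
Qed.

(** Each factor 1 / sqrt 2 split off from rho gains a factor 1 / 2 by [E_ou_half_le], and the
    averages stay centred. *)
Lemma E_ou_dyadic_le (G : T -> R) j (rho : R) : bm G -> \int[gam]_x G x = 0 ->
  0 <= rho -> rho ^+ 2 <= 2^-1 ^+ j ->
  \int[gam]_x (ou rho G x ^+ 2) <= 2^-1 ^+ j * \int[gam]_x (G x ^+ 2).
Proof.
move=> bG G0; elim: j rho => [|j ih] rho r0 rj.
  rewrite expr0 mul1r; apply: E_ou_sqr_le => //.
  by rewrite r0/= -(ler_pXn2r (n := 2)) ?nnegrE// expr1n.
pose tau := rho * Num.sqrt 2.
have t0 : 0 <= tau by rewrite mulr_ge0// sqrtr_ge0.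
have tj : tau ^+ 2 <= 2^-1 ^+ j.
  by rewrite exprMn sqr_sqrtr//; rewrite [2^-1 ^+ _]exprS in rj; lra.
have hj : 2^-1 ^+ j <= 1 :> R by rewrite exprn_ile1//; lra.
have t1 : 0 <= tau <= 1.
  by rewrite t0/= -(ler_pXn2r (n := 2)) ?nnegrE// expr1n; lra.
have s1 : 0 <= Num.sqrt (2^-1 : R) <= 1.
  by rewrite sqrtr_ge0/= -(ler_pXn2r (n := 2)) ?nnegrE ?sqrtr_ge0// sqr_sqrtr// expr1n; lra.
have -> : ou rho G = ou (Num.sqrt 2^-1) (ou tau G).
  apply/funext => x; rewrite ou_ou//; congr (ou _ G x).
  by rewrite mulrCA -sqrtrM// mulVf ?pnatr_eq0// sqrtr1 mulr1.
apply: (le_trans (E_ou_half_le (bm_ou tau bG) _)); first by rewrite E_ou.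
by rewrite exprS -mulrA ler_pM2l// ih.
Qed.

(** The constant 2 is the cost of rounding [rho ^+ 2] up to a power of 1 / 2: the least j with
    2^-(j+1) < rho^2 satisfies rho^2 <= 2^-j < 2 rho^2. *)
Lemma E_ou_quadratic_le (G : T -> R) (rho : R) : bm G -> \int[gam]_x G x = 0 ->
  0 < rho <= 1 ->
  \int[gam]_x (ou rho G x ^+ 2) <= 2 * rho ^+ 2 * \int[gam]_x (G x ^+ 2).
Proof.
move=> bG G0 /andP[r0 r1].
have r20 : 0 < rho ^+ 2 by rewrite exprn_gt0.
have ex : exists j, 2^-1 ^+ j.+1 < rho ^+ 2.
  have q2 : 0 <= (rho ^+ 2)^-1 by rewrite invr_ge0 ltW.
  have := archi_boundP q2; set N := Num.bound _ => h; exists N.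
  rewrite exprVn -[X in _ < X]invrK ltf_pV2 ?posrE ?exprn_gt0 ?invr_gt0//.
  by rewrite (lt_trans h)// -natrX ltr_nat (ltn_trans (ltnSn N))// ltn_expl.
have [j hj jmin] := ex_minnP ex.
have rj : rho ^+ 2 <= 2^-1 ^+ j.
  case: j {hj} jmin => [|j] jmin; first by rewrite expr0 exprn_ile1// ltW.
  by rewrite leNgt; apply/negP => /jmin; rewrite ltnn.
apply: (le_trans (E_ou_dyadic_le bG G0 (ltW r0) rj)).
rewrite ler_wpM2r//; last by rewrite [2^-1 ^+ _]exprS in hj; lra.
by apply: Ege0 => x; exact: sqr_ge0.
Qed.

(** By self-adjointness the squared norm of [ou rho G] is the scalar product of G with
    [ou (rho ^+ 2) G]. At rho = 1 the noise vanishes, which [gauss_sym] excludes, but [ou 1] is the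
    identity. *)
Lemma E_ou_sqr_doubling (G : T -> R) (rho : R) : bm G -> 0 < rho <= 1 ->
  (\int[gam]_x (ou rho G x ^+ 2)) ^+ 2 <=
  \int[gam]_x (G x ^+ 2) * \int[gam]_x (ou (rho ^+ 2) G x ^+ 2).
Proof.
move=> bG /andP[r0 r1].
have r1' : 0 <= rho <= 1 by rewrite ltW.
suff -> : \int[gam]_x (ou rho G x ^+ 2) =
    \int[gam]_x (G x * ou (rho ^+ 2) G x).
  by apply: Ecauchy_schwarz => //; exact: bm_ou.
have [->|rn1] := eqVneq rho 1.
  rewrite expr1n (_ : ou 1 G = G)//.
  apply/funext => x; rewrite /ou expr1n subrr sqrtr0.
  by under eq_Rintegral do rewrite lin10; rewrite EcstE.
have rlt : rho < 1 by rewrite lt_neqAle rn1.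
have s0 : 0 < Num.sqrt (1 - rho ^+ 2).
  by rewrite sqrtr_gt0 subr_gt0 expr_lt1// ltW.
have rs : rho ^+ 2 + Num.sqrt (1 - rho ^+ 2) ^+ 2 = 1.
  by rewrite sqr_sqrt1//; ring.
have bh : bm (ou rho G) := bm_ou rho bG.
transitivity (\int[gam]_x \int[gam]_y
    (ou rho G x * G (lin rho (Num.sqrt (1 - rho ^+ 2)) x y))).
  apply: eq_Rintegral => x _; rewrite EZ ?expr2//.
  by apply: (bm_comp bG); meas.
rewrite (gauss_sym (F := fun x y => ou rho G x * G y) s0 rs); last first.
  by apply: bmM; [apply: (bm_comp bh)|apply: (bm_comp bG)]; meas.
apply: eq_Rintegral => x _; rewrite expr2 -ou_ou// -EZ; last first.
  by apply: (bm_comp bh); meas.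
by apply: eq_Rintegral => y _; rewrite mulrC.
Qed.

Lemma ou_spectral_gap0 (G : T -> R) (rho : R) : bm G -> \int[gam]_x G x = 0 ->
  0 < rho <= 1 ->
  \int[gam]_x (ou rho G x ^+ 2) <= rho ^+ 2 * \int[gam]_x (G x ^+ 2).
Proof.
move=> bG G0 r1; set A := \int[gam]_x (G x ^+ 2).
have : 0 <= A by apply: Ege0 => x; exact: sqr_ge0.
rewrite le_eqVlt => /orP[/eqP A0|A0].
  rewrite -A0 mulr0 A0; apply: E_ou_sqr_le => //.
  by case/andP: r1 => r0 ->; rewrite ltW.
pose phi r := \int[gam]_x (ou r G x ^+ 2) / A.
rewrite -ler_pdivrMr//; apply: (@doubling_bound _ phi) => //.
- by move=> r _; rewrite divr_ge0 ?(ltW A0)//; apply: Ege0 => x; exact: sqr_ge0.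
- move=> r r01; rewrite /phi expr_div_n ler_pdivrMr ?exprn_gt0//.
  rewrite (le_trans (E_ou_sqr_doubling bG r01))// -/A.
  by rewrite expr2 mulrA divfK ?gt_eqF// mulrC.
- by move=> r r01; rewrite /phi ler_pdivrMr// E_ou_quadratic_le.
Qed.

Lemma ou_spectral_gap (G : T -> R) (rho m : R) : bm G -> \int[gam]_x G x = m ->
  0 < rho <= 1 ->
  \int[gam]_x ((ou rho G x - m) ^+ 2) <= rho ^+ 2 * \int[gam]_x ((G x - m) ^+ 2).
Proof.
move=> bG Gm r1.
have bGm : bm (fun x => G x - m) by apply: bmB => //; exact: bm_cst.
rewrite (le_trans _ (ou_spectral_gap0 bGm _ r1))//; last first.
  by rewrite EB ?EcstE ?Gm ?subrr//; exact: bm_cst.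
rewrite le_eqVlt; apply/orP; left; apply/eqP; apply: eq_Rintegral => x _.
congr (_ ^+ 2); rewrite /ou EB ?EcstE//; last exact: bm_cst.
by apply: (bm_comp bG); meas.
Qed.

End ou_operator.

(** * Second order expansions *)

Section expansion.
Context {R : realType}.

(** The first order term vanishes because a is the mean. M is chosen before the probability and the
    function, so one constant serves every step of the interpolation and every point of the outer
    integral. *)
Lemma E_taylor2_le (C dC : R -> R) (lo hi eta : R) :
  profile C dC -> 0 < lo -> 0 < eta ->
  exists2 M : R, 0 < M & forall d (T : measurableType d) (P : probability T R)
    (g : T -> R) (a : R), bm g -> (forall x, lo <= g x <= hi) ->
    \int[P]_x g x = a ->
    `|\int[P]_x prim C (g x) - prim C a -
      dC a / 2 * \int[P]_x ((g x - a) ^+ 2)| <=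
    eta * \int[P]_x ((g x - a) ^+ 2) + M * \int[P]_x ((g x - a) ^+ 4).
Proof.
move=> pC lo0 eta0; have [M M0 HM] := prim_taylor2 pC hi lo0 eta0.
exists M => // d T P g a bg gs ga.
have as_ : lo <= a <= hi by rewrite -ga; exact: Eseg.
have bU : bm (fun x => prim C (g x)) by apply: bm_nd => //; exact: (prim_nd pC).
have bga : bm (fun x => g x - a) by apply: bmB => //; exact: bm_cst.
have bga2 := bmX 2 bga; have bga4 := bmX 4 bga.
have bZ (k : R) (h : T -> R) : bm h -> bm (fun x => k * h x).
  by move=> bh; apply: bmM => //; exact: bm_cst.
pose F x := prim C (g x) - prim C a - C a * (g x - a) - dC a / 2 * (g x - a) ^+ 2.
have bUa : bm (fun x => prim C (g x) - prim C a) by apply: bmB => //; exact: bm_cst.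
have bF : bm F by apply: bmB; [apply: bmB => //; exact: bZ|exact: bZ].
have FE : \int[P]_x F x = \int[P]_x prim C (g x) - prim C a -
    dC a / 2 * \int[P]_x ((g x - a) ^+ 2).
  rewrite EB; [|by apply: bmB => //; exact: bZ|exact: bZ].
  rewrite EB//; last exact: bZ.
  rewrite EB//; last exact: bm_cst.
  rewrite !EZ// EB//; last exact: bm_cst.
  by rewrite !EcstE ga subrr mulr0 subr0.
rewrite -FE (le_trans (Enorm _ bF))//.
rewrite -!EZ// -ED; [|exact: bZ|exact: bZ].
apply: Ele => [||x]; last exact: HM.
  have [mF [L HL]] := bF; split; first exact: measurableT_comp.
  by exists L => x; rewrite normr_id.
by apply: bmD; exact: bZ.
Qed.

Lemma E_taylor1_le (C dC : R -> R) (lo hi : R) : profile C dC -> 0 < lo ->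
  exists2 M : R, 0 < M & forall d (T : measurableType d) (P : probability T R)
    (g : T -> R) (a : R), bm g -> (forall x, lo <= g x <= hi) ->
    \int[P]_x g x = a ->
    `|\int[P]_x prim C (g x) - prim C a| <= M * \int[P]_x ((g x - a) ^+ 2).
Proof.
move=> pC lo0; have [M M0 HM] := prim_taylor1 pC hi lo0.
exists M => // d T P g a bg gs ga.
have as_ : lo <= a <= hi by rewrite -ga; exact: Eseg.
have bU : bm (fun x => prim C (g x)) by apply: bm_nd => //; exact: (prim_nd pC).
have bga : bm (fun x => g x - a) by apply: bmB => //; exact: bm_cst.
have bga2 := bmX 2 bga.
have bZ (k : R) (h : T -> R) : bm h -> bm (fun x => k * h x).
  by move=> bh; apply: bmM => //; exact: bm_cst.
pose F x := prim C (g x) - prim C a - C a * (g x - a).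
have bUa : bm (fun x => prim C (g x) - prim C a) by apply: bmB => //; exact: bm_cst.
have bF : bm F by apply: bmB => //; exact: bZ.
have FE : \int[P]_x F x = \int[P]_x prim C (g x) - prim C a.
  rewrite EB//; last exact: bZ.
  rewrite EB//; last exact: bm_cst.
  rewrite !EZ// EB//; last exact: bm_cst.
  by rewrite !EcstE ga subrr mulr0 subr0.
rewrite -FE (le_trans (Enorm _ bF))// -!EZ//.
apply: Ele => [||x]; last exact: HM.
  have [mF [L HL]] := bF; split; first exact: measurableT_comp.
  by exists L => x; rewrite normr_id.
exact: bZ.
Qed.

(** Lower half of the Arrow-Pratt expansion of the certainty equivalent V (E U(g)). [primV_taylor]
    inverts U to first order around [prim C a]; its quadratic error is at most M1^2 times the
    squared variance, hence absorbed by the fourth moment. *)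
Lemma mean_lower_bound (C dC : R -> R) (pC : profile C dC) (lo hi eta : R) :
  0 < lo -> 0 < eta ->
  exists2 M : R, 0 < M & forall d (T : measurableType d) (P : probability T R)
    (g : T -> R) (a : R), bm g -> (forall x, lo <= g x <= hi) ->
    \int[P]_x g x = a ->
    a + dC a / C a / 2 * \int[P]_x ((g x - a) ^+ 2) -
      (eta * \int[P]_x ((g x - a) ^+ 2) + M * \int[P]_x ((g x - a) ^+ 4)) <=
    primV pC (\int[P]_x prim C (g x)).
Proof.
move=> lo0 eta0; have Cl0 := profile_gt0 pC lo0.
have e0 : 0 < eta * C lo by rewrite mulr_gt0.
have [M1 M10 H1] := E_taylor1_le hi pC lo0.
have [M2 M20 H2] := E_taylor2_le hi pC lo0 e0.
have [M3 M30 H3] := primV_taylor pC hi lo0.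
exists (M2 / C lo + M3 * M1 ^+ 2).
  by rewrite addr_gt0 ?divr_gt0// mulr_gt0// exprn_gt0.
move=> d T P g a bg gs ga.
have as_ : lo <= a <= hi by rewrite -ga; exact: Eseg.
have bga : bm (fun x => g x - a) by apply: bmB => //; exact: bm_cst.
have h1 := H1 _ _ P g a bg gs ga; have h2 := H2 _ _ P g a bg gs ga.
set s := \int[P]_x prim C (g x) in h1 h2 *.
have ss : prim C lo <= s <= prim C hi.
  apply: Eseg => [|x]; first by apply: bm_nd => //; exact: (prim_nd pC).
  by have /andP[? ?] := gs x; rewrite !(prim_nd pC).
have h3 := H3 a s as_ ss.
have V40 : (\int[P]_x ((g x - a) ^+ 2)) ^+ 2 <= \int[P]_x ((g x - a) ^+ 4).
  rewrite (le_trans (Esqr_le P (bmX 2 bga)))// le_eqVlt; apply/orP; left.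
  by apply/eqP; apply: eq_Rintegral => x _; rewrite -exprM.
have V0 : 0 <= \int[P]_x ((g x - a) ^+ 2) by apply: Ege0 => x; exact: sqr_ge0.
have W0 : 0 <= \int[P]_x ((g x - a) ^+ 4).
  by apply: Ege0 => x; rewrite exprn_even_ge0.
set V := \int[P]_x ((g x - a) ^+ 2) in h1 h2 V40 V0 *.
set W := \int[P]_x ((g x - a) ^+ 4) in h2 V40 W0 *.
have Cla : C lo <= C a by apply: (profile_le pC) => //; case/andP: as_.
have Ca0 : 0 < C a by lra.
apply: le_trans h3.
have k1 : (s - prim C a) ^+ 2 <= M1 ^+ 2 * W.
  apply: (@le_trans _ _ (M1 ^+ 2 * V ^+ 2)); last first.
    by rewrite ler_wpM2l// sqr_ge0.
  rewrite -exprMn -(real_normK (num_real (s - _))) lerXn2r// ?nnegrE//.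
  by rewrite mulr_ge0// ltW.
have k2 : M3 * (s - prim C a) ^+ 2 <= M3 * M1 ^+ 2 * W.
  by rewrite -mulrA ler_pM2l.
have k3 : dC a / C a / 2 * V - (eta * V + M2 / C lo * W) <= (s - prim C a) / C a.
  rewrite ler_pdivlMr//.
  have k4 : (eta * C lo * V + M2 * W) <= (eta * V + M2 / C lo * W) * C a.
    rewrite (_ : _ + _ = (eta * V + M2 / C lo * W) * C lo); last first.
      by field; rewrite gt_eqF.
    by rewrite ler_wpM2l// addr_ge0// mulr_ge0// ?divr_ge0// ltW.
  rewrite mulrBl (_ : dC a / C a / 2 * V * C a = dC a / 2 * V); last first.
    by field; rewrite gt_eqF.
  by move: h2; rewrite ler_norml => /andP[h2 _]; lra.
by rewrite mulrDl; lra.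
Qed.

End expansion.

(** * The inequality for one small Gaussian increment *)

Section local_inequality.
Context {R : realType} (n : nat).
Notation T := (n.-tuple R).
Notation gam := (std_gaussian R n).

(** The form in which concavity enters the argument: a supporting line from above at every point. *)
Definition supported (k : R -> R) := forall a : R, 0 < a ->
  exists m : R, forall b : R, 0 < b -> k b <= k a + m * (b - a).

(** Both sides are compared at the overall mean [abar]: the left is bounded above by [E_taylor2_le]
    and the spectral gap, the right below by [mean_lower_bound] for each y and the tangent of
    [prim C1]. The relation between rho and the curvatures makes the two second order terms
    equal. *)
Lemma local_inequality (C dC C1 dC1 : R -> R) (pC : profile C dC)
    (pC1 : profile C1 dC1) (lo hi eta : R) : 0 < lo -> 0 < eta ->
  supported (fun y => C y / dC y) ->
  exists2 M : R, 0 < M & forall d (T' : measurableType d) (Q : probability T' R)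
    (g : T' -> T -> R) (rho m2 m4 : R), 0 < rho <= 1 ->
    (forall a : R, 0 < a -> rho ^+ 2 * (dC1 a / C1 a) = dC a / C a) ->
    bm (fun p : T' * T => g p.1 p.2) ->
    (forall y z, lo <= g y z <= hi) ->
    (forall y, \int[gam]_z ((g y z - \int[gam]_w g y w) ^+ 2) <= m2) ->
    (forall y, \int[gam]_z ((g y z - \int[gam]_w g y w) ^+ 4) <= m4) ->
    \int[gam]_z prim C1 (ou rho (fun w => \int[Q]_y g y w) z) <=
    prim C1 (\int[Q]_y primV pC (\int[gam]_z prim C (g y z))) +
      eta * m2 + M * m4.
Proof.
move=> lo0 eta0 kC; have Ch0 : 0 < C1 (Num.max lo hi).
  by apply: (profile_gt0 pC1); rewrite lt_max lo0.
(* The error e occurs once on the left and once on the right multiplied by [C1 abar]; together they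
   make at most eta. *)
pose e := eta / (1 + C1 (Num.max lo hi)).
have e0 : 0 < e by rewrite divr_gt0// addr_gt0.
have [M1 M10 H1] := E_taylor2_le hi pC1 lo0 e0.
have [M2 M20 H2] := mean_lower_bound pC hi lo0 e0.
exists (M1 + C1 (Num.max lo hi) * M2); first by rewrite addr_gt0 ?mulr_gt0.
move=> d T' Q g rho m2 m4 r1 rk bg gs gm2 gm4.
have bZ dX (X : measurableType dX) (k : R) (h : X -> R) : bm h -> bm (fun x => k * h x).
  by move=> bh; apply: bmM => //; exact: bm_cst.
have bgy y : bm (g y) by exact: bm_section bg.
pose a y := \int[gam]_z g y z.
have ba : bm a by exact: bm_int.
pose G z := \int[Q]_y g y z.
have bgr : bm (fun p : T * T' => g p.2 p.1) by apply: (bm_comp2 bg); meas.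
have bG : bm G by apply: (bm_int Q (f := fun z y => g y z)).
have bgz z : bm (fun y => g y z) by exact: (bm_sectionr (f := g)).
have as_ y : lo <= a y <= hi by exact: Eseg.
have Gs z : lo <= G z <= hi by exact: Eseg.
pose abar := \int[gam]_z G z.
have abarE : abar = \int[Q]_y a y by rewrite /abar -Efubini.
have abs : lo <= abar <= hi by exact: Eseg.
have ab0 : 0 < abar by case/andP: abs => h _; exact: lt_le_trans h.
have abh : abar <= Num.max lo hi by rewrite le_max; case/andP: abs => _ ->; rewrite orbT.
have Cab0 := profile_gt0 pC1 ab0.
have Cabh : C1 abar <= C1 (Num.max lo hi) by exact: (profile_le pC1).
have bda y : bm (fun z => g y z - a y) by apply: bmB => //; exact: bm_cst.
have bd : bm (fun p : T' * T => g p.1 p.2 - a p.1).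
  by apply: bmB => //; apply: (bm_comp ba); meas.
have bdr : bm (fun p : T * T' => g p.2 p.1 - a p.2).
  by apply: bmB => //; apply: (bm_comp ba); meas.
have bGa : bm (fun z => G z - abar) by apply: bmB => //; exact: bm_cst.
have GaE z : G z - abar = \int[Q]_y (g y z - a y) by rewrite EB// -abarE.
have m20 : 0 <= m2.
  by apply: le_trans (gm2 point); apply: Ege0 => z; exact: sqr_ge0.
have m40 : 0 <= m4.
  by apply: le_trans (gm4 point); apply: Ege0 => z; rewrite exprn_even_ge0.
(* G averages g over y, so by Jensen its variance is at most the mean of the variances of the
   [g y]. *)
have VG2 : \int[gam]_z ((G z - abar) ^+ 2) <= m2.
  apply: (@le_trans _ _ (\int[gam]_z \int[Q]_y ((g y z - a y) ^+ 2))).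
    apply: Ele => [||z]; [exact: bmX| |].
      by apply: (bm_int Q (f := fun z y => (g y z - a y) ^+ 2)); exact: bmX.
    rewrite GaE; apply: Esqr_le; apply: bmB => //; exact: ba.
  rewrite (Efubini gam Q (f := fun z y => (g y z - a y) ^+ 2)); last exact: bmX.
  rewrite -(EcstE Q m2); apply: Ele => //; last exact: bm_cst.
  by apply: (bm_int gam (f := fun y z => (g y z - a y) ^+ 2)); exact: bmX.
have VG4 : \int[gam]_z ((G z - abar) ^+ 4) <= m4.
  apply: (@le_trans _ _ (\int[gam]_z \int[Q]_y ((g y z - a y) ^+ 4))).
    apply: Ele => [||z]; [exact: bmX| |].
      by apply: (bm_int Q (f := fun z y => (g y z - a y) ^+ 4)); exact: bmX.
    rewrite GaE; apply: Eexp4_le; apply: bmB => //; exact: ba.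
  rewrite (Efubini gam Q (f := fun z y => (g y z - a y) ^+ 4)); last exact: bmX.
  rewrite -(EcstE Q m4); apply: Ele => //; last exact: bm_cst.
  by apply: (bm_int gam (f := fun y z => (g y z - a y) ^+ 4)); exact: bmX.
set VG := \int[gam]_z ((G z - abar) ^+ 2) in VG2.
have VG0 : 0 <= VG by apply: Ege0 => z; exact: sqr_ge0.
have r1' : 0 <= rho <= 1 by case/andP: r1 => ? ->; rewrite ltW.
have bo : bm (ou rho G) by exact: bm_ou.
have os z : lo <= ou rho G z <= hi.
  by apply: Eseg => //; apply: (bm_comp bG); meas.
have oE : \int[gam]_z ou rho G z = abar by rewrite E_ou.
have up := H1 _ _ gam (ou rho G) abar bo os oE.
have oV : \int[gam]_z ((ou rho G z - abar) ^+ 2) <= rho ^+ 2 * VG.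
  exact: ou_spectral_gap.
have oV4 : \int[gam]_z ((ou rho G z - abar) ^+ 4) <= m4.
  apply: le_trans VG4; have := E_ou_exp4_le r1' bGa.
  congr (_ <= _); apply: eq_Rintegral => z _; congr (_ ^+ 4).
  rewrite /ou EB; [|by apply: (bm_comp bG); meas|exact: bm_cst].
  by rewrite EcstE.
pose b y := primV pC (\int[gam]_z prim C (g y z)).
have bb : bm b.
  apply: bm_nd; first exact: primV_nd.
  by apply: (bm_int gam (f := fun y z => prim C (g y z))); apply: bm_nd => //; exact: (prim_nd pC).
have [m Hm] := kC abar ab0.
set kap := C abar / dC abar in Hm.
have kap0 : 0 < kap by rewrite divr_gt0 ?(profile_gt0 pC) ?(profile_dgt0 pC).
(* d ^ 2 / k >= 2 lam d - k lam ^ 2 for every lam, with equality at d = lam k;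
   the right-hand side is affine in (d, k), and k (a y) is bounded by the
   supporting line at abar. *)
pose lam z := (G z - abar) / kap.
have blam : bm lam by apply: bmM => //; exact: bm_cst.
pose L2 := \int[gam]_z (lam z ^+ 2).
have L2E : L2 = VG / kap ^+ 2.
  rewrite /L2 mulrC -EZ; last exact: bmX.
  by apply: eq_Rintegral => z _; rewrite /lam expr_div_n mulrC.
have low y : a y + \int[gam]_z (lam z * (g y z - a y)) -
    (kap + m * (a y - abar)) / 2 * L2 - (e * m2 + M2 * m4) <= b y.
  have := H2 _ _ gam (g y) (a y) (bgy y) (gs y) erefl; rewrite -/(b y).
  apply: le_trans.
  have ay0 : 0 < a y by case/andP: (as_ y) => h _; exact: lt_le_trans h.
  pose k := C (a y) / dC (a y).
  have k0 : 0 < k by rewrite divr_gt0 ?(profile_gt0 pC) ?(profile_dgt0 pC).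
  have kE : dC (a y) / C (a y) = k^-1 by rewrite invf_div.
  have t1 := ler_wpM2l (ltW e0) (gm2 y : _ <= m2); rewrite -/(a y) in t1.
  have t2 := ler_wpM2l (ltW M20) (gm4 y); rewrite -/(a y) in t2.
  have t3 : k / 2 * L2 <= (kap + m * (a y - abar)) / 2 * L2.
    rewrite ler_wpM2r//; last by rewrite ler_pM2r// Hm.
    by apply: Ege0 => z; exact: sqr_ge0.
  have bl : bm (fun z => lam z * (g y z - a y)) by exact: bmM.
  have t4 : \int[gam]_z (lam z * (g y z - a y)) - k / 2 * L2 <=
      k^-1 / 2 * \int[gam]_z ((g y z - a y) ^+ 2).
    rewrite -EZ; last exact: bmX.
    rewrite -EZ; last exact: bmX.
    rewrite -EB//; last by apply: bZ; exact: bmX.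
    apply: Ele => [||z].
    - by apply: bmB => //; apply: bZ; exact: bmX.
    - by apply: bZ; exact: bmX.
    rewrite -subr_ge0 (_ : _ - _ = (g y z - a y - k * lam z) ^+ 2 / (2 * k)).
      by rewrite divr_ge0 ?sqr_ge0// mulr_ge0// ltW.
    by field; rewrite gt_eqF.
  rewrite kE; clear -t1 t2 t3 t4; lra.
have blam2 : bm (fun p : T' * T => lam p.2 * (g p.1 p.2 - a p.1)).
  by apply: bmM => //; apply: (bm_comp blam); meas.
have lowE : abar + VG / kap / 2 - (e * m2 + M2 * m4) <= \int[Q]_y b y.
  pose f1 y := \int[gam]_z (lam z * (g y z - a y)).
  have bf1 : bm f1 by exact: (bm_int gam (f := fun y z => lam z * (g y z - a y))).
  pose f2 y := (kap + m * (a y - abar)) / 2 * L2.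
  have baa : bm (fun y => a y - abar) by apply: bmB => //; exact: bm_cst.
  have bf2 : bm f2.
    apply: bmM; last exact: bm_cst.
    apply: bmM; last exact: bm_cst.
    by apply: bmD; [exact: bm_cst|exact: bZ].
  have f1E : \int[Q]_y f1 y = VG / kap.
    rewrite /f1 (Efubini Q gam (f := fun y z => lam z * (g y z - a y)))//.
    rewrite mulrC -EZ; last exact: bmX.
    apply: eq_Rintegral => z _; rewrite EZ -?GaE; last by apply: bmB => //; exact: ba.
    by rewrite /lam expr2 mulrAC mulrC.
  have f2E : \int[Q]_y f2 y = kap / 2 * L2.
    transitivity (\int[Q]_y (kap / 2 * L2 + m / 2 * L2 * (a y - abar))).
      by apply: eq_Rintegral => y _; rewrite /f2; ring.
    rewrite ED; [|exact: bm_cst|exact: bZ].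
    by rewrite EcstE EZ// EB ?EcstE -?abarE ?subrr ?mulr0 ?addr0//; exact: bm_cst.
  have := @Ele _ _ _ Q (fun y => a y + f1 y - f2 y - (e * m2 + M2 * m4)) b.
  have c1 : bm (fun y => a y + f1 y) by exact: bmD.
  have c2 : bm (fun y => a y + f1 y - f2 y) by exact: bmB.
  have c3 : bm (fun _ : T' => e * m2 + M2 * m4) := bm_cst _ _.
  rewrite EB// EB// ED// EcstE f1E f2E -abarE => /(_ (bmB c2 c3) bb low).
  rewrite L2E (_ : kap / 2 * (VG / kap ^+ 2) = VG / kap / 2); last first.
    by field; rewrite gt_eqF.
  by clear; lra.
have Eb0 : 0 <= \int[Q]_y b y by apply: Ege0 => y; exact: primV_ge0.
have tan := prim_tangent pC1 ab0 Eb0.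
have kk : C1 abar * (VG / kap / 2) = dC1 abar / 2 * (rho ^+ 2 * VG).
  have Ca0 := profile_gt0 pC ab0; have dCa0 := profile_dgt0 pC ab0.
  have : kap^-1 = rho ^+ 2 * (dC1 abar / C1 abar) by rewrite rk// invf_div.
  move=> ->; by field; rewrite gt_eqF.
have dC1a0 := profile_dgt0 pC1 ab0.
have q1 : dC1 abar / 2 * \int[gam]_z ((ou rho G z - abar) ^+ 2) <=
    dC1 abar / 2 * (rho ^+ 2 * VG) by rewrite ler_pM2l// divr_gt0.
have rho21 : rho ^+ 2 <= 1 by rewrite exprn_ile1//; case/andP: r1'.
have q2 : e * \int[gam]_z ((ou rho G z - abar) ^+ 2) <= e * m2.
  rewrite ler_pM2l// (le_trans oV)// (le_trans _ VG2)//.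
  by rewrite ler_piMl.
have q3 : M1 * \int[gam]_z ((ou rho G z - abar) ^+ 4) <= M1 * m4.
  by rewrite ler_pM2l.
have q4 : C1 abar * (e * m2 + M2 * m4) <= C1 (Num.max lo hi) * (e * m2 + M2 * m4).
  by rewrite ler_wpM2r// addr_ge0// mulr_ge0// ltW.
have q5 : e * m2 + C1 (Num.max lo hi) * (e * m2) = eta * m2.
  rewrite /e; field; rewrite gt_eqF// addr_gt0//.
have q6 := ler_wpM2l (ltW Cab0) lowE.
move: up; rewrite ler_norml => /andP[_ up].
rewrite -/b -/G; clear -up q1 q2 q3 q4 q5 q6 tan kk; lra.
Qed.

End local_inequality.

(** * Interpolation along the heat flow *)

Section heat.
Context {R : realType} (n : nat).
Notation T := (n.-tuple R).
Notation gam := (std_gaussian R n).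

Definition heat (r : R) (phi : T -> R) (x : T) : R :=
  \int[gam]_y phi (lin 1 (Num.sqrt r) x y).

Lemma bm_heat (r : R) (phi : T -> R) : bm phi -> bm (heat r phi).
Proof. by move=> bp; apply: bm_int; apply: (bm_comp bp); meas. Qed.

Lemma heat_seg (r a b : R) (phi : T -> R) x : bm phi ->
  (forall y, a <= phi y <= b) -> a <= heat r phi x <= b.
Proof. by move=> bp ps; apply: Eseg => //; apply: (bm_comp bp); meas. Qed.

Lemma heat_heat (r s : R) (phi : T -> R) (x : T) : 0 <= r -> 0 <= s -> bm phi ->
  heat r (heat s phi) x = heat (r + s) phi x.
Proof.
move=> r0 s0 bp; pose F u := phi (lin 1 1 x u).
have bF : bm F by apply: (bm_comp bp); meas.
transitivity (\int[gam]_y \int[gam]_z F (lin (Num.sqrt r) (Num.sqrt s) y z)).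
  apply: eq_Rintegral => y _; apply: eq_Rintegral => z _; congr phi.
  by apply: eq_from_tnth => i; rewrite !tnth_lin; ring.
rewrite (@gauss_stable _ _ _ _ (Num.sqrt (r + s))) ?sqrtr_ge0//; last first.
  by rewrite !sqr_sqrtr ?addr_ge0.
apply: eq_Rintegral => y _; congr phi.
by apply: eq_from_tnth => i; rewrite !tnth_lin; ring.
Qed.

(** Moving x by w amounts to moving the Gaussian variable by w / sqrt r, so [gauss_shift] makes the
    flow Lipschitz from mere boundedness of phi. *)
Lemma heat_lipschitz (r M : R) (phi : T -> R) (x w : T) : 0 < r ->
  measurable_fun setT phi -> (forall y, 0 <= phi y <= M) ->
  `|heat r phi (lin 1 1 x w) - heat r phi x| <=
  M * (shift_const + 1) / Num.sqrt r * \sum_(i < n) `|tnth w i|.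
Proof.
move=> r0 mp pM; pose F u := phi (lin 1 (Num.sqrt r) x u).
have mF : measurable_fun setT F by apply: measurableT_comp => //; meas.
have sr0 : 0 < Num.sqrt r by rewrite sqrtr_gt0.
have := @gauss_shift _ n F M (lin (Num.sqrt r)^-1 0 w w) mF (fun u => pM _).
congr (`|_ - _| <= _).
  apply: eq_Rintegral => y _; rewrite /F; congr phi.
  apply: eq_from_tnth => i; rewrite !tnth_lin.
  by field; rewrite gt_eqF.
rewrite !mulr_sumr.
apply: eq_bigr => i _; rewrite tnth_lin mul0r addr0 normrM gtr0_norm ?invr_gt0//.
by ring.
Qed.

Definition gauss_m4 : R := fine (\int[gam]_x ((\sum_(i < n) `|tnth x i|) ^+ 4)%:E).

Lemma gauss_m4_ge0 : 0 <= gauss_m4.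
Proof.
rewrite /gauss_m4 fine_ge0//; apply: integral_ge0 => x _.
by rewrite lee_fin exprn_even_ge0.
Qed.

(** Centring at b rather than at the mean gives the moment bound at once. Passing to the mean a uses
    (u - v)^4 <= 8 u^4 + 8 v^4 and Jensen for (a - b)^4, whence 16 = 8 + 8. *)
Lemma E_center4_le (g : T -> R) (b L : R) : bm g -> 0 <= L ->
  (forall z, `|g z - b| <= L * \sum_(i < n) `|tnth z i|) ->
  \int[gam]_z ((g z - \int[gam]_w g w) ^+ 4) <= 16 * (L ^+ 4 * gauss_m4).
Proof.
move=> bg L0 gL; set a := \int[gam]_w g w.
have bgb : bm (fun z => g z - b) by apply: bmB => //; exact: bm_cst.
have bga : bm (fun z => g z - a) by apply: bmB => //; exact: bm_cst.
have bgb4 := bmX 4 bgb; have bga4 := bmX 4 bga.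
have m4E : (\int[gam]_x ((\sum_(i < n) `|tnth x i|) ^+ 4)%:E)%E = gauss_m4%:E.
  rewrite /gauss_m4 fineK// ge0_fin_numE ?gauss_exp4_lty//.
  by apply: integral_ge0 => x _; rewrite lee_fin exprn_even_ge0.
have mS : measurable_fun [set: T] (fun x => ((\sum_(i < n) `|tnth x i|) ^+ 4)%:E).
  apply/measurable_EFinP; apply: measurable_funX; apply: measurable_sum => i.
  by apply: measurableT_comp => //; exact: measurable_tnth.
have h1 : \int[gam]_z ((g z - b) ^+ 4) <= L ^+ 4 * gauss_m4.
  rewrite -lee_fin bm_EFin_int// EFinM -m4E -ge0_integralZl//; last 2 first.
  - by move=> x _; rewrite lee_fin exprn_even_ge0.
  - by rewrite lee_fin exprn_ge0.
  apply: ge0_le_integral => //.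
  - by move=> x _; rewrite lee_fin exprn_even_ge0.
  - by apply/measurable_EFinP; have [] := bgb4.
  - by apply: emeasurable_funM.
  move=> z _; rewrite -EFinM lee_fin -exprMn.
  rewrite -[X in X <= _]ger0_norm ?exprn_even_ge0// normrX lerXn2r ?nnegrE//.
  exact: le_trans (gL z).
have h2 : (a - b) ^+ 4 <= \int[gam]_z ((g z - b) ^+ 4).
  have := Eexp4_le gam bgb; rewrite EB ?EcstE//; exact: bm_cst.
apply: (@le_trans _ _ (\int[gam]_z (8 * (g z - b) ^+ 4 + 8 * (a - b) ^+ 4))).
  apply: Ele => [//||z].
    by apply: bmD; [apply: bmM => //; exact: bm_cst|exact: bm_cst].
  have h (u v : R) : (u - v) ^+ 4 <= 8 * u ^+ 4 + 8 * v ^+ 4.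
    have e1 : (u - v) ^+ 2 <= 2 * (u ^+ 2 + v ^+ 2).
      by have := sqr_ge0 (u + v); lra.
    have -> : 8 * u ^+ 4 + 8 * v ^+ 4 = 4 * (2 * ((u ^+ 2) ^+ 2 + (v ^+ 2) ^+ 2)) by ring.
    apply: (@le_trans _ _ (4 * (u ^+ 2 + v ^+ 2) ^+ 2)); last first.
      by rewrite ler_pM2l//; have := sqr_ge0 (u ^+ 2 - v ^+ 2); lra.
    have -> : 4 * (u ^+ 2 + v ^+ 2) ^+ 2 = (2 * (u ^+ 2 + v ^+ 2)) ^+ 2 by ring.
    rewrite (_ : (u - v) ^+ 4 = ((u - v) ^+ 2) ^+ 2); last by rewrite -exprM.
    by rewrite lerXn2r ?nnegrE ?sqr_ge0// mulr_ge0// addr_ge0 ?sqr_ge0.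
  have := h (g z - b) (a - b).
  by rewrite (_ : g z - b - (a - b) = g z - a)//; ring.
have b8 : bm (fun z => 8 * (g z - b) ^+ 4) by apply: bmM => //; exact: bm_cst.
rewrite ED//; last exact: bm_cst.
by rewrite EZ// EcstE; clear -h1 h2; lra.
Qed.

End heat.

Section interpolation.
Context {R : realType} (n : nat).
Notation T := (n.-tuple R).
Notation gam := (std_gaussian R n).

Lemma primV_lipschitz (C dC : R -> R) (pC : profile C dC) (lo s s' : R) :
  0 < lo -> prim C lo <= s -> prim C lo <= s' ->
  `|primV pC s - primV pC s'| <= `|s - s'| / C lo.
Proof.
move=> lo0; have Cl := profile_gt0 pC lo0.
wlog ss : s s' / s <= s'.
  move=> H ls ls'; have [ss|/ltW ss] := leP s s'; first exact: H.
  by rewrite distrC [X in _ <= X / _]distrC; exact: H.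
move=> ls ls'; have Us := prim_ge0 pC lo.
have s0 : 0 <= s by lra.
have s'0 : 0 <= s' by lra.
have Vss := primV_nd pC ss.
rewrite distrC [X in _ <= X / _]distrC !ger0_norm ?subr_ge0//.
have la : lo <= primV pC s by rewrite -(primVK pC (ltW lo0)); exact: primV_nd.
rewrite ler_pdivlMr// -{2}(primK pC s0) -{2}(primK pC s'0).
have [|/(_ _) + _] := @prim_sandwich _ C dC pC (primV pC s) (primV pC s') _ Vss.
  exact: primV_ge0.
move=> /(_ (lt_le_trans lo0 la)); apply: le_trans.
by rewrite mulrC ler_wpM2r ?subr_ge0// (profile_le pC).
Qed.

(* Interpolates between prim C1 of the left mean at s = 0 and the integral of
   prim C1 of the Ornstein-Uhlenbeck average at s = 1, when h is primV of the
   heat flow run for the remaining time 1 - s. *)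
Definition interp (C1 : R -> R) (rho s : R) (h : T -> R) : R :=
  \int[gam]_x prim C1 (\int[gam]_y
    h (lin (Num.sqrt s * rho) (Num.sqrt s * Num.sqrt (1 - rho ^+ 2)) x y)).

(** Over a step e the function h varies with the increment by [L * Num.sqrt e] times an l1 norm, so
    the variances are of order e and the fourth moments of order e^2. B is chosen before eta, which
    keeps the sum of the errors over all steps under control. *)
Lemma interp_step (C dC C1 dC1 : R -> R) (pC : profile C dC)
    (pC1 : profile C1 dC1) (lo hi r0 : R) (phi : T -> R) : 0 < lo -> 0 < r0 ->
  supported (fun y => C y / dC y) ->
  bm phi -> (forall x, prim C lo <= phi x <= prim C hi) ->
  exists2 B : R, 0 <= B & forall eta : R, 0 < eta ->
  exists2 M : R, 0 < M & forall rho s e r : R, 0 < rho <= 1 ->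
    (forall a : R, 0 < a -> rho ^+ 2 * (dC1 a / C1 a) = dC a / C a) ->
    0 <= s -> 0 <= e -> r0 <= r ->
    interp C1 rho (s + e) (primV pC \o heat r phi) <=
    interp C1 rho s (primV pC \o heat (r + e) phi) +
      (eta * (B * e) + M * (B * e) ^+ 2).
Proof.
move=> lo0 r00 kC bp ps.
have Cl := profile_gt0 pC lo0.
have Ul0 : 0 <= prim C lo := prim_ge0 pC lo.
have Uh0 : 0 <= prim C hi := prim_ge0 pC hi.
have sc0 := @shift_const_ge0 R.
have sr0 : 0 < Num.sqrt r0 by rewrite sqrtr_gt0.
pose L := prim C hi * (shift_const + 1) / Num.sqrt r0 / C lo.
have L0 : 0 <= L.
  apply: divr_ge0; last exact: ltW.
  apply: divr_ge0; last exact: ltW.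
  by apply: mulr_ge0 => //; rewrite addr_ge0.
have K0 := gauss_m4_ge0 (R := R) n.
(* The square of [B * e] is the bound of [E_center4_le] with Lipschitz constant [L * Num.sqrt e]. *)
pose B := 4 * L ^+ 2 * Num.sqrt (gauss_m4 (R := R) n).
have B0 : 0 <= B.
  by apply: mulr_ge0; rewrite ?sqrtr_ge0// mulr_ge0// sqr_ge0.
exists B => // eta eta0.
have hi_lo : lo <= hi.
  rewrite leNgt; apply/negP => hl; have /andP[l1 l2] := ps point.
  have [h0|h0] := leP 0 hi.
    by have := prim_lt pC h0 hl; have := le_trans l1 l2; lra.
  have := prim_lt pC (lexx 0) lo0; rewrite prim0.
  by rewrite (prim_le0 _ (ltW h0)) in l2; have := le_trans l1 l2; lra.
have [M M0 HM] := local_inequality n pC pC1 hi lo0 eta0 kC.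
exists M => // rho s e r r1 rk s0 e0 rr.
have r_gt0 : 0 < r by exact: lt_le_trans rr.
pose sg := Num.sqrt (1 - rho ^+ 2).
have sg0 : 0 <= sg by exact: sqrtr_ge0.
have rho0 : 0 < rho by case/andP: r1.
pose h := primV pC \o heat r phi.
have bh : bm h by apply: bm_nd; [exact: primV_nd|exact: bm_heat].
have hs x : lo <= h x <= hi.
  apply: primV_seg; [exact: ltW| |exact: heat_seg].
  by rewrite (le_trans (ltW lo0)).
pose p x y := lin (Num.sqrt s * rho) (Num.sqrt s * sg) x y : T.
pose g x y z := h (lin 1 (Num.sqrt e) (p x y) z).
have bg3 : bm (fun q : (T * T) * T => g q.1.1 q.1.2 q.2).
  by apply: (bm_comp bh); rewrite /p; meas.
have bg x : bm (fun q : T * T => g x q.1 q.2).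
  by apply: (bm_comp bh); rewrite /p; meas.
have gs x y z : lo <= g x y z <= hi by exact: hs.
have gL x y z : `|g x y z - h (p x y)| <= (L * Num.sqrt e) * \sum_(i < n) `|tnth z i|.
  have phi0 u : 0 <= phi u <= prim C hi.
    by have /andP[l1 l2] := ps u; rewrite (le_trans Ul0).
  have -> : g x y z = h (lin 1 1 (p x y) (lin (Num.sqrt e) 0 z z)).
    rewrite /g; congr h; apply: eq_from_tnth => i; rewrite !tnth_lin; ring.
  have hseg u := heat_seg r u bp ps.
  have l1 u : prim C lo <= heat r phi u by case/andP: (hseg u).
  apply: (le_trans (primV_lipschitz pC lo0 (l1 _) (l1 _))).
  rewrite ler_pdivrMr//.
  apply: (le_trans (heat_lipschitz _ _ r_gt0 (bp.1) phi0)).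
  have -> : \sum_(i < n) `|tnth (lin (Num.sqrt e) 0 z z) i| =
      Num.sqrt e * \sum_(i < n) `|tnth z i|.
    rewrite mulr_sumr; apply: eq_bigr => i _.
    by rewrite tnth_lin mul0r addr0 normrM ger0_norm// sqrtr_ge0.
  rewrite (_ : L * _ * _ * _ = (prim C hi * (shift_const + 1) / Num.sqrt r0) *
    (Num.sqrt e * \sum_(i < n) `|tnth z i|)); last first.
    by rewrite /L; field; rewrite !gt_eqF.
  apply: ler_wpM2r; first by rewrite mulr_ge0 ?sqrtr_ge0 ?sumr_ge0.
  apply: ler_wpM2l; first by rewrite mulr_ge0// addr_ge0.
  by rewrite lef_pV2 ?posrE ?sqrtr_gt0// ler_wsqrtr.
have Le0 : 0 <= L * Num.sqrt e by rewrite mulr_ge0// sqrtr_ge0.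
have bgz x y : bm (g x y) by apply: (bm_comp bh); meas.
have m4 x y : \int[gam]_z ((g x y z - \int[gam]_w g x y w) ^+ 4) <= (B * e) ^+ 2.
  apply: (le_trans (E_center4_le (bgz x y) Le0 (gL x y))).
  rewrite le_eqVlt; apply/orP; left; apply/eqP.
  have -> : (L * Num.sqrt e) ^+ 4 = L ^+ 4 * (Num.sqrt e ^+ 2) ^+ 2 by ring.
  rewrite sqr_sqrtr// /B.
  have {1}-> : gauss_m4 (R := R) n = Num.sqrt (gauss_m4 (R := R) n) ^+ 2.
    by rewrite sqr_sqrtr.
  by ring.
have m2 x y : \int[gam]_z ((g x y z - \int[gam]_w g x y w) ^+ 2) <= B * e.
  have V0 : 0 <= \int[gam]_z ((g x y z - \int[gam]_w g x y w) ^+ 2).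
    by apply: Ege0 => z; exact: sqr_ge0.
  rewrite -(ler_pXn2r (n := 2)) ?nnegrE//; last exact: mulr_ge0.
  apply: le_trans (m4 x y).
  have bd : bm (fun z => g x y z - \int[gam]_w g x y w).
    by apply: bmB => //; exact: bm_cst.
  apply: (le_trans (Esqr_le gam (bmX 2 bd))).
  rewrite le_eqVlt; apply/orP; left; apply/eqP.
  by apply: eq_Rintegral => z _; rewrite -exprM.
have loc x := HM _ _ gam (g x) rho _ _ r1 rk (bg x) (gs x) (m2 x) (m4 x).
have r1' : 0 <= rho <= 1 by case/andP: r1 => ? ->; rewrite ltW.
have se0 : 0 <= s + e by rewrite addr_ge0.
pose W u := prim C1 (\int[gam]_y h (lin rho (sg * Num.sqrt (s + e)) u y)).
have WE u : W u = prim C1 (\int[gam]_y h (lin rho (sg * Num.sqrt (s + e)) u y)).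
  by [].
have bW : bm W.
  apply: bm_nd; first exact: (prim_nd pC1).
  by apply: bm_int; apply: (bm_comp bh); meas.
have sqr_se : Num.sqrt (s + e) ^+ 2 = Num.sqrt s ^+ 2 + Num.sqrt e ^+ 2.
  by rewrite !sqr_sqrtr.
(* The outer integral, over a Gaussian vector of variance s + e, splits into
   two; so does the inner one, by [inner] below. *)
have lhsE : interp C1 rho (s + e) h =
    \int[gam]_x \int[gam]_z W (lin (Num.sqrt s) (Num.sqrt e) x z).
  have W_stable := @gauss_stable _ _ (Num.sqrt s) (Num.sqrt e)
    (Num.sqrt (s + e)) W (sqrtr_ge0 _) (sqrtr_ge0 _) (sqrtr_ge0 _) sqr_se bW.
  transitivity (\int[gam]_x W (lin (Num.sqrt (s + e)) 0 x x)); last first.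
    exact/esym.
  rewrite /interp.
  apply: eq_Rintegral => x _.
  rewrite WE; apply: (congr1 (prim C1)).
  apply: eq_Rintegral => y _; congr h.
  by apply: eq_from_tnth => i; rewrite !tnth_lin -/sg; ring.
(* With w the increment of the inner vector and z that of the outer one, the displacement is sqrt e
   times rho z + sg w, the argument of [ou rho]. *)
have inner x z : \int[gam]_y h (lin rho (sg * Num.sqrt (s + e))
      (lin (Num.sqrt s) (Num.sqrt e) x z) y) =
    ou rho (fun w => \int[gam]_y g x y w) z.
  pose F u := h (lin 1 sg (lin (Num.sqrt s * rho) (Num.sqrt e * rho) x z) u).
  have bF : bm F by apply: (bm_comp bh); meas.
  transitivity (\int[gam]_y F (lin (Num.sqrt (s + e)) 0 y y)).
    apply: eq_Rintegral => y _; rewrite /F; congr h.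
    by apply: eq_from_tnth => i; rewrite !tnth_lin; ring.
  have F_stable := @gauss_stable _ _ (Num.sqrt s) (Num.sqrt e)
    (Num.sqrt (s + e)) F (sqrtr_ge0 _) (sqrtr_ge0 _) (sqrtr_ge0 _) sqr_se bF.
  rewrite -[LHS]F_stable [LHS]Efubini; last by apply: (bm_comp bF); meas.
  apply: eq_Rintegral => w _; apply: eq_Rintegral => y _.
  rewrite /F /g; congr h.
  by apply: eq_from_tnth => i; rewrite !tnth_lin -/sg; ring.
(* [prim C] undoes [primV], so the mean over z lengthens the heat flow from r to [r + e]. *)
have rhsE x y : primV pC (\int[gam]_z prim C (g x y z)) =
    (primV pC \o heat (r + e) phi) (p x y).
  rewrite /= addrC -heat_heat//; last exact: ltW.
  congr (primV pC _); apply: eq_Rintegral => z _.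
  rewrite /g /h /= primK//.
  by have /andP[q1 q2] := heat_seg r (lin 1 (Num.sqrt e) (p x y) z) bp ps; lra.
rewrite lhsE.
have bh' : bm (primV pC \o heat (r + e) phi).
  by apply: bm_nd; [exact: primV_nd|exact: bm_heat].
have bI : bm (fun x => prim C1 (\int[gam]_y (primV pC \o heat (r + e) phi) (p x y))).
  apply: bm_nd; first exact: (prim_nd pC1).
  apply: bm_int; apply: (bm_comp bh'); rewrite /p; meas.
rewrite /interp -/sg -(EcstE gam (eta * (B * e) + M * (B * e) ^+ 2)) -ED//; last exact: bm_cst.
apply: Ele => [||x].
- by apply: bm_int; apply: (bm_comp bW); meas.
- by apply: bmD => //; exact: bm_cst.
have -> : \int[gam]_z W (lin (Num.sqrt s) (Num.sqrt e) x z) =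
    \int[gam]_z prim C1 (ou rho (fun w => \int[gam]_y g x y w) z).
  by apply: eq_Rintegral => z _; rewrite WE inner.
have -> : \int[gam]_y (primV pC \o heat (r + e) phi) (p x y) =
    \int[gam]_y primV pC (\int[gam]_z prim C (g x y z)).
  by apply: eq_Rintegral => y _; rewrite rhsE.
by rewrite addrA; exact: loc x.
Qed.

End interpolation.

(** * Summation of the steps, and the inequality for bounded functions *)

Section core_inequality.
Context {R : realType} (n : nat).
Notation T := (n.-tuple R).
Notation gam := (std_gaussian R n).

Lemma interp0 (C dC C1 : R -> R) (pC : profile C dC) (rho : R) (phi : T -> R) :
  interp C1 rho 0 (primV pC \o heat 1 phi) =
  prim C1 (primV pC (\int[gam]_x phi x)).
Proof.
rewrite /interp -[RHS](EcstE gam); apply: eq_Rintegral => x _.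
apply: (congr1 (prim C1)); rewrite -[RHS](EcstE gam).
apply: eq_Rintegral => y _; rewrite /=; apply: (congr1 (primV pC)).
apply: eq_Rintegral => z _; apply: (congr1 phi).
by apply: eq_from_tnth => i; rewrite !tnth_lin sqrtr0 sqrtr1; ring.
Qed.

Lemma interp_le (C dC C1 dC1 : R -> R) (pC : profile C dC)
    (pC1 : profile C1 dC1) (lo hi rho r0 : R) (phi : T -> R) : 0 < lo ->
  supported (fun y => C y / dC y) ->
  0 < rho <= 1 ->
  (forall a : R, 0 < a -> rho ^+ 2 * (dC1 a / C1 a) = dC a / C a) ->
  bm phi -> (forall x, prim C lo <= phi x <= prim C hi) ->
  0 < r0 < 1 ->
  interp C1 rho (1 - r0) (primV pC \o heat r0 phi) <=
  prim C1 (primV pC (\int[gam]_x phi x)).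
Proof.
move=> lo0 kC r1 rk bp ps /andP[r00 r01].
have [B B0 HB] := interp_step pC pC1 lo0 r00 kC bp ps.
set K := prim C1 _.
apply/ler_addgt0Pr => d d0.
(* Half of d pays for the errors linear in e, the other half for the quadratic ones, whose sum is of
   order 1 / N; adding 1 to B allows for B = 0. *)
have e0 : 0 < d / 2 / (B + 1) by rewrite !divr_gt0// ltr_wpDl.
have [M M0 HM] := HB _ e0; set eta := d / 2 / (B + 1) in e0 HM.
have MB0 : 0 <= M * B ^+ 2 / (d / 2).
  by apply: divr_ge0; [apply: mulr_ge0; [exact: ltW|exact: sqr_ge0]|lra].
have := archi_boundP MB0; set N := Num.bound _ => NB.
have N0 : 0 < N%:R :> R by exact: le_lt_trans NB.
pose e := (1 - r0) / N%:R.
have e_ge0 : 0 <= e by rewrite divr_ge0 ?subr_ge0 ?ltW.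
have Ne : N%:R * e = 1 - r0 by rewrite /e mulrC divfK ?gt_eqF.
pose err := eta * (B * e) + M * (B * e) ^+ 2.
have step k : (k <= N)%N ->
    interp C1 rho (k%:R * e) (primV pC \o heat (1 - k%:R * e) phi) <=
    K + k%:R * err.
  elim: k => [|k ih] kN; first by rewrite !mul0r addr0 subr0 interp0.
  have ke : k.+1%:R * e <= 1 - r0 by rewrite -Ne ler_wpM2r// ler_nat.
  have ke0 : 0 <= k%:R * e by rewrite mulr_ge0.
  have rr : r0 <= 1 - k.+1%:R * e by lra.
  have := HM rho (k%:R * e) e (1 - k.+1%:R * e) r1 rk ke0 e_ge0 rr.
  rewrite (_ : k%:R * e + e = k.+1%:R * e); last by rewrite -natr1; ring.
  rewrite (_ : 1 - k.+1%:R * e + e = 1 - k%:R * e); last by rewrite -natr1; ring.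
  move=> h; apply: (le_trans h); rewrite -/err.
  rewrite (_ : K + k.+1%:R * err = K + k%:R * err + err); last first.
    by rewrite -natr1; ring.
  by rewrite lerD2r; exact: ih (ltnW kN).
have := step N (leqnn N); rewrite Ne subKr => h.
apply: (le_trans h); rewrite lerD2l.
have r0le : 0 <= 1 - r0 <= 1 by rewrite subr_ge0 ltW//=; lra.
rewrite (_ : N%:R * _ = eta * B * (1 - r0) + M * B ^+ 2 / N%:R * (1 - r0) ^+ 2); last first.
  by rewrite /err /e; field; rewrite gt_eqF.
have h1 : eta * B * (1 - r0) <= d / 2.
  apply: (@le_trans _ _ (eta * B)).
    by case/andP: r0le => ? ?; rewrite ler_piMr// mulr_ge0// ltW.
  have <- : eta * (B + 1) = d / 2 by rewrite /eta divfK// gt_eqF// ltr_wpDl.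
  by rewrite ler_wpM2l ?(ltW e0)//; lra.
have h2 : M * B ^+ 2 / N%:R * (1 - r0) ^+ 2 <= d / 2.
  apply: (@le_trans _ _ (M * B ^+ 2 / N%:R)).
    rewrite ler_piMr ?divr_ge0 ?mulr_ge0 ?sqr_ge0 ?(ltW M0)//.
    by case/andP: r0le => ? ?; rewrite exprn_ile1.
  rewrite ler_pdivrMr// [_ * N%:R]mulrC -ler_pdivrMr ?divr_gt0//.
  exact: ltW.
by clear -h1 h2; lra.
Qed.

(** By convexity of [prim C], [primV] of the smoothed [prim C (f x)] is at least the smoothed f. The
    variances (1 - r0) (1 - rho^2) and r0 then add up to what [ou] requires at correlation sqrt (1 -
    r0) rho. *)
Lemma interp_ge (C dC C1 dC1 : R -> R) (pC : profile C dC)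
    (pC1 : profile C1 dC1) (lo hi rho r0 : R) (f : T -> R) : 0 < lo ->
  0 < rho <= 1 -> bm f -> (forall x, lo <= f x <= hi) -> 0 < r0 < 1 ->
  \int[gam]_x prim C1 (ou (Num.sqrt (1 - r0) * rho) f x) <=
  interp C1 rho (1 - r0) (primV pC \o heat r0 (fun x => prim C (f x))).
Proof.
move=> lo0 /andP[rho0 rho1] bf fs /andP[r00 r01].
have bU : bm (fun x => prim C (f x)) by apply: bm_nd => //; exact: (prim_nd pC).
have bh : bm (primV pC \o heat r0 (fun x => prim C (f x))).
  by apply: bm_nd; [exact: primV_nd|exact: bm_heat].
apply: Ele => [||x].
- by apply: bm_nd; [exact: (prim_nd pC1)|exact: bm_ou].
- apply: bm_nd; first exact: (prim_nd pC1).
  by apply: bm_int; apply: (bm_comp bh); meas.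
apply: (prim_nd pC1).
have s0 : 0 <= 1 - r0 by rewrite subr_ge0 ltW.
have q1 : 0 <= 1 - rho ^+ 2 by rewrite subr_ge0 exprn_ile1// ltW.
pose F u := f (lin 1 1 (lin (Num.sqrt (1 - r0) * rho) 0 x x) u).
have bF : bm F by apply: (bm_comp bf); meas.
have F_stable := @gauss_stable _ _
  (Num.sqrt (1 - r0) * Num.sqrt (1 - rho ^+ 2)) (Num.sqrt r0)
  (Num.sqrt (1 - (Num.sqrt (1 - r0) * rho) ^+ 2)) F
  (mulr_ge0 (sqrtr_ge0 _) (sqrtr_ge0 _)) (sqrtr_ge0 _) (sqrtr_ge0 _) _ bF.
apply: (@le_trans _ _ (\int[gam]_y heat r0 f
    (lin (Num.sqrt (1 - r0) * rho)
      (Num.sqrt (1 - r0) * Num.sqrt (1 - rho ^+ 2)) x y))).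
  rewrite le_eqVlt; apply/orP; left; apply/eqP.
  transitivity (\int[gam]_y F
      (lin (Num.sqrt (1 - (Num.sqrt (1 - r0) * rho) ^+ 2)) 0 y y)).
    apply: eq_Rintegral => y _; apply: (congr1 f).
    by apply: eq_from_tnth => i; rewrite !tnth_lin; ring.
  rewrite -F_stable.
  - apply: eq_Rintegral => y _; apply: eq_Rintegral => z _; apply: (congr1 f).
    by apply: eq_from_tnth => i; rewrite !tnth_lin; ring.
  - rewrite [in RHS]exprMn !sqr_sqrtr//; last 2 first.
    + exact: ltW.
    + rewrite exprMn sqr_sqrtr// subr_ge0 mulr_ile1 ?sqr_ge0//; first lra.
      by rewrite exprn_ile1// ltW.
    by rewrite exprMn sqr_sqrtr//; ring.
apply: Ele => [||y].
- by apply: (bm_comp (bm_heat _ bf)); meas.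
- by apply: (bm_comp bh); meas.
set p := lin _ _ x y; rewrite /=.
have /andP[a0 _] := heat_seg r0 p bf fs.
have a_gt0 : 0 < heat r0 f p by exact: lt_le_trans a0.
rewrite -[X in X <= _](primVK pC (ltW a_gt0)); apply: primV_nd.
set a := heat r0 f p in a0 a_gt0 *.
have bfp : bm (fun z => f (lin 1 (Num.sqrt r0) p z)) by apply: (bm_comp bf); meas.
have bfa : bm (fun z => f (lin 1 (Num.sqrt r0) p z) - a).
  by apply: bmB => //; exact: bm_cst.
have bCfa : bm (fun z => C a * (f (lin 1 (Num.sqrt r0) p z) - a)).
  by apply: bmM => //; exact: bm_cst.
have <- : \int[gam]_z (prim C a + C a * (f (lin 1 (Num.sqrt r0) p z) - a)) = prim C a.
  rewrite ED//; last exact: bm_cst.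
  rewrite EcstE EZ// EB//; last exact: bm_cst.
  by rewrite EcstE -/a subrr mulr0 addr0.
apply: Ele => [||z].
- by apply: bmD => //; exact: bm_cst.
- by apply: (bm_comp bU); meas.
apply: (prim_tangent pC) => //.
have /andP[fl _] := fs (lin 1 (Num.sqrt r0) p z).
by rewrite (le_trans _ fl)// ltW.
Qed.

(** The derivative of y^x in x is y^x ln y. For increases it is bounded by B^(q' + 1), since ln y <=
    B; for decreases by 1, since q >= 1 gives y^q ln(1/y) <= y / y when y < 1. The bound is thus
    uniform down to y = 0. *)
Lemma powR_lipschitz_exponent (B y q q' : R) : 1 <= B -> 0 < y <= B ->
  1 <= q <= q' -> `|y `^ q - y `^ q'| <= (q' - q) * (B `^ (q' + 1) + 1).
Proof.
move=> B1 /andP[y0 yB] /andP[q1 qq].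
have B0 : 0 < B by lra.
have E (a b : R) : expR b - expR a <= expR b * (b - a).
  have := expR_ge1Dx (a - b) => h.
  have -> : expR a = expR b * expR (a - b) by rewrite -expRD; congr expR; ring.
  have := ler_wpM2l (expR_ge0 b) h; lra.
have pw x : y `^ x = expR (x * ln y) by rewrite /powR gt_eqF.
have Bq : 0 <= B `^ (q' + 1) by exact: powR_ge0.
have qq0 : 0 <= q' - q by lra.
rewrite ler_norml; apply/andP; split.
- rewrite lerNl opprB !pw (le_trans (E _ _))//.
  rewrite (_ : _ * _ = (q' - q) * (expR (q' * ln y) * ln y)); last by ring.
  apply: ler_wpM2l => //; rewrite -pw.
  apply: (@le_trans _ _ (B `^ (q' + 1))); last by lra.
  rewrite powRD; last by apply/implyP => _; rewrite gt_eqF.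
  rewrite powRr1 ?(ltW B0)//.
  apply: (@le_trans _ _ (y `^ q' * B)).
    rewrite ler_wpM2l ?powR_ge0//.
    by have := ln_sublinear y0; lra.
  rewrite ler_wpM2r ?(ltW B0)// ge0_ler_powR ?nnegrE ?(ltW y0) ?(ltW B0)//.
  by lra.
- rewrite !pw (le_trans (E _ _))//.
  rewrite (_ : _ * _ = (q' - q) * (expR (q * ln y) * - ln y)); last by ring.
  apply: ler_wpM2l => //; rewrite -pw.
  apply: (@le_trans _ _ 1); last by lra.
  rewrite -lnV ?posrE//.
  have yV : 0 < y^-1 by rewrite invr_gt0.
  have [y1|y1] := leP 1 y.
    have : ln y^-1 <= 0 by rewrite ln_le0// invf_le1.
    move=> l0; apply: (@le_trans _ _ 0) => //.
    by rewrite mulr_ge0_le0// powR_ge0.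
  have yq : y `^ q <= y.
    rewrite ge1r_powR// y0 ltW//.
  have l1 : ln y^-1 <= y^-1 by have := ln_sublinear yV; lra.
  have l0 : 0 <= ln y^-1 by rewrite ln_ge0// invf_ge1// ltW.
  apply: (@le_trans _ _ (y * y^-1)).
    by apply: ler_pM => //; exact: powR_ge0.
  by rewrite divff// gt_eqF.
Qed.

Lemma prim_powR_exponent (C dC : R -> R) (pC : profile C dC) (hi x q q' : R) :
  x <= hi -> 1 <= q <= q' ->
  `|prim (fun y => C y `^ q) x - prim (fun y => C y `^ q') x| <=
  (q' - q) * (((Num.max 1 (C hi)) `^ (q' + 1) + 1) * Num.max 0 hi).
Proof.
move=> xhi /andP[q1 qq]; set B := Num.max 1 (C hi).
have B1 : 1 <= B by rewrite le_max lexx.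
have qq0 : 0 <= q' - q by lra.
have K0 : 0 <= B `^ (q' + 1) + 1 by rewrite addr_ge0// powR_ge0.
have [x0|x0] := leP x 0.
  by rewrite !prim_le0// subrr normr0 !mulr_ge0// le_max lexx.
have pq r : 1 <= r -> profile (fun y => C y `^ r) (fun y => r * C y `^ (r - 1) * dC y).
  by move=> r1; apply: profile_powR => //; lra.
have iq := integrable_profile (pq q q1) x.
have iq' := integrable_profile (pq q' (le_trans q1 qq)) x.
have iB : lebesgue_measure.-integrable `]0, x]
    (EFin \o (fun y => C y `^ q - C y `^ q')).
  by have := integrableB _ iq iq'; apply.
rewrite /prim -RintegralB//.
apply: (le_trans (le_normr_Rintegral _ iB)) => //.
apply: (@le_trans _ _ (\int[lebesgue_measure]_(y in `]0, x])
    (cst ((q' - q) * (B `^ (q' + 1) + 1)) y))); last first.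
  rewrite Rintegral_cst_itv ?(ltW x0)// subr0 mulrA ler_wpM2l ?mulr_ge0//.
  by rewrite le_max xhi orbT.
apply: le_Rintegral => //.
- exact: (integrable_norm iB).
- apply: measurable_bounded_integrable => //.
    by rewrite /= lebesgue_measure_itv/=; case: ifP => // _; rewrite ltry.
  exists `|(q' - q) * (B `^ (q' + 1) + 1)|; split; first exact: num_real.
  by move=> M mM y _; rewrite /= ltW.
- move=> y /=; rewrite in_itv/= => /andP[y0 yx].
  apply: powR_lipschitz_exponent => //; last by rewrite q1.
  rewrite (profile_gt0 pC)//= le_max (profile_le pC)//= ?orbT//.
  exact: le_trans xhi.
Qed.

Lemma profile_powR_ratio (C dC : R -> R) (pC : profile C dC) (q a : R) :
  0 < q -> 0 < a ->
  q * C a `^ (q - 1) * dC a / C a `^ q = q * (dC a / C a).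
Proof.
move=> q0 a0; have C0 := profile_gt0 pC a0.
rewrite -(mulr_powRB1 (ltW C0) q0); field.
by rewrite !gt_eqF// powR_gt0.
Qed.

Lemma hypercontractive_bounded (C dC : R -> R) (pC : profile C dC)
    (lo hi q : R) (f : T -> R) : 0 < lo ->
  supported (fun y => C y / dC y) -> 1 <= q ->
  bm f -> (forall x, lo <= f x <= hi) ->
  \int[gam]_x prim (fun y => C y `^ q) (ou (Num.sqrt q)^-1 f x) <=
  prim (fun y => C y `^ q) (primV pC (\int[gam]_x prim C (f x))).
Proof.
move=> lo0 kC q1 bf fs; have q0 : 0 < q by lra.
have sq0 : 0 < Num.sqrt q by rewrite sqrtr_gt0.
have sq1 : 0 <= (Num.sqrt q)^-1 <= 1.
  rewrite invr_ge0 (ltW sq0)/= invf_le1//.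
  by rewrite -[1]sqrtr1 ler_wsqrtr.
have bU : bm (fun x => prim C (f x)) by apply: bm_nd => //; exact: (prim_nd pC).
have Us x : prim C lo <= prim C (f x) <= prim C hi.
  by have /andP[? ?] := fs x; rewrite !(prim_nd pC).
set m := primV pC _.
have /andP[_ lohi] : lo <= lo <= hi.
  by have /andP[l1 l2] := fs point; rewrite lexx (le_trans l1).
have ms : lo <= m <= hi.
  apply: primV_seg; [exact: ltW|by rewrite (le_trans (ltW lo0))|].
  exact: Eseg.
have bo : bm (ou (Num.sqrt q)^-1 f) by exact: bm_ou.
have os x : lo <= ou (Num.sqrt q)^-1 f x <= hi.
  by apply: Eseg => //; apply: (bm_comp bf); meas.
have pq r : 1 <= r -> profile (fun y => C y `^ r) (fun y => r * C y `^ (r - 1) * dC y).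
  by move=> r1; apply: profile_powR => //; lra.
(* At q = 1 there is no room for a smaller exponent, but the average is f itself and both sides
   coincide. *)
move: q1; rewrite le_eqVlt => /orP[/eqP q1|q1].
  have C1 y : 0 < y -> C y `^ q = C y.
    by move=> y0; rewrite -q1 powRr1// ltW// (profile_gt0 pC).
  have E x : prim (fun y => C y `^ q) x = prim C x.
    apply: eq_Rintegral => y /set_mem/=; rewrite in_itv/= => /andP[y0 _].
    exact: C1.
  rewrite E primK; last by apply: Ege0 => x; exact: (prim_ge0 pC).
  rewrite le_eqVlt; apply/orP; left; apply/eqP; apply: eq_Rintegral => x _.
  rewrite E; congr prim; rewrite /ou -q1 sqrtr1 invr1 expr1n subrr sqrtr0.
  by under eq_Rintegral do rewrite lin10; rewrite EcstE.
(* Smoothing by the heat flow for time 1 - q' / q costs no more than lowering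
   the exponent from q to q'; let q' tend to q. *)
set D := (((Num.max 1 (C hi)) `^ (q + 1) + 1) * Num.max 0 hi).
have D0 : 0 <= D.
  by rewrite mulr_ge0 ?addr_ge0 ?powR_ge0// le_max lexx.
have key q' : 1 <= q' < q ->
    \int[gam]_x prim (fun y => C y `^ q) (ou (Num.sqrt q)^-1 f x) <=
    prim (fun y => C y `^ q) m + 2 * ((q - q') * D).
  move=> /andP[q'1 q'q]; have q'0 : 0 < q' by lra.
  have sq'0 : 0 < Num.sqrt q' by rewrite sqrtr_gt0.
  have r1 : 0 < (Num.sqrt q')^-1 <= 1.
    rewrite invr_gt0 sq'0/= invf_le1//.
    by rewrite -[1]sqrtr1 ler_wsqrtr.
  (* This r leaves the variance q' / q, which turns the correlation 1 / sqrt q' into 1 / sqrt q; see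
     [rE]. *)
  have r0 : 0 < 1 - q' / q < 1.
    rewrite subr_gt0 ltr_pdivrMr// mul1r q'q/=.
    by rewrite ltrBlDr ltrDl divr_gt0.
  have rk (a : R) : 0 < a -> (Num.sqrt q')^-1 ^+ 2 *
      ((q' * C a `^ (q' - 1) * dC a) / C a `^ q') = dC a / C a.
    move=> a0; rewrite profile_powR_ratio// exprVn sqr_sqrtr ?(ltW q'0)//.
    by rewrite mulKf// gt_eqF.
  have rE : Num.sqrt (1 - (1 - q' / q)) * (Num.sqrt q')^-1 = (Num.sqrt q)^-1.
    by rewrite subKr sqrtrM ?(ltW q'0)// mulrAC divff ?gt_eqF// mul1r sqrtrV ?(ltW q0).
  have h1 := interp_ge pC (pq q' q'1) lo0 r1 bf fs r0.
  have h2 := interp_le pC (pq q' q'1) lo0 kC r1 rk bU Us r0.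
  have := le_trans h1 h2; rewrite rE -/m => h.
  have q'qq : 1 <= q' <= q by rewrite q'1 ltW.
  have c1 x : x <= hi -> prim (fun y => C y `^ q) x <=
      prim (fun y => C y `^ q') x + (q - q') * D.
    move=> xh; have := prim_powR_exponent pC xh q'qq.
    rewrite ler_norml -/D => /andP[+ _]; clear; lra.
  have c2 x : x <= hi -> prim (fun y => C y `^ q') x <=
      prim (fun y => C y `^ q) x + (q - q') * D.
    move=> xh; have := prim_powR_exponent pC xh q'qq.
    rewrite ler_norml -/D => /andP[_]; clear; lra.
  have b1 : bm (fun x => prim (fun y => C y `^ q) (ou (Num.sqrt q)^-1 f x)).
    by apply: bm_nd => //; exact: (prim_nd (pq q (ltW q1))).
  have b2 : bm (fun x => prim (fun y => C y `^ q') (ou (Num.sqrt q)^-1 f x)).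
    by apply: bm_nd => //; exact: (prim_nd (pq q' q'1)).
  have h3 : \int[gam]_x prim (fun y => C y `^ q) (ou (Num.sqrt q)^-1 f x) <=
    \int[gam]_x prim (fun y => C y `^ q') (ou (Num.sqrt q)^-1 f x) + (q - q') * D.
    rewrite -(EcstE gam ((q - q') * D)) -ED//; last exact: bm_cst.
    apply: Ele => [//||x]; first by apply: bmD => //; exact: bm_cst.
    by apply: c1; case/andP: (os x).
  have mh : m <= hi by case/andP: ms.
  have h4 := c2 m mh.
  apply: (le_trans h3).
  rewrite mulr_natl mulr2n addrA lerD2r; exact: le_trans h h4.
apply/ler_addgt0Pr => d d0.
pose q' := Num.max 1 (q - d / (2 * (D + 1))).
have D1 : 0 < 2 * (D + 1) by lra.
have q'q : 1 <= q' < q.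
  by rewrite le_max lexx/= gt_max q1/= gtrBl divr_gt0.
apply: (le_trans (key q' q'q)); rewrite lerD2l.
have qd : q - q' <= d / (2 * (D + 1)).
  by rewrite lerBlDr -lerBlDl le_max lexx orbT.
apply: (@le_trans _ _ (2 * (d / (2 * (D + 1)) * (D + 1)))).
  rewrite ler_pM2l// ler_pM//; last by rewrite lerDl.
  by case/andP: q'q => _ ?; rewrite subr_ge0 ltW.
by rewrite le_eqVlt; apply/orP; left; apply/eqP; field; rewrite gt_eqF// ltr_wpDl.
Qed.

End core_inequality.

(** * Extended real values and truncation *)

Section supporting_line.
Context {R : realType}.

(** The slope is the supremum of the chord slopes to the right of a, which every chord slope from
    the left bounds above. *)
Lemma concave_supported (k : R^o -> R^o) :
  concave_function [set y : R^o | 0 < y] k -> supported (k : R -> R).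
Proof.
move=> kC a a0.
have chord (x y z : R) : 0 < x -> x < y -> y < z ->
    k x * (z - y) + k z * (y - x) <= k y * (z - x).
  move=> x0 xy yz; have zx : 0 < z - x by lra.
  have p0 : 0 <= (z - y) / (z - x) by rewrite divr_ge0 ?ltW// subr_gt0.
  have p1 : (z - y) / (z - x) <= 1 by rewrite ler_pdivrMr// mul1r; lra.
  have := kC (Itv01 p0 p1) x z.
  rewrite !mem_set/=; [|lra|lra] => /(_ isT isT).
  rewrite convRE/=.
  rewrite [X in _ <= k X -> _](_ : _ = y); last first.
    rewrite [LHS]convRE/= /unstable.onem.
    by field; rewrite gt_eqF.
  rewrite /unstable.onem.
  move=> h; have := ler_wpM2r (ltW zx) h.
  rewrite (_ : (_ + _) * (z - x) = k x * (z - y) + k z * (y - x))//.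
  by field; rewrite gt_eqF.
pose S := [set (k b - k a) / (b - a) | b in [set b : R | a < b]].
have ub (b : R) : 0 < b -> b < a -> ubound S ((k a - k b) / (a - b)).
  move=> b0 ba _ [b' /= ab' <-].
  rewrite ler_pdivlMr ?subr_gt0// mulrAC ler_pdivrMr ?subr_gt0//.
  by have := chord b a b' b0 ba ab'; lra.
have S0 : S !=set0 by exists ((k (a + 1) - k a) / (a + 1 - a)), (a + 1) => //=; lra.
have hS : has_ubound S.
  by exists ((k a - k (a / 2)) / (a - a / 2)); apply: ub; lra.
exists (sup S) => b b0; case: (ltgtP a b) => [ab|ba|<-]; last first.
- by rewrite subrr mulr0 addr0.
- have : sup S <= (k a - k b) / (a - b) by apply: ge_sup => //; exact: ub.
  by rewrite ler_pdivlMr ?subr_gt0//; lra.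
- have : (k b - k a) / (b - a) <= sup S by apply: ub_le_sup => //; exists b.
  by rewrite ler_pdivrMr ?subr_gt0//; lra.
Qed.

End supporting_line.

(** * The functions u and v on the extended half-line *)

Section extended_primitive.
Context {R : realType}.

Section one_exponent.
Variables (c dc : R -> R) (pc : profile c dc) (t : R).
Notation q := (expR (2 * t)).
Notation cq := (fun y : R => c y `^ q).

Let pq : profile cq (fun y => q * c y `^ (q - 1) * dc y).
Proof. by apply: profile_powR => //; exact: expR_gt0. Qed.

Lemma u_EFin (x : R) : u c t x%:E = (prim cq x)%:E.
Proof.
rewrite /u (_ : [set y : R | _] = `]0, x]%classic); last first.
  by apply/seteqP; split => y /=; rewrite in_itv/= lte_fin lee_fin.
rewrite /prim fineK//; apply: integrable_fin_num => //.
exact: (integrable_profile pq).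
Qed.

Lemma u_ge0 x : (0 <= u c t x)%E.
Proof. by apply: integral_ge0 => y _; rewrite lee_fin powR_ge0. Qed.

Lemma u_pinfty : u c t +oo%E = +oo%E.
Proof.
apply/eqP; rewrite eq_le leey/= leNgt; apply/negP => ufin.
have uE : u c t +oo%E = (fine (u c t +oo%E))%:E.
  by rewrite fineK// ge0_fin_numE ?u_ge0.
set K := fine _ in uE.
have K0 : 0 <= K by rewrite /K fine_ge0 ?u_ge0.
(* If the value at infinity were a finite K, a point where the primitive equals K + 1 would
   contradict monotonicity. *)
have [x x0 xE] := prim_surj pq (ltac:(lra) : 0 <= K + 1).
suff : (u c t x%:E <= u c t +oo)%E.
  by rewrite uE u_EFin lee_fin xE; lra.
have Sy : [set y : R | (0 < y%:E <= +oo)%E] = `]0, +oo[%classic.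
  by apply/seteqP; split => y /=; rewrite in_itv/= lte_fin leey andbT.
have Sx : [set y : R | (0 < y%:E <= x%:E)%E] = `]0, x]%classic.
  by apply/seteqP; split => y /=; rewrite in_itv/= lte_fin lee_fin.
rewrite /u Sx Sy; apply: ge0_subset_integral => //.
- apply/measurable_EFinP; apply: open_continuous_measurable_fun.
    exact: interval_open.
  by move=> y /set_mem/=; rewrite in_itv/= andbT => /(profile_cont pq).
- by move=> y _; rewrite lee_fin powR_ge0.
- by move=> y /=; rewrite !in_itv/= andbT => /andP[].
Qed.

Lemma v_u (x : R) : 0 <= x -> v c t (u c t x%:E) = x%:E.
Proof.
rewrite le_eqVlt => /orP[/eqP<-|x0]; first by rewrite u_EFin prim0 /v eqxx.
have U0 : 0 < prim cq x by rewrite -(prim0 cq) (prim_lt pq).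
rewrite /v u_EFin eqe gt_eqF//= -u_EFin pinvKV//.
- move=> y z /set_mem/= + /set_mem/=; case: y => [y| |]; case: z => [z| |];
    rewrite ?ltxx ?andbF//.
  rewrite !lte_fin => /andP[y0 _] /andP[z0 _]; rewrite !u_EFin => -[].
  by move=> /(prim_inj pq (ltW y0) (ltW z0)) ->.
- by rewrite mem_set//= lte_fin x0 ltry.
Qed.

(** Continuity along increasing sequences, with limit +oo allowed since the Ornstein-Uhlenbeck
    average may diverge. A limit 0 is separate: the derivative exists only at positive points, but
    the sequence is then constant. *)
Lemma u_cvg (a : R^nat) (l : \bar R) :
  {homo a : n m / (n <= m)%N >-> n <= m} -> (forall n, 0 <= a n) ->
  ((a n)%:E @[n --> \oo] --> l)%E ->
  (u c t (a n)%:E @[n --> \oo] --> u c t l)%E.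
Proof.
move=> nda a0; case: l => [r| |] al.
- have ar : a n @[n --> \oo] --> r by move/fine_cvgP : al => [].
  have ar' n : a n <= r.
    rewrite -(cvg_lim _ ar)//; apply: nondecreasing_cvgn_le => //.
    by apply/cvg_ex; exists r.
  rewrite (_ : (fun n => _) = EFin \o (fun n => prim cq (a n))); last first.
    by apply/funext => n; rewrite u_EFin.
  rewrite u_EFin; apply: cvg_EFin; first by near=> n.
  have r0 : 0 <= r by exact: le_trans (a0 0%N) (ar' 0%N).
  move: r0; rewrite le_eqVlt => /orP[/eqP r0|r0].
    rewrite (_ : _ \o _ = fun=> prim cq r); first exact: cvg_cst.
    by apply/funext => n /=; congr prim; apply/eqP; rewrite eq_le ar' -r0 a0.
  apply: (@cvg_comp _ _ _ a (prim cq) _ (nbhs r)) => //.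
  exact: derive_continuous (is_derive_prim pq r0).
- rewrite u_pinfty; apply/cvgeyPge => A.
  have [x x0 xE] := prim_surj pq (normr_ge0 A).
  move/cvgeyPge/(_ x) : al => al; near=> n.
  rewrite u_EFin lee_fin (le_trans (ler_norm A))// -xE (prim_nd pq)//.
  by rewrite -lee_fin; near: n.
- exfalso; move/cvgeNyPle : al => /(_ (-1)) [N _ /(_ N (leqnn N))] /=.
  by rewrite lee_fin => h; have := a0 N; lra.
Unshelve. all: by end_near.
Qed.

End one_exponent.
End extended_primitive.

(** * Truncation from above and monotone convergence *)

Section truncation.
Context {R : realType} (d : nat).
Notation T := (d.-tuple R).
Notation gam := (std_gaussian R d).

Lemma expR_sqrtV (t : R) : (Num.sqrt (expR (2 * t)))^-1 = expR (- t).
Proof.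
rewrite expRN; congr (_^-1).
have -> : expR (2 * t) = expR t ^+ 2 by rewrite expr2 -expRD; congr expR; ring.
by rewrite sqrtr_sqr ger0_norm// expR_ge0.
Qed.

Lemma OU_lin (t : R) (f : T -> R) (x : T) : OU t f x =
  (\int[gam]_y (f (lin (expR (- t)) (Num.sqrt (1 - expR (- t) ^+ 2)) x y))%:E)%E.
Proof.
have -> : expR (- t) ^+ 2 = expR (- (2 * t)).
  by rewrite expr2 -expRD; congr expR; ring.
by [].
Qed.

Lemma OU_bm (t : R) (f : T -> R) (x : T) : bm f ->
  OU t f x = (ou (expR (- t)) f x)%:E.
Proof.
move=> bf; rewrite OU_lin -bm_EFin_int//.
by apply: (bm_comp bf); meas.
Qed.

Variables (f : T -> R) (f0 : forall x, 0 <= f x) (mf : measurable_fun setT f).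

Definition trunc (m : nat) (x : T) : R := Num.min (f x) m%:R.

Lemma trunc_seg m x : 0 <= trunc m x <= m%:R.
Proof. by rewrite /trunc le_min f0 ler0n ge_min lexx orbT. Qed.

Lemma bm_trunc m : bm (trunc m).
Proof.
apply: bm_bounded (trunc_seg m).
exact: measurable_minr.
Qed.

Lemma trunc_nd x : {homo trunc^~ x : m n / (m <= n)%N >-> m <= n}.
Proof.
by move=> m n mn; rewrite /trunc le_min ge_min lexx/= ge_min ler_nat mn orbT.
Qed.

Lemma ou_trunc_nd (t : R) x :
  {homo (fun m => ou (expR (- t)) (trunc m) x) : m n / (m <= n)%N >-> m <= n}.
Proof.
move=> m n mn; apply: Ele => [||y]; last exact: trunc_nd.
- by apply: (bm_comp (bm_trunc m)); meas.
- by apply: (bm_comp (bm_trunc n)); meas.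
Qed.

(** For each y the truncated values are eventually constant in m, so monotone convergence applies,
    also where the limit is +oo. *)
Lemma ou_trunc_cvg (t : R) x :
  ((ou (expR (- t)) (trunc m) x)%:E @[m --> \oo] --> OU t f x)%E.
Proof.
under eq_fun do rewrite -(OU_bm _ _ (bm_trunc _)) OU_lin.
rewrite OU_lin; set L := lin _ _ x.
have mL : measurable_fun setT L by rewrite /L; meas.
rewrite (_ : (\int[gam]_y (f (L y))%:E)%E =
    (\int[gam]_y limn (fun m => (trunc m (L y))%:E))%E).
  apply: cvg_monotone_convergence => //.
  - move=> m; apply/measurable_EFinP; apply: measurableT_comp => //.
    by have [] := bm_trunc m.
  - by move=> m y _; rewrite lee_fin; have /andP[] := trunc_seg m (L y).
  - by move=> y _ m n mn; rewrite lee_fin; exact: trunc_nd.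
apply: eq_integral => y _; apply/esym/cvg_lim => //.
apply: cvg_near_cst.
have := archi_boundP (f0 (L y)); set N := Num.bound _ => fN.
exists N => // m /= Nm; congr EFin; rewrite /trunc; apply/min_idPl.
by rewrite (le_trans (ltW fN))// ler_nat.
Qed.

End truncation.

(** * From bounded functions to the statement with u and v *)

Section hypercontractivity.
Context {R : realType} (d : nat).
Notation T := (d.-tuple R).
Notation gam := (std_gaussian R d).

Lemma u0E (c dc : R -> R) (x : R) : profile c dc ->
  u c 0 x%:E = (prim c x)%:E.
Proof.
move=> pc; rewrite (u_EFin pc); congr EFin.
apply: eq_Rintegral => y /set_mem/=; rewrite in_itv/= => /andP[y0 _].
by rewrite mulr0 expR0 powRr1// ltW// (profile_gt0 pc).
Qed.

(** The bounded case needs a positive lower bound, so the truncation is lifted to [del]. This adds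
    at most [prim c del] to the mean, which the strict gap below [prim c M] absorbs. *)
Lemma hypercontractive_trunc (c dc : R -> R) (pc : profile c dc)
    (t M : R) (f : T -> R) (m : nat) : 0 <= t ->
  supported (fun y => c y / dc y) ->
  (forall x, 0 <= f x) -> measurable_fun setT f ->
  gam.-integrable setT (fun x => u c 0 (f x)%:E) ->
  (\int[gam]_x u c 0 (f x)%:E < (prim c M)%:E)%E ->
  (\int[gam]_x u c t (ou (expR (- t)) (trunc f m) x)%:E <= u c t M%:E)%E.
Proof.
move=> t0 kc f0 mf intf fM.
have pq : profile (fun y => c y `^ expR (2 * t))
    (fun y => expR (2 * t) * c y `^ (expR (2 * t) - 1) * dc y).
  by apply: profile_powR => //; exact: expR_gt0.
rewrite (eq_integral (fun x => (prim c (f x))%:E)) in fM; last first.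
  by move=> x _; rewrite (u0E _ pc).
have intf' : gam.-integrable setT (EFin \o (fun x => prim c (f x))).
  by apply: eq_integrable intf => // x _; rewrite (u0E _ pc).
have s0E : (\int[gam]_x (prim c (f x))%:E)%E = (\int[gam]_x prim c (f x))%:E.
  by rewrite fineK// (integrable_fin_num _ intf').
rewrite s0E lte_fin in fM; set s0 := \int[gam]_x prim c (f x) in s0E fM.
have s00 : 0 <= s0 by apply: Rintegral_ge0 => x _; exact: (prim_ge0 pc).
have M0 : 0 < M.
  rewrite ltNge; apply/negP => /(prim_le0 c) M0.
  by rewrite M0 in fM; lra.
have [del del0] := prim_cont pc (lexx 0) (ltac:(lra) : 0 < prim c M - s0).
rewrite prim0 add0r => Udel.
pose g x := Num.max del (trunc f m x).
have bt := bm_trunc f0 mf m.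
have ts := trunc_seg f0 m.
have gs x : del <= g x <= Num.max del m%:R.
  rewrite /g le_max lexx/= ge_max !le_max lexx/=.
  by have /andP[_ ->] := ts x; rewrite orbT.
have bg : bm g.
  apply: bm_bounded gs; apply: measurable_maxr; first exact: measurable_cst.
  by case: bt.
have bU : bm (fun x => prim c (g x)) by apply: bm_nd => //; exact: (prim_nd pc).
have q1 : 1 <= expR (2 * t) by rewrite -expR0 ler_expR mulr_ge0.
have := hypercontractive_bounded pc del0 kc q1 bg gs.
rewrite expR_sqrtV => h.
have Ug : \int[gam]_x prim c (g x) <= prim c M.
  rewrite -lee_fin bm_EFin_int//.
  apply: (@le_trans _ _ (\int[gam]_x ((prim c del)%:E + (prim c (f x))%:E))%E).
    apply: ge0_le_integral => //.
    - by move=> x _; rewrite lee_fin (prim_ge0 pc).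
    - by apply/measurable_EFinP; case: bU.
    - by apply: emeasurable_funD => //; exact: measurable_int intf'.
    move=> x _; rewrite -EFinD lee_fin /g maxEle; case: ifP => _.
      apply: (@le_trans _ _ (prim c (f x))).
        by apply: (prim_nd pc); rewrite ge_min lexx.
      by rewrite lerDr (prim_ge0 pc).
    by rewrite lerDl (prim_ge0 pc).
  rewrite ge0_integralD//.
  - by rewrite integral_prob_cst s0E -EFinD lee_fin; lra.
  - by move=> x _; rewrite lee_fin (prim_ge0 pc).
  - by move=> x _; rewrite lee_fin (prim_ge0 pc).
  - exact: measurable_int intf'.
have bo : bm (ou (expR (- t)) (trunc f m)) by exact: bm_ou.
have bUo : bm (fun x => prim (fun y => c y `^ expR (2 * t))
    (ou (expR (- t)) (trunc f m) x)).
  by apply: bm_nd => //; exact: (prim_nd pq).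
under eq_integral do rewrite (u_EFin pc).
rewrite (u_EFin pc) -bm_EFin_int// lee_fin.
apply: (@le_trans _ _ (\int[gam]_x prim (fun y => c y `^ expR (2 * t))
    (ou (expR (- t)) g x))).
  apply: Ele => [//||x].
    by apply: bm_nd; [exact: (prim_nd pq)|exact: bm_ou].
  apply: (prim_nd pq); apply: Ele => [||y].
  - by apply: (bm_comp bt); meas.
  - by apply: (bm_comp bg); meas.
  by rewrite /g le_max lexx orbT.
apply: (le_trans h); apply: (prim_nd pq).
by rewrite -(primVK pc (ltW M0)); exact: primV_nd.
Qed.

End hypercontractivity.

Theorem theorem1p1 (R : realType) (d : nat) (c : R -> R)
  (d_ge1 : (1 <= d)%N)
  (c_gt0 : forall y : R, 0 < y -> 0 < c y)
  (c_derivable : forall y : R, 0 < y -> derivable c y 1)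
  (c'_continuous : forall y : R, 0 < y -> {for y, continuous (c^`()%classic)})
  (c'_gt0 : forall y : R, 0 < y -> 0 < (c^`()%classic) y)
  (c_concave : concave_function [set y : R^o | 0 < y]
     (fun y : R^o => c y / (c^`()%classic) y))
  (f : d.-tuple R -> R)
  (f_ge0 : forall x, 0 <= f x)
  (f_measurable : measurable_fun setT f)
  (uf_L1 : (std_gaussian R d).-integrable setT (fun x => u c 0 (f x)%:E)) :
  forall t : R, 0 <= t ->
    (std_gaussian R d).-integrable setT (fun x => u c t (OU t f x)) /\
    (v c t ('N[std_gaussian R d]_1[(fun x => u c t (OU t f x))]) <=
     v c 0 ('N[std_gaussian R d]_1[(fun x => u c 0 (f x)%:E)]))%E.
Proof.
move=> t t0.
have pc : profile c (c^`()%classic).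
  by split => // y y0; rewrite derive1E; exact/derivableP/c_derivable.
have kc := concave_supported c_concave.
set gam := std_gaussian R d.
have pq (s : R) : profile (fun y => c y `^ expR (2 * s))
    (fun y => expR (2 * s) * c y `^ (expR (2 * s) - 1) * (c^`()%classic) y).
  by apply: profile_powR => //; exact: expR_gt0.
have bo m : bm (ou (expR (- t)) (trunc f m)) by apply: bm_ou; exact: bm_trunc.
have o_ge0 m x : 0 <= ou (expR (- t)) (trunc f m) x.
  by apply: Ege0 => y; have /andP[] := trunc_seg f_ge0 m
    (lin (expR (- t)) (Num.sqrt (1 - expR (- t) ^+ 2)) x y).
pose F m x := u c t (ou (expR (- t)) (trunc f m) x)%:E.
have FE m : F m = EFin \o
    (fun x => prim (fun y => c y `^ expR (2 * t)) (ou (expR (- t)) (trunc f m) x)).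
  by apply/funext => x; rewrite /F (u_EFin pc).
have mF m : measurable_fun setT (F m).
  rewrite FE; apply/measurable_EFinP.
  by have [] := bm_nd (prim_nd (pq t)) (bo m).
have Fcvg x : (F m x @[m --> \oo] --> u c t (OU t f x))%E.
  apply: (u_cvg pc) => //.
  - exact: ou_trunc_nd.
  - exact: ou_trunc_cvg.
have mu : measurable_fun setT (fun x => u c t (OU t f x)).
  by apply: (emeasurable_fun_cvg F) => // x _; exact: Fcvg.
have Flim : (\int[gam]_x F m x @[m --> \oo] --> \int[gam]_x u c t (OU t f x))%E.
  rewrite (eq_integral (fun x => limn (F ^~ x))); last first.
    by move=> x _; apply/esym/cvg_lim => //; exact: Fcvg.
  apply: cvg_monotone_convergence => //.
  - by move=> m x _; exact: u_ge0.
  - move=> x _ m n mn; rewrite /F !(u_EFin pc) lee_fin (prim_nd (pq t))//.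
    exact: ou_trunc_nd.
have u0_ge0 x : (0 <= u c 0 (f x)%:E)%E by exact: u_ge0.
have ut_ge0 x : (0 <= u c t (OU t f x))%E by exact: u_ge0.
have s0E : (\int[gam]_x u c 0 (f x)%:E)%E =
    (fine (\int[gam]_x u c 0 (f x)%:E)%E)%:E.
  by rewrite fineK// (integrable_fin_num _ uf_L1).
set s0 := fine _ in s0E.
have s00 : 0 <= s0 by apply: fine_ge0; exact: integral_ge0.
(* The bound on the truncations does not depend on m, so it passes to the limit. *)
have bound M : s0 < prim c M ->
    (\int[gam]_x u c t (OU t f x) <= (prim (fun y => c y `^ expR (2 * t)) M)%:E)%E.
  move=> sM; rewrite -(u_EFin pc).
  apply: cvge_le Flim; near=> m.
  by apply: (hypercontractive_trunc pc) => //; rewrite s0E lte_fin.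
(* Any value above s0 would do here: one finite bound already gives integrability. *)
have [M0 M00 M0E] := prim_surj pc (ltac:(lra) : 0 <= s0 + 1).
have ifin : (\int[gam]_x u c t (OU t f x) < +oo)%E.
  by apply: le_lt_trans (bound M0 _) (ltry _); rewrite M0E; lra.
have intu : gam.-integrable setT (fun x => u c t (OU t f x)).
  apply/integrableP; split => //.
  by under eq_integral do rewrite gee0_abs//.
have L1t : ('N[gam]_1[(fun x => u c t (OU t f x))] =
    \int[gam]_x u c t (OU t f x))%E.
  clear -ut_ge0; rewrite Lnorm1; apply: eq_integral => x _.
  by rewrite gee0_abs.
have L10 : ('N[gam]_1[(fun x => u c 0 (f x)%:E)] =
    \int[gam]_x u c 0 (f x)%:E)%E.
  clear -u0_ge0; rewrite Lnorm1; apply: eq_integral => x _.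
  by rewrite gee0_abs.
have sE : (\int[gam]_x u c t (OU t f x))%E =
    (fine (\int[gam]_x u c t (OU t f x))%E)%:E.
  apply/esym/fineK; clear -intu.
  by apply: integrable_fin_num intu.
set s := fine _ in sE.
have s_ge0 : 0 <= s.
  apply: fine_ge0; clear -ut_ge0.
  by apply: integral_ge0.
have [V0 V00 V0E] := prim_surj pc s00.
have [W W0 WE] := prim_surj (pq t) s_ge0.
split; first exact: intu.
have -> : v c t ('N[gam]_1[(fun x => u c t (OU t f x))]) = W%:E.
  rewrite -[RHS](v_u pc t W0) (u_EFin pc t W) WE.
  by apply: (congr1 (v c t)); exact: etrans L1t sE.
have -> : v c 0 ('N[gam]_1[(fun x => u c 0 (f x)%:E)]) = V0%:E.
  rewrite -[RHS](v_u pc 0 V00) (u0E V0 pc) V0E.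
  by apply: (congr1 (v c 0)); exact: etrans L10 s0E.
rewrite lee_fin leNgt.
(* [bound] asks for a strict inequality, hence the midpoint: it would force [u c t W <= u c t M]
   although [M < W]. *)
apply/negP => VW; pose M := (V0 + W) / 2.
have VM : V0 < M by rewrite /M; clear -VW; lra.
have MW : M < W by rewrite /M; clear -VW; lra.
have := bound M; rewrite sE lee_fin -V0E -WE => /(_ (prim_lt pc V00 VM)).
by rewrite leNgt (prim_lt (pq t) (le_trans V00 (ltW VM)) MW).
Unshelve. all: by end_near.
Qed.
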